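(* Let $\Theta=(\theta_m)_{m\ge1}$ be a sequence of non-negative real numbers such that $g_\Theta$ is of class $\mathcal{F}(r,\theta)$ or of class $e\mathcal{F}(r,\theta,\gamma)$, where $r>0$, $\theta>0$ and $0<\gamma\le1$. Let $K_{0n}$ be the total number of cycles of a random permutation in $S_n$ distributed according to $\mathbb{P}_\Theta$. Then, as $n\to\infty$, $$\frac{K_{0n}-\theta\log n}{\sqrt{\theta\log n}}\xrightarrow{d}\mathcal{N}(0,1).$$
   Context: For $\sigma$ in the symmetric group $S_n$, $C_m^{(n)}(\sigma)$ is the number of cycles of length $m$ in the disjoint cycle decomposition of $\sigma$, and $K_{0n}=\sum_{m=1}^nC_m^{(n)}$. The weighted measure on $S_n$ is $\mathbb{P}_\Theta[\sigma]=\frac{1}{h_n n!}\prod_{m=1}^n\theta_m^{C_m^{(n)}(\sigma)}$, with normalization $h_n=\frac1{n!}\sum_{\sigma\in S_n}\prod_{m=1}^n\theta_m^{C_m^{(n)}(\sigma)}$ (defined whenever $h_n>0$). Put $g_\Theta(t)=\sum_{k\ge1}\frac{\theta_k}{k}t^k$. $\mathcal N(0,1)$ is the standard Gaussian law. For $0<r<R$ and $0<\phi<\pi/2$ let $\Delta_0(r,R,\phi)=\{z\in\mathbb{C}: |z|<R,\ z\ne r,\ |\arg(z-r)|>\phi\}$. A function $g$ is of class $\mathcal{F}(r,\theta)$ if there are $R>r$ and $0<\phi<\pi/2$ such that $g$ is holomorphic in $\Delta_0(r,R,\phi)$, and there is a constant $K$ with $g(t)=\theta\log\frac{1}{1-t/r}+K+O(t-r)$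 as $t\to r$ (in this domain). A function $g$ is of class $e\mathcal{F}(r,\theta,\gamma)$ if $g(t)=\theta\log\frac{1}{1-t/r}+g_0(t)$ with $g_0$ analytic in $\{|t|<r\}$ and $[t^n]g_0=O(r^{-n}n^{-1-\gamma})$, where $[t^n]g_0$ is the coefficient of $t^n$. For the formal power series $g_\Theta$, being of such a class means that it converges near $0$ and its sum (analytically continued if necessary) has the stated properties. *)

(* Defs.v *)
From HB Require Import structures.
From mathcomp Require Import all_boot all_order all_algebra all_fingroup.
From mathcomp Require Import complex.
From mathcomp Require Import all_classical all_reals all_analysis.
Set Implicit Arguments.
Unset Strict Implicit.
Unset Printing Implicit Defensive.
Import Order.TTheory GRing.Theory Num.Theory.
Import numFieldNormedType.Exports.
Local Open Scope classical_set_scope.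
Local Open Scope ring_scope.
Local Open Scope complex_scope.

(* R[i] carries its usual topology through its regular-module alias R[i]^o,
   whose norm `|z| is the modulus, as a nonnegative element of R[i]. *)

Section ComplexFunctions.
Variable R : realType.
Implicit Types (z t : R[i]) (f g : R[i]^o -> R[i]^o) (c : nat -> R[i]^o).

(* Principal argument, with values in ]-pi, pi]; arg 0 is a junk value. *)
Definition carg z : R :=
  let a := acos (complex.Re z / Normc.normc z) in
  if 0 <= complex.Im z then a else - a.

Definition clog z : R[i] := ln (Normc.normc z) +i* carg z.

Definition holomorphic_on (D : set R[i]^o) f : Prop :=
  forall z, D z -> derivable f (z : R[i]^o) (1 : R[i]^o).

Definition has_power_series f c : Prop :=
  \forall t \near (0 : R[i]^o),
    (series (fun k => c k * t ^+ k : R[i]^o)) @ \oo --> (f t : R[i]^o).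

Definition Delta0 (r rho phi : R) : set R[i]^o :=
  [set z : R[i]^o | [/\ Normc.normc z < rho, z != r%:C &
                        phi < `|carg (z - r%:C)|] ].

Definition log_term (r theta : R) t : R[i]^o :=
  theta%:C * clog (1 - t / r%:C)^-1.

Definition class_F (r theta : R) g : Prop :=
  exists rho phi : R, [/\ r < rho, 0 < phi < pi / 2,
    holomorphic_on (Delta0 r rho phi) g &
    exists K : R[i]^o,
      let at_r := within (Delta0 r rho phi) (nbhs (r%:C : R[i]^o)) in
      (fun t : R[i]^o => g t - (log_term r theta t + K) : R[i]^o)
        =O_at_r (fun t : R[i]^o => t - r%:C : R[i]^o)].

Definition class_eF (r theta gamma : R) g : Prop :=
  let D := [set t : R[i]^o | Normc.normc t < r] in
  exists g0 : R[i]^o -> R[i]^o, [/\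
    forall t, D t -> g t = log_term r theta t + g0 t,
    holomorphic_on D g0 &
    exists c : nat -> R[i]^o, has_power_series g0 c /\
      c =O_\oo (fun n => (r ^- n * n%:R `^ (-1 - gamma))%:C : R[i]^o)].

Definition formal_of_class (a : nat -> R) (P : (R[i]^o -> R[i]^o) -> Prop) :=
  exists g, has_power_series g (fun k => (a k)%:C) /\ P g.

(* The coefficient at k = 0 is 0, as x / 0 = 0. *)
Definition g_coef (Theta : nat -> R) (k : nat) : R := Theta k / k%:R.

End ComplexFunctions.

Section WeightedPermutations.
Variables (R : realType) (n : nat).

Definition num_cycles_of_length (m : nat) (s : 'S_n) : nat :=
  #|[set c in porbits s | #|c| == m]%SET|.

Definition total_cycles (s : 'S_n) : nat :=
  (\sum_(1 <= m < n.+1) num_cycles_of_length m s)%N.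

Variable Theta : nat -> R.

Definition perm_weight (s : 'S_n) : R :=
  \prod_(1 <= m < n.+1) Theta m ^+ num_cycles_of_length m s.

Definition perm_norm : R := (n`!%:R)^-1 * \sum_(s : 'S_n) perm_weight s.

(* Meaningful only when [perm_norm] is positive. *)
Definition perm_prob (A : {set 'S_n}) : R :=
  \sum_(s in A) (perm_norm * n`!%:R)^-1 * perm_weight s.

End WeightedPermutations.

(* [F n] is the distribution function of the n-th random variable. *)
Definition cvg_in_distribution (R : realType) (F : nat -> R -> R)
    (mu : probability (measurableTypeR R) R) : Prop :=
  let G := fun x : R => fine (mu [set y : R | y <= x]) in
  forall x : R, {for x, continuous G} -> F n x @[n --> \oo] --> G x.

(* Main.v *)
(* Write [Theta k * r ^ k = theta + e k]. The generating function of the weighted cycle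
   counts is [exp (X * g_Theta t)], so up to the factor [r ^ n] its coefficients are the
   convolution of the Ewens polynomials (constant weights [theta]) with the coefficients of
   [exp (X * \sum_k e k / k * t ^ k)]. If [e] tends to 0 and [\sum_k |e k| / k] is finite, the
   latter have summable l1 norms, and the law of the number of cycles is asymptotically a
   signed mixture of shifted Ewens laws of index [n - k]; these are sums of independent Bernoulli
   variables, and Stein's method gives the Gaussian limit.

   For [eF] the two conditions on [e] follow from uniqueness of power series and the expansion
   of the logarithm. For [F], the function [G = g - log_term - K] is [O(t - r)] in a slit disc, so
   by Cauchy estimates on discs of radius proportional to [|t - r|] its derivative is bounded in
   [|t| < r]. Bessel's inequality for [G (t * cis h) - G t] as [h] tends to 0 then bounds
   [\sum_k e k ^ 2], which implies both conditions by Cauchy-Schwarz. *)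

Require Import Defs.
From HB Require Import structures.
From mathcomp Require Import all_boot all_order all_algebra all_fingroup.
From mathcomp Require Import complex.
From mathcomp Require Import all_classical all_reals all_analysis.
From mathcomp Require Import zify ring lra.
Set Implicit Arguments.
Unset Strict Implicit.
Unset Printing Implicit Defensive.
Import Order.TTheory GRing.Theory Num.Theory.
Import numFieldNormedType.Exports.
Local Open Scope ring_scope.

(** * Cycle index of the symmetric group *)

(** No asymptotic formula for the normalization is needed. Numerator and denominator are both
    compared with the Ewens polynomial of index n at 1, and the same constant, the exponential of
    [\sum_k e k / k], appears in both; it only has to be nonzero. The two conditions on [e] act on
    different ranges of the mixture. Summability of [|e k| / k] dominates the terms with k at most n
    / 2. Beyond that, the Ewens normalization of index n - k may be much larger than that of index n
    (when theta < 1), and [e --> 0] is what makes the coefficients of the perturbation o(1 / n)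
    there. For class F, Bessel's inequality only asks for a bounded holomorphic function inside the
    disc. Applying it to a rotation difference, rather than to the derivative, avoids any termwise
    differentiation, and the coefficients are reached through circle integrals, so that convergence
    of the series of [G] up to radius [r] never has to be proved. *)

Section CycleInsertion.
Variable T : finType.
Implicit Types (s t : {perm T}) (x a b : T).

Lemma porbit_sub_closed s x (B : {set T}) :
  x \in B -> (forall y, y \in B -> s y \in B) -> porbit s x \subset B.
Proof.
move=> xB sB; apply/fintype.subsetP => _ /porbitP[i ->].
by elim: i => [|i IHi]; rewrite ?expg0 ?perm1 // expgSr permM sB.
Qed.

Lemma mem_porbit_perm s x y : y \in porbit s x -> s y \in porbit s x.
Proof.
by move=> /porbitP[i ->]; rewrite -permM -expgSr mem_porbit.
Qed.

Lemma eq_in_porbit s t x :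
  (forall y, y \in porbit t x -> s y = t y) -> porbit s x = porbit t x.
Proof.
move=> st; have E i : (s ^+ i)%g x = (t ^+ i)%g x.
  elim: i => [|i IHi]; rewrite ?expg0 // !expgSr !permM IHi st //.
  exact: mem_porbit.
by apply/setP => u; apply/porbitP/porbitP => -[i ->]; exists i.
Qed.

Section Tperm.
Variables (s : {perm T}) (a b : T).
Hypotheses (sb : s b = b) (ab : a != b).
(** In this product the transposition acts first, so [t] inserts the fixed point [b] between [a] and
    [s a] in the cycle of [a]. *)
Let t := (tperm a b * s)%g.

Lemma tperm_insert_l : t a = b.
Proof. by rewrite permM tpermL. Qed.

Let tb : t b = s a. Proof. by rewrite permM tpermR. Qed.
Let tD x : x != a -> x != b -> t x = s x.
Proof. by move=> xa xb; rewrite permM tpermD // eq_sym. Qed.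

Lemma notin_porbit_fixed : b \notin porbit s a.
Proof.
rewrite porbit_sym; apply: contra ab => /porbitP[i ->]; apply/eqP.
by elim: i => [|i IHi]; rewrite ?expg0 ?perm1 // expgSr permM IHi.
Qed.

Lemma porbit_insert : porbit t a = (b |: porbit s a)%SET.
Proof.
apply/eqP; rewrite finset.eqEsubset; apply/andP; split.
  apply: porbit_sub_closed => [|y]; first by rewrite !inE porbit_id orbT.
  rewrite !inE; have [->|yb] := eqVneq y b.
    by rewrite tb (mem_porbit_perm (porbit_id _ _)) orbT.
  have [->|ya] := eqVneq y a; first by rewrite tperm_insert_l eqxx.
  by rewrite tD //= => /mem_porbit_perm ->; rewrite orbT.
have bt : b \in porbit t a.
  by rewrite -tperm_insert_l (mem_porbit_perm (porbit_id _ _)).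
rewrite finset.subUset finset.sub1set bt /=.
apply: porbit_sub_closed => [|y yt]; first exact: porbit_id.
have [->|yb] := eqVneq y b; first by rewrite sb.
have [->|ya] := eqVneq y a; first by rewrite -tb mem_porbit_perm.
by rewrite -tD // mem_porbit_perm.
Qed.

Lemma porbit_insert_other x :
  x \notin porbit s a -> x != b -> porbit t x = porbit s x.
Proof.
move=> xa xb; apply: eq_in_porbit => y yx.
apply: tD; first by apply: contraNneq xa => <-; rewrite porbit_sym.
apply: contraNneq xb => yb.
move: yx; rewrite yb porbit_sym => /porbitP[i ->]; apply/eqP.
by elim: i => [|i IHi]; rewrite ?expg0 ?perm1 // expgSr permM IHi.
Qed.

End Tperm.
End CycleInsertion.

Section CycleWeights.
Variables (T : finType) (A : comNzRingType) (y : nat -> A).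
Implicit Types (s : {perm T}) (B : {set T}) (a b : T).

(** Restricting to cycles of points of [B] lets the ground set shrink in inductions while the type
    of permutations stays the same: the fixed points outside [B] carry no weight. *)
Definition cycle_weight s B : A := \prod_(c in [set porbit s x | x in B]%SET) y #|c|.

Definition cycle_sum B : A := \sum_(s : {perm T} | perm_on B s) cycle_weight s B.

(* The weight [y] is evaluated at the length of the cycle of [a] plus [j]: deleting a
   point from that cycle then trades one unit of length for one unit of [j]. *)
Definition shifted_cycle_sum a j B : A :=
  \sum_(s : {perm T} | perm_on B s)
    y (#|porbit s a| + j) * cycle_weight s (B :\: porbit s a)%SET.

Lemma cycle_weightD B s a : perm_on B s -> a \in B ->
  cycle_weight s B = y #|porbit s a| * cycle_weight s (B :\: porbit s a)%SET.
Proof.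
move=> sB aB; rewrite /cycle_weight.
have -> : [set porbit s x | x in B]%SET =
    (porbit s a |: [set porbit s x | x in B :\: porbit s a])%SET.
  apply/setP => c; rewrite !inE; apply/imsetP/orP.
    move=> [x xB ->]; have [xa|xa] := boolP (x \in porbit s a).
      by left; rewrite eq_porbit_mem.
    by right; apply: imset_f; rewrite inE xa.
  move=> [/eqP ->|/imsetP[x]]; first by exists a.
  by rewrite inE => /andP[_ xB] ->; exists x.
rewrite big_setU1 //=; apply/negP => /imsetP[x].
rewrite inE => /andP[/negP xa _] e; apply: xa.
by rewrite -eq_porbit_mem e.
Qed.

Lemma cycle_sum_shift B a : a \in B -> cycle_sum B = shifted_cycle_sum a 0 B.
Proof.
move=> aB; apply: eq_bigr => s sB.
by rewrite addn0 (cycle_weightD sB aB).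
Qed.

Lemma perm_on_fixed B a s :
  perm_on (B :\ a) s = perm_on B s && (s a == a).
Proof.
apply/idP/andP => [sB|[sB /eqP sa]].
  split; first by apply: fintype.subset_trans sB _; apply: subsetDl.
  by apply/eqP; apply: (out_perm sB); rewrite !inE eqxx.
apply/fintype.subsetP => x sx; rewrite !inE (fintype.subsetP sB) // andbT.
by apply: contraNneq sx => ->; apply/eqP.
Qed.

(** Split by the image of [a]. If [a] is fixed, its cycle contributes [y j.+1]. Otherwise its image
    [b] is cut out of the cycle by a transposition, a bijection onto the permutations supported on
    [B] minus [b], and [j] records the point removed. *)
Lemma shifted_cycle_sum_rec B a j : a \in B ->
  shifted_cycle_sum a j B = y j.+1 * cycle_sum (B :\ a) +
    \sum_(b in B :\ a) shifted_cycle_sum a j.+1 (B :\ b).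
Proof.
move=> aB; rewrite {1}/shifted_cycle_sum.
rewrite (partition_big (fun s : {perm T} => s a) (mem B)) /=; last first.
  by move=> s sB; rewrite perm_closed.
rewrite (bigD1 a) //=; congr +%R.
  rewrite /cycle_sum big_distrr /=; apply: eq_big => [s|s /andP[sB /eqP sa]].
    by rewrite perm_on_fixed.
  have -> : porbit s a = [set a].
    apply/eqP; rewrite finset.eqEsubset finset.sub1set porbit_id andbT.
    by apply: porbit_sub_closed => [|x]; rewrite !inE // => /eqP ->; rewrite sa.
  by rewrite cards1.
apply: eq_big => [b|b /andP[bB ba]]; first by rewrite !inE andbC.
rewrite (reindex_inj (@mulgI _ (tperm a b))) /=.
have ab : a != b by rewrite eq_sym.
apply: eq_big => [s|s].
  rewrite permM tpermL perm_on_fixed; apply: andb_id2r => /eqP sb.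
  have tB : perm_on B (tperm a b).
    apply/fintype.subsetP => x; rewrite inE.
    by case: tpermP => [->|->|]; rewrite ?eqxx.
  apply/idP/idP => [|sB]; last exact: perm_onM.
  by move=> /(perm_onM tB); rewrite tpermKg.
rewrite permM tpermL => /andP[_ /eqP sb].
rewrite porbit_insert // cardsU1 notin_porbit_fixed //= add1n addSnnS.
congr (_ * _); rewrite /cycle_weight.
have -> : (B :\: (b |: porbit s a) = B :\ b :\: porbit s a)%SET.
  by apply/setP => x; rewrite !inE; case: (x == b); rewrite /= ?andbF.
rewrite (eq_in_imset (g := porbit s)) // => x.
by rewrite !inE => /and3P[xa xb _]; apply: porbit_insert_other.
Qed.

Lemma cycle_sum0 : cycle_sum finset.set0 = 1.
Proof.
rewrite /cycle_sum (bigD1 1%g) ?perm_on1 //= big1 ?addr0.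
  by rewrite /cycle_weight imset0 big_set0.
move=> s /andP[s0 /negP[]]; apply/eqP/permP => x; rewrite perm1.
by apply: (out_perm s0); rewrite inE.
Qed.

End CycleWeights.

Section CycleIndex.
Variables (A : comNzRingType) (y : nat -> A).

(** Iteration of the recursion: [n ^_ k] counts the ordered choices of the k other points on the
    cycle of [a]. The hypothesis on [z] is what strong induction on the cardinality supplies in
    [cycle_sumE]. *)
Lemma shifted_cycle_sum_expand (T : finType) (z : nat -> A) N :
  (forall B : {set T}, (#|B| <= N)%N -> cycle_sum y B = z #|B|) ->
  forall n (B : {set T}) a j, (n <= N)%N -> #|B| = n.+1 -> a \in B ->
  shifted_cycle_sum y a j B =
    \sum_(k < n.+1) (n ^_ k)%:R * y (j + k).+1 * z (n - k)%N.
Proof.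
move=> zN; elim=> [|n IHn] B a j nN Bn aB.
  rewrite shifted_cycle_sum_rec // big_ord1 ffactn0 mul1r addn0.
  have B0 : (B :\ a = finset.set0)%SET.
    by apply/eqP; rewrite -cards_eq0; move: Bn; rewrite (cardsD1 a) aB add1n => -[->].
  by rewrite B0 big_set0 addr0 zN cards0.
have cB b : b \in B -> #|(B :\ b)%SET| = n.+1.
  by move=> bB; move: Bn; rewrite (cardsD1 b) bB add1n => -[].
rewrite shifted_cycle_sum_rec // big_ord_recl ffactn0 mul1r addn0 subn0.
rewrite zN ?cB //; congr +%R.
transitivity (\sum_(b in (B :\ a)%SET)
   \sum_(k < n.+1) (n ^_ k)%:R * y (j.+1 + k).+1 * z (n - k)%N).
  apply: eq_bigr => b; rewrite !inE => /andP[ba bB].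
  apply: IHn; rewrite ?cB //; first exact: ltnW.
  by rewrite !inE eq_sym ba.
rewrite sumr_const cB // -sumrMnl; apply: eq_bigr => k _.
rewrite -!mulrnAl -mulrnA mulnC; congr (_%:R * y _ * z _).
by rewrite lift0 addSnnS.
Qed.

(** The recursion uses all earlier values, so their whole list is carried. The n-th value is n!
    times the coefficient of t ^ n in the exponential of [\sum_k y k / k * t ^ k]. *)
Fixpoint cycle_index_seq (n : nat) : seq A :=
  if n is m.+1 then
    let s := cycle_index_seq m in
    rcons s (\sum_(k < m.+1) (m ^_ k)%:R * y k.+1 * s`_(m - k))
  else [:: 1].

Definition cycle_index n : A := (cycle_index_seq n)`_n.

Lemma size_cycle_index_seq n : size (cycle_index_seq n) = n.+1.
Proof. by elim: n => //= n IHn; rewrite size_rcons IHn. Qed.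

Lemma nth_cycle_index_seq n m :
  (m <= n)%N -> (cycle_index_seq n)`_m = cycle_index m.
Proof.
elim: n => [|n IHn]; first by rewrite leqn0 => /eqP ->.
rewrite leq_eqVlt => /predU1P[-> //|mn].
by rewrite /= nth_rcons size_cycle_index_seq mn IHn.
Qed.

Lemma cycle_indexS n :
  cycle_index n.+1 = \sum_(k < n.+1) (n ^_ k)%:R * y k.+1 * cycle_index (n - k).
Proof.
rewrite /cycle_index /= nth_rcons size_cycle_index_seq ltnn eqxx.
by apply: eq_bigr => k _; rewrite nth_cycle_index_seq // leq_subr.
Qed.

Lemma cycle_sumE (T : finType) (B : {set T}) : cycle_sum y B = cycle_index #|B|.
Proof.
have [n] := ubnP #|B|; elim: n B => // n IHn B; rewrite ltnS => Bn.
case Bm : #|B| => [|m].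
  have -> : B = finset.set0 by apply/eqP; rewrite -cards_eq0 Bm.
  by rewrite cycle_sum0.
have [a aB] : exists a, a \in B by apply/set0Pn; rewrite -card_gt0 Bm.
rewrite (cycle_sum_shift _ aB) (shifted_cycle_sum_expand (z := cycle_index) (N := m)
  _ _ (leqnn m)) ?cycle_indexS //.
by move=> C Cm; apply: IHn; rewrite (leq_ltn_trans Cm) // -Bm.
Qed.

Lemma sum_cycle_weight n :
  \sum_(s : 'S_n) \prod_(c in porbits s) y #|c| = cycle_index n.
Proof.
have := cycle_sumE [set: 'I_n]%SET; rewrite cardsT card_ord => <-.
apply: eq_big => [s|s _].
  by apply/esym/fintype.subsetP => x; rewrite !inE.
rewrite /cycle_weight; suff -> : [set porbit s x | x in [set: 'I_n]]%SET = porbits s by [].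
by apply/setP => d; apply/imsetP/imsetP => -[x _ ->]; exists x; rewrite ?inE.
Qed.

End CycleIndex.

(** * Exponential formula *)

Section FormalExponential.
Variable A : comNzRingType.
Implicit Types (e d : nat -> A).

Definition conv d d' n : A := \sum_(i < n.+1) d i * d' (n - i)%N.

(* [d] is the coefficient sequence of [exp (\sum_(k >= 1) e k / k * t ^ k)]. *)
Definition exp_rec e d := d 0%N = 1 /\
  forall n, n.+1%:R * d n.+1 = \sum_(k < n.+1) e k.+1 * d (n - k)%N.

Let trunc N d : {poly A} := \poly_(i < N) d i.

Let coef_conv N d d' n : (n < N)%N -> (trunc N d * trunc N d')`_n = conv d d' n.
Proof.
move=> nN; rewrite coefM; apply: eq_bigr => i _.
by rewrite !coef_poly (leq_ltn_trans (leq_subr _ _) nN) (leq_ltn_trans _ nN) // -ltnS.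
Qed.

Let coefM_eq (p q s : {poly A}) n :
  (forall i, (i <= n)%N -> p`_i = q`_i) -> (p * s)`_n = (q * s)`_n.
Proof. by move=> pq; rewrite !coefM; apply: eq_bigr => i _; rewrite pq // -ltnS. Qed.

Let exp_rec_trunc N e d n : exp_rec e d -> (n < N)%N ->
  ((trunc N.+1 d)^`())`_n = (trunc N.+1 (e \o S) * trunc N.+1 d)`_n.
Proof.
move=> [_ dS] nN; rewrite coef_deriv coef_poly ltnS nN coef_conv ?ltnS 1?ltnW //.
by rewrite -mulr_natl dS.
Qed.

(** The recursion is the coefficientwise form of D' = E' D, so this is Leibniz's rule for a product
    of exponentials. It is applied to polynomials truncated beyond degree n, whose low coefficients
    agree with those of the formal series. *)
Lemma exp_rec_conv e e' d d' : exp_rec e d -> exp_rec e' d' ->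
  exp_rec (fun k => e k + e' k) (conv d d').
Proof.
move=> ed ed'; split; first by rewrite /conv big_ord1 (proj1 ed) (proj1 ed') mulr1.
move=> n; rewrite -(@coef_conv n.+2) // mulr_natl -coef_deriv derivM coefD.
rewrite (coefM_eq (q := trunc n.+2 (e \o S) * trunc n.+2 d)); last first.
  by move=> i ni; apply: exp_rec_trunc.
rewrite [trunc n.+2 d * _^`()]mulrC.
rewrite (coefM_eq (p := (trunc n.+2 d')^`()) (q := trunc n.+2 (e' \o S) * trunc n.+2 d')); last first.
  by move=> i ni; apply: exp_rec_trunc.
rewrite -!mulrA [trunc _ d' * _]mulrC -coefD -mulrDl coefM.
apply: eq_bigr => i _; rewrite coefD !coef_poly.
have iN : (i < n.+2)%N by apply: ltnW; rewrite ltnS.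
by rewrite iN coef_conv // (leq_ltn_trans (leq_subr _ _)).
Qed.

Lemma exp_rec_uniq e d d' : (forall n, GRing.lreg (n.+1%:R : A)) ->
  exp_rec e d -> exp_rec e d' -> d =1 d'.
Proof.
move=> reg [d0 dS] [d0' dS'] n; have [N] := ubnP n.
elim: N n => // N IHN [_|n]; first by rewrite d0.
rewrite ltnS => nN; apply: (reg n); rewrite dS dS'; apply: eq_bigr => k _.
by rewrite IHN // (leq_ltn_trans (leq_subr _ _)).
Qed.

End FormalExponential.

Lemma exp_rec_morph (A B : comNzRingType) (f : {rmorphism A -> B}) e d :
  exp_rec e d -> exp_rec (f \o e) (f \o d).
Proof.
move=> [d0 dS]; split=> [|n] /=; first by rewrite d0 rmorph1.
rewrite -(rmorph_nat f) -rmorphM dS rmorph_sum; apply: eq_bigr => k _.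
exact: rmorphM.
Qed.

(** * Linear functionals and the l1 norm on polynomials *)

Section PolyFunctional.
Variable R : realFieldType.
Implicit Types (p q : {poly R}) (f g : nat -> R).

(** When [p] is the generating polynomial of an integer statistic, this is the unnormalized mean of
    [f] of that statistic. *)
Definition expectation f p : R := \sum_(i < size p) p`_i * f i.

Lemma expectation_widen f p n : (size p <= n)%N ->
  expectation f p = \sum_(i < n) p`_i * f i.
Proof.
move=> pn; rewrite /expectation (big_ord_widen n (fun i => p`_i * f i)) //.
rewrite big_mkcond; apply: eq_bigr => i _; case: ltnP => // pi.
by rewrite nth_default // mul0r.
Qed.

Lemma expectation0 f : expectation f 0 = 0.
Proof. by rewrite /expectation size_poly0 big_ord0. Qed.

Lemma expectationD f p q : expectation f (p + q) = expectation f p + expectation f q.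
Proof.
pose n := maxn (size p) (size q).
rewrite !(@expectation_widen f _ n) ?leq_maxl ?leq_maxr ?size_polyD // -big_split.
by apply: eq_bigr => i _; rewrite coefD mulrDl.
Qed.

Lemma expectation_sum (I : Type) (r : seq I) (F : I -> {poly R}) f :
  expectation f (\sum_(i <- r) F i) = \sum_(i <- r) expectation f (F i).
Proof.
apply: (big_morph (expectation f)); [exact: expectationD|exact: expectation0].
Qed.

Lemma expectationZ f a p : expectation f (a *: p) = a * expectation f p.
Proof.
rewrite (@expectation_widen f (a *: p) (size p)) ?size_scale_leq // mulr_sumr.
by apply: eq_bigr => i _; rewrite coefZ mulrA.
Qed.

Lemma expectation_mulX f p : expectation f (p * 'X) = expectation (f \o S) p.
Proof.
rewrite (@expectation_widen f _ (size p).+1); last first.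
  by have [->|p0] := eqVneq p 0; rewrite ?mul0r ?size_poly0 // size_mulX.
rewrite big_ord_recl coefMX eqxx mul0r add0r.
by apply: eq_bigr => i _; rewrite lift0 coefMX.
Qed.

Lemma expectationXn f n : expectation f 'X^n = f n.
Proof.
by elim: n f => [|n IHn] f;
  rewrite ?exprSr ?expectation_mulX ?IHn // /expectation size_polyC oner_eq0 big_ord1
     coefC mul1r.
Qed.

Lemma expectation_le f g p : (forall i, 0 <= p`_i) -> (forall i, f i <= g i) ->
  expectation f p <= expectation g p.
Proof. by move=> p0 fg; apply: ler_sum => i _; apply: ler_wpM2l. Qed.

Lemma expectation1 p : expectation (fun=> 1) p = p.[1].
Proof.
by rewrite horner_coef; apply: eq_bigr => i _; rewrite expr1n.
Qed.

Definition l1norm p : R := \sum_(i < size p) `|p`_i|.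

Lemma l1norm_widen p n : (size p <= n)%N -> l1norm p = \sum_(i < n) `|p`_i|.
Proof.
move=> pn; rewrite /l1norm (big_ord_widen n (fun i => `|p`_i|)) //.
rewrite big_mkcond; apply: eq_bigr => i _; case: ltnP => // pi.
by rewrite nth_default // normr0.
Qed.

Lemma l1norm_ge0 p : 0 <= l1norm p. Proof. exact: sumr_ge0. Qed.

Lemma l1norm0 : l1norm 0 = 0.
Proof. by rewrite /l1norm size_poly0 big_ord0. Qed.

Lemma l1normD p q : l1norm (p + q) <= l1norm p + l1norm q.
Proof.
pose n := maxn (size p) (size q).
rewrite !(@l1norm_widen _ n) ?leq_maxl ?leq_maxr ?size_polyD // -big_split.
by apply: ler_sum => i _; rewrite coefD ler_normD.
Qed.

Lemma l1norm_sum (I : Type) (r : seq I) (F : I -> {poly R}) :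
  l1norm (\sum_(i <- r) F i) <= \sum_(i <- r) l1norm (F i).
Proof.
elim/big_rec2: _ => [|i x p _ px]; first by rewrite l1norm0.
by apply: le_trans (l1normD _ _) _; rewrite lerD2l.
Qed.

Lemma l1normZ a p : l1norm (a *: p) = `|a| * l1norm p.
Proof.
rewrite (@l1norm_widen (a *: p) (size p)) ?size_scale_leq // mulr_sumr.
by apply: eq_bigr => i _; rewrite coefZ normrM.
Qed.

Lemma l1norm_mulX p : l1norm (p * 'X) = l1norm p.
Proof.
rewrite (@l1norm_widen _ (size p).+1); last first.
  by have [->|p0] := eqVneq p 0; rewrite ?mul0r ?size_poly0 // size_mulX.
rewrite big_ord_recl coefMX eqxx normr0 add0r.
by apply: eq_bigr => i _; rewrite lift0 coefMX.
Qed.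

Lemma l1norm1 : l1norm 1 = 1.
Proof. by rewrite /l1norm size_poly1 big_ord1 coef1 normr1. Qed.

Lemma expectationM f p q :
  expectation f (p * q) = \sum_(i < size p) p`_i * expectation (fun j => f (i + j)%N) q.
Proof.
suff H n : (size p <= n)%N ->
    expectation f (p * q) = \sum_(i < n) p`_i * expectation (fun j => f (i + j)%N) q.
  exact: H.
elim: n p f => [|n IHn] p f.
  by rewrite leqn0 size_poly_eq0 => /eqP ->; rewrite mul0r expectation0 big_ord0.
have [p0 [a ->]] : exists p0 a, p = p0 * 'X + a%:P.
  by elim/poly_ind: p => [|p0 a _]; [exists 0, 0; rewrite mul0r add0r|exists p0, a].
rewrite size_MXaddC => pn.
rewrite mulrDl expectationD mulrAC expectation_mulX (IHn p0); last first.
  by move: pn; case: ifP => // /andP[/eqP -> _]; rewrite size_poly0.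
rewrite mul_polyC expectationZ big_ord_recl addrC coefD coefMX coefC !eqxx add0r.
congr +%R; apply: eq_bigr => i _.
by rewrite lift0 coefD coefMX coefC addr0.
Qed.

(** Here [p] will be the signed perturbation and [q] an Ewens polynomial: the signs of [p] cost no
    more than its l1 norm once the shifts of [f] are bounded uniformly. *)
Lemma expectation_normM f p q M :
  (forall i, `|expectation (fun j => f (i + j)%N) q| <= M) ->
  `|expectation f (p * q)| <= l1norm p * M.
Proof.
move=> qM; rewrite expectationM; apply: le_trans (ler_norm_sum _ _ _) _.
rewrite mulr_suml; apply: ler_sum => i _; rewrite normrM.
exact: ler_wpM2l.
Qed.

Lemma norm_horner1 p : `|p.[1]| <= l1norm p.
Proof.
rewrite -expectation1; apply: le_trans (ler_norm_sum _ _ _) _.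
by apply: ler_sum => i _; rewrite mulr1.
Qed.

End PolyFunctional.

Section ExponentialPolynomials.
Variable R : realFieldType.
Implicit Types (e : nat -> R).

(* Coefficient of [t ^ n] in [exp ('X * \sum_(k >= 1) e k / k * t ^ k)]. *)
Definition expoly e n : {poly R} := n`!%:R^-1 *: cycle_index (fun k => e k *: 'X) n.

Let natr_poly_lreg n : GRing.lreg (n.+1%:R : {poly R}).
Proof. by apply/lregP; rewrite -polyC_natr polyC_eq0 pnatr_eq0. Qed.

Lemma expoly_rec e : exp_rec (fun k => e k *: 'X) (expoly e).
Proof.
split=> [|n]; first by rewrite /expoly /cycle_index /= invr1 scale1r.
rewrite {1}/expoly cycle_indexS mulr_natl -scaler_nat scalerA factS natrM invfM.
rewrite mulrA divff ?pnatr_eq0 // mul1r scaler_sumr; apply: eq_bigr => k _.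
have kn : (k <= n)%N by rewrite -ltnS.
rewrite -!mulrA mulr_natl -[X in _ *: X = _]scaler_nat scalerA -scalerAr; congr (_ *: _).
rewrite -(ffact_fact kn) natrM invfM mulrAC mulVf ?mul1r //.
by rewrite pnatr_eq0 -lt0n ffact_gt0.
Qed.

Lemma expoly_eq e e' : (forall k, e k.+1 = e' k.+1) -> expoly e =1 expoly e'.
Proof.
move=> ee; apply: (@exp_rec_uniq _ (fun k => e k *: 'X)) => //.
- exact: expoly_rec.
- have [d0 dS] := expoly_rec e'; split=> // n; rewrite dS.
  by apply: eq_bigr => k _; rewrite ee.
Qed.

Lemma expolyS e n : n.+1%:R *: expoly e n.+1 =
  (\sum_(k < n.+1) e k.+1 *: expoly e (n - k)) * 'X.
Proof.
rewrite scaler_nat -mulr_natl (proj2 (expoly_rec e)) mulr_suml.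
by apply: eq_bigr => k _; rewrite -scalerAl [in LHS]mulrC; exact: scalerAl.
Qed.

Lemma expolyD e e' n :
  expoly (fun k => e k + e' k) n = conv (expoly e) (expoly e') n.
Proof.
apply: (@exp_rec_uniq _ (fun k => e k *: 'X + e' k *: 'X)).
- exact: natr_poly_lreg.
- have [d0 dS] := expoly_rec (fun k => e k + e' k); split=> // m; rewrite dS.
  by apply: eq_bigr => k _; rewrite scalerDl.
- by apply: exp_rec_conv; apply: expoly_rec.
Qed.

Lemma expoly_horner1 e : exp_rec e (fun n => (expoly e n).[1]).
Proof.
have := exp_rec_morph (horner_eval (1 : R)) (expoly_rec e).
by move=> [d0 dS]; split=> [|n]; rewrite ?hornerC //; move: d0 (dS n);
  rewrite /= /horner_eval // => _ ->; apply: eq_bigr => k _; rewrite hornerZ hornerX mulr1.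
Qed.

Lemma expoly_ge0 e n i : (forall k, 0 <= e k.+1) -> 0 <= (expoly e n)`_i.
Proof.
move=> e0; have [N] := ubnP n; elim: N n i => // N IHN [|n] i nN.
  by rewrite (proj1 (expoly_rec e)) coef1 ler0n.
rewrite -(@pmulr_rge0 _ n.+1%:R) ?ltr0Sn // -coefZ expolyS coefMX.
case: eqP => // _; rewrite coef_sum; apply: sumr_ge0 => k _; rewrite coefZ.
by rewrite mulr_ge0 // IHN // (leq_ltn_trans (leq_subr _ _)).
Qed.

(** Majorant principle: the triangle inequality is propagated through the recursion, in which
    multiplication by 'X preserves the l1 norm. *)
Lemma l1norm_expoly e n :
  l1norm (expoly e n) <= (expoly (fun k => `|e k|) n).[1].
Proof.
have [d0 dS] := expoly_horner1 (fun k => `|e k|).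
have [N] := ubnP n; elim: N n => // N IHN [|n] nN.
  by rewrite (proj1 (expoly_rec e)) d0 l1norm1.
rewrite -(@ler_pM2l _ n.+1%:R) ?ltr0Sn // dS.
rewrite -[n.+1%:R in leLHS](@ger0_norm _ n.+1%:R) // -l1normZ expolyS l1norm_mulX.
apply: le_trans (l1norm_sum _ _) _; apply: ler_sum => k _; rewrite l1normZ.
by rewrite ler_wpM2l // IHN // (leq_ltn_trans (leq_subr _ _)).
Qed.

(** With constant weights, the sums in two consecutive instances of [expolyS] differ by a single
    term, so the recursion collapses to a product: these are the rising factorials of [th *: 'X]
    divided by n!. Each normalized linear factor is the law of one Bernoulli variable of [ewens]. *)
Lemma expoly_cst th n : expoly (fun=> th) n.+1 =
  n.+1%:R^-1 *: (expoly (fun=> th) n * (th *: 'X + n%:R%:P)).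
Proof.
have nz m : m.+1%:R != 0 :> R by rewrite pnatr_eq0.
apply: (scalerI (nz n)); rewrite [in RHS]scalerA divff // scale1r expolyS.
rewrite -scaler_sumr big_ord_recl subn0 scalerDr mulrDl mulrDr.
rewrite -scalerAl -scalerAr; congr +%R; case: n => [|n].
  by rewrite big_ord0 scaler0 mul0r mulr0.
rewrite [RHS]mulrC mul_polyC expolyS -scaler_sumr.
by congr (_ *: _ * _); apply: eq_bigr => i _; rewrite lift0.
Qed.

End ExponentialPolynomials.

Local Open Scope classical_set_scope.

(** * Ewens distribution *)

Section Ewens.
Variables (R : realType) (th : R).
Hypothesis th_gt0 : 0 < th.
Implicit Types (f g : nat -> R) (n : nat).

(* The sum of independent Bernoulli variables with parameters [th / (th + i)], [i < n]. *)
Fixpoint ewens n f : R :=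
  if n is m.+1 then
    th / (th + m%:R) * ewens m (f \o S) + m%:R / (th + m%:R) * ewens m f
  else f 0%N.

Let thn_gt0 n : 0 < th + n%:R.
Proof. by rewrite ltr_wpDr. Qed.
Let thn_neq0 n : th + n%:R != 0.
Proof. by rewrite gt_eqF. Qed.

Definition ewens_p n : R := th / (th + n%:R).

Let p_ge0 n : 0 <= ewens_p n.
Proof. by rewrite divr_ge0 // ltW. Qed.

Let q_ge0 n : 0 <= n%:R / (th + n%:R).
Proof. by rewrite divr_ge0 // ltW. Qed.

Let qE n : n%:R / (th + n%:R) = 1 - ewens_p n.
Proof. by rewrite /ewens_p; field. Qed.

Let p_le1 n : ewens_p n <= 1.
Proof. by rewrite -subr_ge0 -qE. Qed.

Lemma ewensS n f : ewens n.+1 f =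
  ewens_p n * ewens n (f \o S) + (1 - ewens_p n) * ewens n f.
Proof. by rewrite -qE. Qed.

Lemma ewens_eq n f g : f =1 g -> ewens n f = ewens n g.
Proof. by move=> /funext ->. Qed.

Lemma ewensD n f g : ewens n (fun s => f s + g s) = ewens n f + ewens n g.
Proof.
elim: n f g => // n IHn f g; rewrite !ewensS.
rewrite (ewens_eq _ (g := fun s => (f \o S) s + (g \o S) s)) // !IHn; ring.
Qed.

Lemma ewensZ n a f : ewens n (fun s => a * f s) = a * ewens n f.
Proof.
elim: n f => // n IHn f; rewrite !ewensS.
rewrite (ewens_eq _ (g := fun s => a * (f \o S) s)) // !IHn; ring.
Qed.

Lemma ewensN n f : ewens n (fun s => - f s) = - ewens n f.
Proof. by rewrite -mulN1r -ewensZ; apply: ewens_eq => s; rewrite mulN1r. Qed.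

Lemma ewens_cst n a : ewens n (fun=> a) = a.
Proof.
elim: n => // n IHn; rewrite ewensS (ewens_eq _ (g := fun=> a)) // IHn; ring.
Qed.

Lemma ewens_le n f g : (forall s, f s <= g s) -> ewens n f <= ewens n g.
Proof.
elim: n f g => [|n IHn] f g fg; first exact: fg.
rewrite !ewensS lerD // ler_wpM2l // ?subr_ge0 //; apply: IHn => // s; exact: fg.
Qed.

Lemma ewens_norm n f M : (forall s, `|f s| <= M) -> `|ewens n f| <= M.
Proof.
move=> fM; rewrite ler_norml; apply/andP; split.
  rewrite -(ewens_cst n (- M)); apply: ewens_le => s.
  by have := fM s; rewrite ler_norml => /andP[].
rewrite -(ewens_cst n M); apply: ewens_le => s.
by have := fM s; rewrite ler_norml => /andP[].
Qed.

Lemma expectation_ewens n f :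
  expectation f (expoly (fun=> th) n) = (expoly (fun=> th) n).[1] * ewens n f.
Proof.
elim: n f => [|n IHn] f.
  by rewrite (proj1 (expoly_rec _)) hornerC mul1r; exact: (expectationXn f 0).
rewrite expoly_cst; move: (expoly _ n) IHn => P IHn.
rewrite expectationZ mulrDr -scalerAr expectationD expectationZ.
rewrite expectation_mulX [P * _]mulrC mul_polyC expectationZ !IHn /=.
rewrite hornerZ hornerD !hornerZ hornerMX; move: (ewens n f) (ewens n (f \o S)) => u v.
by field; rewrite thn_neq0 nat1r pnatr_eq0.
Qed.

Definition ewens_mean n : R := \sum_(i < n) ewens_p i.
Definition ewens_var n : R := \sum_(i < n) ewens_p i * (1 - ewens_p i).

Lemma ewens_meanS n : ewens_mean n.+1 = ewens_mean n + ewens_p n.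
Proof. by rewrite /ewens_mean big_ord_recr. Qed.

Lemma ewens_varS n : ewens_var n.+1 = ewens_var n + ewens_p n * (1 - ewens_p n).
Proof. by rewrite /ewens_var big_ord_recr. Qed.

(* [|E[(S - mu) f(S)] - V E[g(S)]| <= V e] when [g] approximates the increments of [f]:
   the error contributed by the n-th Bernoulli variable is weighted by its variance. *)
Lemma ewens_stein n f g e :
  (forall s, `|f s.+1 - f s - g s| <= e) ->
  (forall s, `|f s.+1 - f s - g s.+1| <= e) ->
  `|ewens n (fun s => (s%:R - ewens_mean n) * f s) - ewens_var n * ewens n g|
    <= ewens_var n * e.
Proof.
elim: n f g => [|n IHn] f g fg fg1.
  by rewrite /ewens_mean /ewens_var !big_ord0 /= subrr !mul0r subrr normr0.
rewrite ewens_meanS ewens_varS.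
have := IHn f g fg fg1; have := IHn (f \o S) (g \o S) (fun s => fg s.+1) (fun s => fg1 s.+1).
set mu := ewens_mean n; set V := ewens_var n; set p := ewens_p n.
have p0 : 0 <= p by exact: p_ge0.
have q0 : 0 <= 1 - p by rewrite subr_ge0; exact: p_le1.
have pq : 0 <= p * (1 - p) by rewrite mulr_ge0.
move=> H1 H0; rewrite !ewensS -/p.
have dE h : `|ewens n (fun s => f s.+1 - f s - h s)| <= e ->
    `|ewens n (f \o S) - ewens n f - ewens n h| <= e.
  by rewrite !(ewensD, ewensN) (ewens_eq _ (g := f \o S)).
have D0 := dE g (ewens_norm n fg); have D1 := dE (g \o S) (ewens_norm n fg1).
have -> : ewens n ((fun s => (s%:R - (mu + p)) * f s) \o S) =
    ewens n (fun s => (s%:R - mu) * (f \o S) s) + (1 - p) * ewens n (f \o S).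
  rewrite -ewensZ -ewensD; apply: ewens_eq => s /=; rewrite -natr1; ring.
have -> : ewens n (fun s => (s%:R - (mu + p)) * f s) =
    ewens n (fun s => (s%:R - mu) * f s) - p * ewens n f.
  rewrite -ewensZ -ewensN -ewensD; apply: ewens_eq => s /=; ring.
move: H1 H0 D0 D1; set a1 := ewens n (fun s => _ * (f \o S) s).
set a0 := ewens n (fun s => (s%:R - mu) * f s).
set g1 := ewens n (g \o S); set g0 := ewens n g; set f1 := ewens n (f \o S).
set f0 := ewens n f => H1 H0 D0 D1.
(* Conditioning on the last Bernoulli variable: the discrepancy is the average of the two
   conditional ones, plus the variance p (1 - p) times the average error of [g] and of shifted [g]
   against the increment of [f]. *)
have -> : p * (a1 + (1 - p) * f1) + (1 - p) * (a0 - p * f0) -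
    (V + p * (1 - p)) * (p * g1 + (1 - p) * g0) =
   p * (a1 - V * g1) + (1 - p) * (a0 - V * g0) +
   p * (1 - p) * (p * (f1 - f0 - g1) + (1 - p) * (f1 - f0 - g0)) by ring.
clearbody a1 a0 g1 g0 f1 f0 mu V p.
have cvx (x y E : R) : `|x| <= E -> `|y| <= E -> `|p * x + (1 - p) * y| <= E.
  move=> xE yE; apply: le_trans (ler_normD _ _) _.
  rewrite !normrM (ger0_norm p0) (ger0_norm q0).
  have -> : E = p * E + (1 - p) * E by ring.
  by rewrite lerD // ler_wpM2l.
apply: le_trans (ler_normD _ _) _; rewrite [leRHS]mulrDl lerD ?cvx //.
by rewrite normrM ger0_norm // ler_wpM2l // cvx.
Qed.

Lemma ln_succ_bounds n : (0 < n)%N ->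
  n.+1%:R^-1 <= ln (n.+1%:R : R) - ln n%:R <= n%:R^-1.
Proof.
move=> n0; have np : 0 < n%:R :> R by rewrite ltr0n.
have Sp : 0 < n.+1%:R :> R by rewrite ltr0n.
rewrite -ln_div ?posrE //; apply/andP; split.
  have -> : n.+1%:R / n%:R = (1 + - n.+1%:R^-1)^-1 :> R.
    by rewrite -natr1; field; rewrite addrK natr1 !gt_eqF.
  have x1 : -1 < - n.+1%:R^-1 :> R by rewrite ltrN2 invf_lt1 // ltr1n ltnS.
  rewrite lnV ?posrE; last by rewrite subr_gt0 invf_lt1 // ltr1n ltnS.
  by rewrite lerNr; apply: le_ln1Dx.
have -> : n.+1%:R / n%:R = 1 + n%:R^-1 :> R by rewrite -natr1; field; rewrite gt_eqF.
by apply: le_ln1Dx; rewrite (lt_trans (ltrN10 _)) // invr_gt0.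
Qed.

(** Since 2 / (n (n + 1)) dominates 1 / n ^ 2, the quantity 2 - 2 / n can carry the partial sums of
    1 / n ^ 2 through an induction. *)
Let sq_bound n (c : R) : (0 < n)%N -> 0 <= c ->
  c / n%:R ^+ 2 <= c * (2 - 2 / n.+1%:R) - c * (2 - 2 / n%:R).
Proof.
move=> n0 c0; have np : 1 <= n%:R :> R by rewrite ler1n.
rewrite -(natr1 n); move: (n%:R : R) np => x x1.
rewrite -subr_ge0.
have -> : c * (2 - 2 / (x + 1)) - c * (2 - 2 / x) - c / x ^+ 2 =
    c * (x - 1) / (x ^+ 2 * (x + 1)).
  by field; apply/andP; split; rewrite gt_eqF //; lra.
by rewrite divr_ge0 // mulr_ge0 ?exprn_ge0 //; lra.
Qed.

Lemma ewens_mean_bound : exists C : R, forall n, (0 < n)%N ->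
  `|ewens_mean n - th * ln n%:R| <= C.
Proof.
(* Both th / (th + m) and th (ln (m + 1) - ln m) lie between th / m - c / m ^ 2 and th / m: the
   summand th ^ 2 serves the first and th the second. The 1 in the bound is [ewens_p 0]. *)
pose c := th ^+ 2 + th; have c0 : 0 <= c by rewrite addr_ge0 ?exprn_ge0 // ltW.
exists (1 + c * 2) => -[//|n] _.
suff : `|ewens_mean n.+1 - th * ln n.+1%:R| <= 1 + c * (2 - 2 / n.+1%:R).
  move=> /le_trans; apply; rewrite lerD2l ler_wpM2l // gerBl.
  by rewrite divr_ge0.
elim: n => [|n IHn].
  rewrite /ewens_mean big_ord1 ln1 mulr0 subr0 /ewens_p addr0 divff ?gt_eqF // normr1.
  by rewrite divr1 subrr mulr0 addr0.
rewrite ewens_meanS.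
have -> : ewens_mean n.+1 + ewens_p n.+1 - th * ln n.+2%:R =
  (ewens_mean n.+1 - th * ln n.+1%:R) +
  (ewens_p n.+1 - th * (ln n.+2%:R - ln n.+1%:R)) by ring.
apply: le_trans (ler_normD _ _) _.
have := sq_bound (ltn0Sn n) c0; set m := n.+1 in IHn *.
have /andP[] := ln_succ_bounds (ltn0Sn n); rewrite -/m.
set l := ln m.+1%:R - _ => l1 l2 sb.
have mp : 1 <= m%:R :> R by rewrite ler1n.
have : `|ewens_p m - th * l| <= c / m%:R ^+ 2; last first.
  by move=> H; apply: le_trans (lerD IHn H) _; rewrite -addrA lerD2l -lerBrDl.
have [A B D] : [/\ th / m%:R - c / m%:R ^+ 2 <= ewens_p m, ewens_p m <= th / m%:R &
    th / m%:R - c / m%:R ^+ 2 <= th / m.+1%:R].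
  rewrite /ewens_p /c -(natr1 m); move: (m%:R : R) mp => x x1; have t0 := th_gt0.
  have tx : 0 < th * x by rewrite mulr_gt0 //; lra.
  have t3 : 0 < th ^+ 3 by rewrite exprn_gt0.
  have t2 : 0 < th ^+ 2 by rewrite exprn_gt0.
  split; rewrite -subr_ge0.
  - have -> : th / (th + x) - (th / x - (th ^+ 2 + th) / x ^+ 2) =
       (th ^+ 3 + th ^+ 2 + th * x) / (x ^+ 2 * (th + x)).
      by field; apply/andP; split; rewrite gt_eqF //; lra.
    by rewrite divr_ge0 // ?mulr_ge0 ?exprn_ge0 //; lra.
  - have -> : th / x - th / (th + x) = th ^+ 2 / (x * (th + x)).
      by field; apply/andP; split; rewrite gt_eqF //; lra.
    by rewrite divr_ge0 // ?mulr_ge0 ?exprn_ge0 //; lra.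
  - have -> : th / (x + 1) - (th / x - (th ^+ 2 + th) / x ^+ 2) =
       (th ^+ 2 * (x + 1) + th) / (x ^+ 2 * (x + 1)).
      by field; apply/andP; split; rewrite gt_eqF //; lra.
    by rewrite divr_ge0 // ?addr_ge0 ?mulr_ge0 ?exprn_ge0 //; lra.
have C : th * l <= th / m%:R by rewrite ler_wpM2l // ltW.
have D' : th / m.+1%:R <= th * l by rewrite ler_wpM2l // ltW.
move: (le_trans D D') A B C.
move: (th / m%:R) (c / m%:R ^+ 2) (th * l) (ewens_p m) => x y z p *.
by rewrite ler_norml; apply/andP; split; lra.
Qed.

(** The difference is the sum of the squares of the [ewens_p i]: 1 for i = 0, and at most th ^ 2 / i
    ^ 2 afterwards. *)
Lemma ewens_mean_var : exists C : R, forall n,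
  `|ewens_mean n - ewens_var n| <= C.
Proof.
exists (1 + th ^+ 2 * 2) => -[|n].
  by rewrite /ewens_mean /ewens_var !big_ord0 subrr normr0 addr_ge0 ?mulr_ge0 ?exprn_ge0 ?ltW.
have th2 : 0 <= th ^+ 2 by rewrite exprn_ge0 // ltW.
suff : 0 <= ewens_mean n.+1 - ewens_var n.+1 <= 1 + th ^+ 2 * (2 - 2 / n.+1%:R).
  move=> /andP[h0 h1]; rewrite ger0_norm //; apply: le_trans h1 _.
  by rewrite lerD2l ler_wpM2l // gerBl divr_ge0.
elim: n => [|n IHn].
  rewrite /ewens_mean /ewens_var !big_ord1 /ewens_p addr0 divff ?gt_eqF //.
  by rewrite divr1 !subrr !mulr0 subr0 addr0 ler01 lexx.
rewrite ewens_meanS ewens_varS.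
have := sq_bound (ltn0Sn n) th2; set m := n.+1 in IHn *.
have mp : 1 <= m%:R :> R by rewrite ler1n.
have : ewens_p m ^+ 2 <= th ^+ 2 / m%:R ^+ 2.
  rewrite -expr_div_n ler_sqr ?nnegrE ?p_ge0 ?divr_ge0 ?(ltW th_gt0) //.
  rewrite /ewens_p ler_wpM2l ?(ltW th_gt0) // lef_pV2 ?posrE //.
  by rewrite lerDr ltW.
have : 0 <= ewens_p m ^+ 2 by rewrite exprn_ge0.
move: IHn => /andP[]; move: (ewens_p m) => p.
have -> : p * (1 - p) = p - p ^+ 2 by ring.
move: (p ^+ 2) (th ^+ 2 / m%:R ^+ 2) (th ^+ 2 * (2 - 2 / m.+1%:R))
  (th ^+ 2 * (2 - 2 / m%:R)) (ewens_mean m) (ewens_var m) => ? ? ? ? ? ?.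
by move=> *; apply/andP; split; lra.
Qed.

Lemma ewens_mean_subr n k : `|ewens_mean n - ewens_mean (n - k)| <= k%:R.
Proof.
elim: k => [|k IHk]; first by rewrite subn0 subrr normr0.
apply: le_trans (ler_distD (ewens_mean (n - k)) _ _) _.
rewrite -natr1 lerD // subnS; case: (n - k)%N => [|m]; first by rewrite subrr normr0.
by rewrite ewens_meanS addrC addKr ger0_norm.
Qed.

Lemma ewens_asymptotics k : exists2 C : R, 0 <= C & forall n, (k < n)%N ->
  `|ewens_mean (n - k) - th * ln n%:R| <= C /\
  `|ewens_var (n - k) - th * ln n%:R| <= C.
Proof.
have [C1 H1] := ewens_mean_bound; have [C2 H2] := ewens_mean_var.
have C10 : 0 <= C1 by apply: le_trans (normr_ge0 _) (H1 1%N isT).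
have C20 : 0 <= C2 by apply: le_trans (normr_ge0 _) (H2 0%N).
exists (k%:R + C1 + C2) => [|n kn]; first by rewrite !addr_ge0.
have A : `|ewens_mean (n - k) - th * ln n%:R| <= k%:R + C1.
  apply: le_trans (ler_distD (ewens_mean n) _ _) _.
  rewrite lerD ?H1 ?(leq_ltn_trans _ kn) // distrC; exact: ewens_mean_subr.
split; first by rewrite (le_trans A) // lerDl.
apply: le_trans (ler_distD (ewens_mean (n - k)) _ _) _.
by rewrite addrC lerD // distrC.
Qed.

End Ewens.

Section EwensCLT.
Variables (R : realType) (th : R).
Hypothesis th_gt0 : 0 < th.

Lemma sqrt_ln_near (T : R) :
  \forall n \near \oo, T <= Num.sqrt (th * ln n%:R).
Proof.
near=> n.
have Tn : expR (T ^+ 2 / th) <= n%:R by near: n; exact: nbhs_infty_ger.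
have n0 : 0 < n%:R :> R by apply: lt_le_trans Tn; exact: expR_gt0.
apply: le_trans (ler_norm _) _; rewrite -sqrtr_sqr ler_wsqrtr // mulrC -ler_pdivrMr //.
by rewrite -(expRK (T ^+ 2 / th)) ler_ln ?posrE ?expR_gt0.
Unshelve. all: by end_near. Qed.

(** Stein's method. As h - c = F' - x F, the mean of [h] at the standardized count W is c plus
    E[F'(W)] - E[W F(W)], which [ewens_stein] controls. The shifts by [k] and [j], and the
    replacement of mean and variance by th ln n, move the mean and the variance only by bounded
    amounts, negligible after normalization. *)
Lemma ewens_clt (F D h : R -> R) (c M : R) k j :
  (forall x : R, is_derive x 1 F (D x)) ->
  (forall x : R, `|F x| <= M) -> (forall x : R, `|D x| <= M) ->
  (forall e, 0 < e -> exists2 d, 0 < d &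
     forall x y : R, `|x - y| <= d -> `|D x - D y| <= e) ->
  (forall x : R, h x = D x - x * F x + c) ->
  (fun n => ewens th (n - k)
     (fun s => h (((s + j)%:R - th * ln n%:R) / Num.sqrt (th * ln n%:R))))
    @ \oo --> c.
Proof.
move=> DF FM DM ucD hE.
have M0 : 0 <= M by apply: le_trans (normr_ge0 _) (FM 0).
have [C C0 asym] := ewens_asymptotics th_gt0 k.
apply/cvgrPdist_le => /= e e0.
have [d d0 Dd] := ucD (e / 4) ltac:(by rewrite divr_gt0).
near=> n.
set tau := Num.sqrt _; set a := th * ln n%:R.
have kn : (k < n)%N by near: n; exact: nbhs_infty_gt.
(* What [tau] must exceed: [taud] keeps one step of the standardized count, of size 1 / tau, within
   the modulus of continuity [d] of [D]; [tauC] with [tau1] gives V <= 2 tau ^ 2; [taue] makes each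
   of the two mismatch terms below at most e / 4. *)
have tau1 : 1 <= tau by rewrite /tau; near: n; exact: sqrt_ln_near.
have taud : d^-1 <= tau by rewrite /tau; near: n; exact: sqrt_ln_near.
have tauC : C <= tau by rewrite /tau; near: n; exact: sqrt_ln_near.
have taue : 4 * (C + j%:R) * M / e <= tau by rewrite /tau; near: n; exact: sqrt_ln_near.
have tau0 : 0 < tau by apply: lt_le_trans tau1.
have tau2 : tau ^+ 2 = a.
  by rewrite sqr_sqrtr // ltW // -sqrtr_gt0.
have [] := asym n kn; rewrite -/a; set mu := ewens_mean th (n - k).
set V := ewens_var th (n - k) => muC VC.
pose w (s : nat) := ((s + j)%:R - a) / tau.
pose f s := F (w s); pose g s := D (w s) / tau.
have wS s : w s.+1 = w s + tau^-1 by rewrite /w addSn -natr1; field; rewrite gt_eqF.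
have dS s y : (y = w s) \/ (y = w s.+1) -> `|f s.+1 - f s - D y / tau| <= (e / 4) / tau.
  move=> yE; have wlt : w s <= w s.+1 by rewrite wS lerDl invr_ge0 ltW.
  have [|x xin] := @MVT_segment _ F D _ _ wlt (fun x _ => DF x).
    apply: continuous_subspaceT => x; apply/differentiable_continuous/derivable1_diffP.
    by have [] := DF x.
  rewrite [X in _ = _ * (X - _)]wS addrAC subrr add0r /f => ->.
  rewrite -mulrBl normrM [`|tau^-1|]ger0_norm ?invr_ge0 ?(ltW tau0) //.
  rewrite ler_wpM2r ?invr_ge0 ?(ltW tau0) //; apply: Dd.
  apply: (@le_trans _ _ (tau^-1)); last by rewrite invf_ple ?posrE.
  move: xin; rewrite in_itv /= => /andP[]; rewrite wS => x1 x2.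
  have i0 : 0 < tau^-1 by rewrite invr_gt0.
  by case: yE => ->; rewrite ?wS ler_norml; apply/andP; split; lra.
have := @ewens_stein _ _ th_gt0 (n - k) f g ((e / 4) / tau)
   (fun s => dS s _ (or_introl erefl)) (fun s => dS s _ (or_intror erefl)).
rewrite -/mu -/V; set E := ewens th (n - k) => stein.
set S := E (fun s => _ * f s) in stein.
have -> : E (fun s => h (w s)) = tau * E g - tau^-1 * S - (mu + j%:R - a) / tau * E f + c.
  rewrite /S /E -!ewensZ // -!ewensN // -!ewensD //.
  rewrite -[X in _ + X](ewens_cst th_gt0 (n - k) c) -ewensD //.
  by apply: ewens_eq => s; rewrite hE /g /f /w natrD; field; rewrite gt_eqF.
have Eg : `|E g| <= M / tau.
  apply: ewens_norm => // s; rewrite /g normrM [`|tau^-1|]ger0_norm ?invr_ge0 ?(ltW tau0) //.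
  by rewrite ler_wpM2r ?invr_ge0 ?(ltW tau0).
have Ef : `|E f| <= M by apply: ewens_norm => // s; exact: FM.
(* Three errors: the variance mismatch, the Stein discrepancy, and the mean mismatch including the
   shift [j]. *)
have -> : c - (tau * E g - tau^-1 * S - (mu + j%:R - a) / tau * E f + c) =
    (V - a) / tau * E g + (S - V * E g) / tau + (mu + j%:R - a) / tau * E f.
  by rewrite -tau2; field; rewrite gt_eqF.
have it0 : 0 <= tau^-1 by rewrite invr_ge0 ltW.
have b1 : `|(V - a) / tau * E g| <= C * M / tau.
  rewrite !normrM [`|tau^-1|]ger0_norm //.
  have -> : C * M / tau = C * 1 * (M / tau) by ring.
  by rewrite !ler_pM ?mulr_ge0 // invf_le1.
have b2 : `|(S - V * E g) / tau| <= e / 2.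
  rewrite normrM [`|tau^-1|]ger0_norm //.
  apply: (@le_trans _ _ (V * (e / 4 / tau) / tau)); first by rewrite ler_wpM2r.
  have -> : V * (e / 4 / tau) / tau = V / tau ^+ 2 * (e / 4) by field; rewrite gt_eqF.
  have -> : e / 2 = 2 * (e / 4) by field.
  rewrite ler_wpM2r ?divr_ge0 ?(ltW e0) // ler_pdivrMr ?exprn_gt0 // tau2.
  have : tau <= tau ^+ 2 by rewrite expr2 ler_peMr // ltW.
  by move: VC; rewrite ler_norml tau2 => /andP[]; move: tauC; lra.
have b3 : `|(mu + j%:R - a) / tau * E f| <= (C + j%:R) * M / tau.
  rewrite !normrM [`|tau^-1|]ger0_norm // mulrAC ler_wpM2r // ler_pM //.
  rewrite addrAC; apply: le_trans (ler_normD _ _) _.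
  by rewrite normr_nat lerD2r.
have b4 : C * M / tau <= (C + j%:R) * M / tau.
  by rewrite ler_wpM2r // ler_wpM2r // lerDl.
have b5 : (C + j%:R) * M / tau <= e / 4.
  by rewrite ler_pdivrMr //; move: taue; rewrite ler_pdivrMr //; lra.
apply: le_trans (ler_normD _ _) _; have := ler_normD ((V - a) / tau * E g) ((S - V * E g) / tau).
move: b1 b2 b3 b4 b5; move: (C * M / tau) ((C + j%:R) * M / tau) => u v.
by lra.
Unshelve. all: by end_near. Qed.

End EwensCLT.

(** * Normal distribution and the Stein equation *)

Section RealCalculus.
Variable R : realType.
Implicit Types (f g df u U : R -> R) (a b x y M : R).

Lemma is_derive_continuous f x d : is_derive x 1 f d -> {for x, continuous f}.
Proof. by move=> [df _]; apply/differentiable_continuous/derivable1_diffP. Qed.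

Lemma mean_value f df a b : a <= b ->
  (forall x, a <= x <= b -> is_derive x 1 f (df x)) ->
  exists2 c, a <= c <= b & f b - f a = df c * (b - a).
Proof.
move=> ab fdf; have [||c] := @MVT_segment _ f df _ _ ab.
- by move=> x; rewrite in_itv /= => /andP[ax xb]; apply: fdf; rewrite !ltW.
- apply: derivable_within_continuous => x; rewrite in_itv /= => axb.
  by have [] := fdf _ axb.
by rewrite in_itv /=; exists c.
Qed.

Lemma derive_bound f df a b M : a <= b ->
  (forall x, a <= x <= b -> is_derive x 1 f (df x)) ->
  (forall x, a <= x <= b -> `|df x| <= M) -> `|f b - f a| <= M * (b - a).
Proof.
move=> ab fdf dfM; have [c cab ->] := mean_value ab fdf.
by rewrite normrM [`|b - a|]ger0_norm ?subr_ge0 // ler_wpM2r ?subr_ge0 ?dfM.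
Qed.

Lemma derive_eq f g df a b : a <= b ->
  (forall x, a <= x <= b -> is_derive x 1 f (df x)) ->
  (forall x, a <= x <= b -> is_derive x 1 g (df x)) -> f b - f a = g b - g a.
Proof.
move=> ab fd gd; apply/eqP; rewrite -subr_eq0; apply/eqP.
have [x xab|c _ /eqP] := @mean_value (fun x => f x - g x) (fun=> 0) a b ab.
  by have := is_deriveB (fd x xab) (gd x xab); rewrite subrr.
by rewrite mul0r => /eqP <-; ring.
Qed.

Lemma derive_ge0 f df a b : a <= b ->
  (forall x, a <= x <= b -> is_derive x 1 f (df x)) ->
  (forall x, a <= x <= b -> 0 <= df x) -> f a <= f b.
Proof.
move=> ab fdf df0; have [c cab e] := mean_value ab fdf.
by rewrite -subr_ge0 e mulr_ge0 ?df0 // subr_ge0.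
Qed.

Lemma continuous_bounded_tail f a M : continuous f ->
  (forall x, a <= `|x| -> `|f x| <= M) -> exists B, forall x, `|f x| <= B.
Proof.
move=> cf tl; pose A := `|a| + 1.
have A0 : - A <= A by rewrite /A; have := normr_ge0 a; lra.
have [|c _ cM] := @EVT_max _ (fun x => `|f x|) _ _ A0.
  by apply: continuous_subspaceT => x; apply: continuous_comp; [exact: cf|exact: norm_continuous].
exists (Num.max M `|f c|) => x; rewrite le_max; case: (leP a `|x|) => xa.
  by rewrite tl.
rewrite cM ?orbT // in_itv /= -ler_norml /A (le_trans (ltW xa)) //.
by rewrite (le_trans (ler_norm _)) // lerDl.
Qed.

(** The integral from -N is a primitive only on ]-N, N[. These patches agree once normalized to
    vanish at 0, so N may depend on the point; near [x] the single patch N = |x| + 2 serves every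
    point. *)
Lemma primitive_exists u : continuous u -> exists U, forall x, is_derive x 1 U (u x).
Proof.
move=> cu.
pose P (N x : R) := (\int[lebesgue_measure]_(t in `[- N, x]) u t)%R.
have PE (N x : R) : `|x| < N -> is_derive x 1 (P N) (u x).
  rewrite ltr_norml => /andP[Nx xN].
  have [|dP <-] := @continuous_FTC1_closed _ u (- N) x N xN _ Nx (cu x).
    apply: continuous_compact_integrable; first exact: segment_compact.
    exact: continuous_subspaceT.
  by rewrite derive1E; apply/derivableP.
have PP (N M x : R) : `|x| < N -> `|x| < M -> P N x - P N 0 = P M x - P M 0.
  move=> xN xM; have H (z : R) : `|z| <= `|x| -> is_derive z 1 (P N) (u z) /\
      is_derive z 1 (P M) (u z).
    by move=> zx; split; apply: PE; apply: le_lt_trans zx _.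
  have [x0|x0] := leP 0 x.
    apply: (@derive_eq _ _ u) => // z /andP[z0 zx]; apply H;
      by rewrite !ger0_norm.
  apply: oppr_inj; rewrite !opprB.
  apply: (@derive_eq _ _ u); rewrite ?(ltW x0) // => z /andP[zx z0]; apply H;
    by rewrite !ler0_norm ?lerN2 // ltW.
exists (fun x => P (`|x| + 1) x - P (`|x| + 1) 0) => x.
have H : is_derive x 1 (fun y => P (`|x| + 2) y - P (`|x| + 2) 0) (u x).
  by rewrite -[u x]subr0; apply: is_deriveB; apply: PE; rewrite ltrDl.
apply: near_eq_is_derive H.
near=> y; apply: PP; last first.
  by rewrite ltrDl.
have yx : `|y - x| < 1.
  by rewrite distrC; near: y; apply: (@cvgr_dist_lt _ _ _ _ _ id x) => //; exact: cvg_id.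
rewrite -[y](subrK x) (le_lt_trans (ler_normD _ _)) // addrC ltrD2l.
by rewrite (lt_trans yx) // ltr1n.
Unshelve. all: by end_near. Qed.

End RealCalculus.

Section NormalDistribution.
Variable R : realType.
Implicit Types (x y a b : R).

Definition Phi x : R := fine (normal_prob 0 1 [set y : R | y <= x]).
Definition phi x : R := normal_pdf 0 1 x.

Let phiE x : phi x = normal_peak 1 * expR (- (x ^+ 2) / 2).
Proof.
by rewrite /phi normal_pdfE ?oner_neq0 // /normal_fun subr0 expr1n mulr2n.
Qed.

Lemma phi_gt0 x : 0 < phi x.
Proof. by rewrite phiE mulr_gt0 ?expR_gt0 // normal_peak_gt0 // oner_neq0. Qed.

Lemma is_derive_phi x : is_derive x 1 phi (- (x * phi x)).
Proof.
have -> : phi = fun y => normal_peak 1 * expR (- (y ^+ 2) / 2).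
  by apply/funext => y; exact: phiE.
apply: is_derive_eq; by rewrite /GRing.scale /=; field.
Qed.

Lemma phiN x : phi (- x) = phi x.
Proof. by rewrite !phiE sqrrN. Qed.

Lemma phi_le x : x != 0 -> phi x <= 2 * normal_peak 1 / x ^+ 2.
Proof.
move=> x0; have x2 : 0 < x ^+ 2 by rewrite exprn_even_gt0.
rewrite phiE -[leRHS]mulrA mulrCA ler_wpM2l ?normal_peak_ge0 //.
rewrite mulNr expRN -[2 / _]invf_div lef_pV2 ?posrE ?expR_gt0 ?divr_gt0 //.
by apply: le_trans (expR_ge1Dx _); rewrite lerDr.
Qed.

Lemma is_derive_Phi x : is_derive x 1 Phi (phi x).
Proof.
have xx1 : x < x + 1 by rewrite ltrDl.
have [|//||dP <-] := @continuous_FTC1 _ phi (BInfty _ true) x (x + 1) xx1.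
- exact: (integrableS measurableT _ (@subsetT _ _) (@integrable_normal_pdf R 0 1)).
- by rewrite ltNyr.
- exact: is_derive_continuous (is_derive_phi x).
have -> : Phi = fun x => (\int[lebesgue_measure]_(t in `]-oo, x]) phi t)%R.
  apply/funext => y; rewrite /Phi /normal_prob /Rintegral.
  have -> // : [set z : R | z <= y] = `]-oo, y]%classic.
  by apply/seteqP; split => z /=; rewrite in_itv.
by rewrite derive1E; apply/derivableP.
Qed.

(** The identity, as a random variable under the normal law, presents [Phi] as a [cdf], whence its
    limits at both infinities. *)
Let idT : measurableTypeR R -> R := idfun.

#[local] HB.instance Definition _ :=
  @isMeasurableFun.Build _ _ _ _ idT (@measurable_id _ _ setT).

Let idR : {RV (normal_prob (0 : R) 1 : probability (measurableTypeR R) R) >-> R} := idT.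

Let Phi_cdf : Phi = fine \o cdf idR.
Proof.
apply/funext => x; rewrite /Phi /cdf /distribution /= /pushforward; congr (fine (normal_prob _ _ _)).
Qed.

Lemma Phi_cvgNy : Phi x @[x --> -oo] --> 0.
Proof. rewrite Phi_cdf; apply: fine_cvg; exact: cvg_cdfNy0. Qed.

Lemma Phi_cvgy : Phi x @[x --> +oo] --> (1 : R).
Proof. rewrite Phi_cdf; apply: fine_cvg; exact: cvg_cdfy1. Qed.

Definition vanishes_at_Ny (u : R -> R) :=
  forall e : R, 0 < e -> exists A : R, forall x, x <= A -> `|u x| <= e.

Let phi_vanishes : vanishes_at_Ny phi.
Proof.
move=> e e0; pose k : R := normal_peak 1.
have k0 : 0 <= k by exact: normal_peak_ge0.
exists (- (1 + 2 * k / e)) => x; rewrite lerNr => xA.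
have B : 0 <= 2 * k / e by rewrite divr_ge0 ?mulr_ge0 // ltW.
have x1 : 1 <= - x by lra.
rewrite ger0_norm; last exact/ltW/phi_gt0.
apply: le_trans (phi_le _) _; first by rewrite -oppr_eq0 gt_eqF //; lra.
rewrite -sqrrN ler_pdivrMr ?exprn_gt0 //; last by lra.
have : 2 * k / e <= - x by lra.
rewrite ler_pdivrMr // => /le_trans; apply.
by rewrite mulrC ler_wpM2l ?(ltW e0) // expr2 ler_peMr //; lra.
Qed.

Let vanishesD u v : vanishes_at_Ny u -> vanishes_at_Ny v ->
  vanishes_at_Ny (fun x => u x + v x).
Proof.
move=> hu hv e e0; have e2 : 0 < e / 2 by rewrite divr_gt0.
have [A HA] := hu _ e2; have [B HB] := hv _ e2.
exists (Num.min A B) => x; rewrite le_min => /andP[xA xB].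
rewrite (splitr e); apply: le_trans (ler_normD _ _) _.
by rewrite lerD ?HA ?HB.
Qed.

Let vanishes_le u v B : vanishes_at_Ny u -> (forall x, x <= B -> `|v x| <= `|u x|) ->
  vanishes_at_Ny v.
Proof.
move=> hu vu e e0; have [A HA] := hu _ e0.
exists (Num.min A B) => x; rewrite le_min => /andP[xA xB].
by apply: le_trans (vu _ xB) (HA _ xA).
Qed.

Let PhiE x : (Phi x)%:E = normal_prob 0 1 [set y : R | y <= x].
Proof.
have -> : [set y : R | y <= x] = `]-oo, x]%classic.
  by apply/seteqP; split => z /=; rewrite in_itv.
rewrite Phi_cdf /= fineK; last by apply: fin_num_measure; exact: measurable_itv.
by [].
Qed.

Lemma Phi_ge0 x : 0 <= Phi x.
Proof. by rewrite -lee_fin PhiE. Qed.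

Lemma Phi_le1 x : Phi x <= 1.
Proof. by rewrite -lee_fin PhiE; exact: (@cdf_le1 _ _ _ _ idR). Qed.

Lemma Phi_vanishes : vanishes_at_Ny Phi.
Proof.
move=> e e0; have /cvgrPdist_le /(_ e e0) [A [_ HA]] := Phi_cvgNy.
exists (A - 1) => x xA; have := HA x; rewrite sub0r normrN; apply.
by apply: le_lt_trans xA _; rewrite ltrBlDr ltrDl.
Qed.

Lemma ccdf_vanishes : vanishes_at_Ny (fun x => 1 - Phi (- x)).
Proof.
move=> e e0; have /cvgrPdist_le /(_ e e0) [A [_ HA]] := Phi_cvgy.
exists (- A - 1) => x xA; apply: HA.
by rewrite ltrNr; apply: le_lt_trans xA _; rewrite ltrBlDr ltrDl.
Qed.

Lemma vanishing_ge0 (u du : R -> R) x : vanishes_at_Ny u -> x < 0 ->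
  (forall y, y < 0 -> is_derive y 1 u (du y)) -> (forall y, y < 0 -> 0 <= du y) ->
  0 <= u x.
Proof.
move=> u0 x0 dudu du0; rewrite leNgt; apply/negP => ux.
have [|A HA] := u0 (- u x / 2); first by rewrite divr_gt0 // oppr_gt0.
have yA := HA (Num.min A x); rewrite ge_min lexx /= in yA; have {}yA := yA isT.
have yx : Num.min A x <= x by rewrite ge_min lexx orbT.
have : u (Num.min A x) <= u x.
  by apply: (derive_ge0 yx) => [z /andP[_ zx]|z /andP[_ zx]]; [apply: dudu|apply: du0];
    apply: le_lt_trans x0.
by move: yA; rewrite ler_norml => /andP[]; lra.
Qed.

(** Both bounds come from functions vanishing at -oo with non-negative derivative: - phi / y - U has
    derivative phi / y ^ 2, and U + phi / y - phi / y ^ 3 has derivative 3 phi / y ^ 4. Taking any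
    vanishing primitive [U] covers the lower tail and the reflected upper tail at once. *)
Lemma mills_ratio (U : R -> R) : (forall x : R, is_derive x 1 U (phi x)) ->
  vanishes_at_Ny U -> forall x, x < 0 ->
  0 <= U x /\ 0 <= phi x + x * U x <= phi x / x ^+ 2.
Proof.
move=> dU U0 x x0.
have UE := vanishing_ge0 U0 x0 (fun y _ => dU y) (fun y _ => ltW (phi_gt0 y)).
have u1 : 0 <= - (phi x / x) - U x.
  apply: (@vanishing_ge0 (fun y => - (phi y / y) - U y) (fun y => phi y / y ^+ 2)) => //.
  - apply: vanishesD; last by move=> e /U0[A HA]; exists A => y /HA; rewrite normrN.
    apply: (vanishes_le (B := -1) phi_vanishes) => y y1.
    rewrite normrN normrM normfV ler_piMr // invf_le1 ?normr_gt0; last 1 first.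
      by rewrite ltr0_neq0 //; lra.
    by rewrite ler0_norm; lra.
  - move=> y y0; have y00 : y != 0 by rewrite ltr0_neq0.
    have H1 := is_derive_phi y; have H2 := dU y.
    have H3 := is_deriveV y00 (is_derive_id y (1 : R)).
    apply: (is_derive_eq (is_deriveB (is_deriveN (is_deriveM H1 H3)) H2)).
    by rewrite /GRing.scale /=; field.
  by move=> y y0; rewrite divr_ge0 ?sqr_ge0 // ltW // phi_gt0.
have u2 : 0 <= U x + (phi x / x - phi x / x ^+ 3).
  apply: (@vanishing_ge0 (fun y => U y + (phi y / y - phi y / y ^+ 3))
    (fun y => 3 * phi y / y ^+ 4)) => //.
  - apply: vanishesD => //; apply: vanishesD.
      apply: (vanishes_le (B := -1) phi_vanishes) => y y1.
      rewrite normrM normfV ler_piMr // invf_le1 ?normr_gt0; last 1 first.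
        by rewrite ltr0_neq0 //; lra.
      by rewrite ler0_norm; lra.
    apply: (vanishes_le (B := -1) phi_vanishes) => y y1.
    rewrite normrN normrM normfV ler_piMr // normrX invf_le1; last first.
      by rewrite exprn_gt0 // normr_gt0 ltr0_neq0 //; lra.
    by rewrite exprn_ege1 // ler0_norm; lra.
  - move=> y y0; have y00 : y != 0 by rewrite ltr0_neq0.
    have H1 := is_derive_phi y; have H2 := dU y; have y3 : y ^+ 3 != 0 by rewrite expf_neq0.
    have H3 := is_deriveV y00 (is_derive_id y (1 : R)).
    have H4 := @is_deriveV _ (fun z => z ^+ 3) y _ _ y3 (is_deriveX 3 (is_derive_id y (1 : R))).
    apply: (is_derive_eq (is_deriveD H2 (is_deriveB (is_deriveM H1 H3) (is_deriveM H1 H4)))).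
    by rewrite /GRing.scale /=; field.
  move=> y y0; apply: divr_ge0; last exact: exprn_even_ge0.
  by rewrite mulr_ge0 // ltW // phi_gt0.
split => //; apply/andP; split.
  have -> : phi x + x * U x = - x * (- (phi x / x) - U x) by field; rewrite ltr0_neq0.
  by rewrite mulr_ge0 // oppr_ge0 ltW.
rewrite -subr_ge0.
have -> : phi x / x ^+ 2 - (phi x + x * U x) = - x * (U x + (phi x / x - phi x / x ^+ 3)).
  by field; rewrite ltr0_neq0.
by rewrite mulr_ge0 // oppr_ge0 ltW.
Qed.

End NormalDistribution.

Section SteinEquation.
Variable R : realType.
Implicit Types (x y a b : R).

(** For a < b, a Lipschitz cut-off between the indicators of ]-oo, a] and ]-oo, b]. The Stein
    equation is solved for it rather than for an indicator, so that the derivative of the solution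
    is uniformly continuous. *)
Definition ramp a b x : R := Num.min 1 (Num.max 0 ((b - x) / (b - a))).

Lemma ramp_ge0 a b x : 0 <= ramp a b x.
Proof. by rewrite /ramp le_min ler01 le_max lexx. Qed.

Lemma ramp_le1 a b x : ramp a b x <= 1.
Proof. by rewrite /ramp ge_min lexx. Qed.

Lemma ramp1 a b x : a < b -> x <= a -> ramp a b x = 1.
Proof.
move=> ab xa; have r1 : 1 <= (b - x) / (b - a).
  by rewrite ler_pdivlMr ?subr_gt0 // mul1r lerD2l lerN2.
by rewrite /ramp min_l // le_max r1 orbT.
Qed.

Lemma ramp0 a b x : a < b -> b <= x -> ramp a b x = 0.
Proof.
move=> ab bx; have r0 : (b - x) / (b - a) <= 0.
  by rewrite ler_pdivrMr ?subr_gt0 // mul0r subr_le0.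
by rewrite /ramp (max_l r0) min_r.
Qed.

Lemma ramp_lip a b x y : a < b -> `|ramp a b x - ramp a b y| <= (b - a)^-1 * `|x - y|.
Proof.
move=> ab.
have -> : (b - a)^-1 * `|x - y| = `|(b - x) / (b - a) - (b - y) / (b - a)|.
  rewrite -mulrBl normrM normfV (gtr0_norm (x := b - a)) ?subr_gt0 // mulrC distrC.
  by congr (`|_| * _); ring.
rewrite /ramp; move: (_ / _) (_ / _) => u v.
have clip_min (c p q : R) : `|Num.min c p - Num.min c q| <= `|p - q|.
  wlog pq : p q / p <= q.
    by move=> H; case: (leP p q) => [/H //|/ltW /H]; rewrite distrC [leRHS]distrC.
  rewrite [leRHS]ler0_norm ?subr_le0 //.
  by case: (leP c p) => cp; case: (leP c q) => cq; rewrite ler_norml; apply/andP; split; lra.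
have clip_max (c p q : R) : `|Num.max c p - Num.max c q| <= `|p - q|.
  wlog pq : p q / p <= q.
    by move=> H; case: (leP p q) => [/H //|/ltW /H]; rewrite distrC [leRHS]distrC.
  rewrite [leRHS]ler0_norm ?subr_le0 //.
  by case: (leP c p) => cp; case: (leP c q) => cq; rewrite ler_norml; apply/andP; split; lra.
exact: le_trans (clip_min _ _ _) (clip_max _ _ _).
Qed.

Lemma ramp_continuous a b : a < b -> continuous (ramp a b).
Proof.
move=> ab x; apply/cvgrPdist_le => e e0; near=> y.
apply: le_trans (ramp_lip _ _ ab) _.
have : `|x - y| <= e * (b - a).
  near: y; apply: (@cvgr_dist_le _ _ _ _ _ id x); first exact: cvg_id.
  by rewrite mulr_gt0 ?subr_gt0.
by move=> xy; rewrite mulrC ler_pdivrMr ?subr_gt0.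
Unshelve. all: by end_near. Qed.

(** Far to the left the solution of the Stein equation has the form s U / phi with s = 1 - c; far to
    the right it has this form after reflection, with s = c. The three bounds concern the solution,
    its derivative, and y times its derivative. *)
Lemma stein_tail (U : R -> R) (s y : R) : (forall x : R, is_derive x 1 U (phi x)) ->
  vanishes_at_Ny U -> 0 <= s <= 1 -> y <= -1 ->
  [/\ `|s * U y / phi y| <= 1, `|s * (phi y + y * U y) / phi y| <= 1 &
      `|y * (s * (phi y + y * U y) / phi y)| <= 1].
Proof.
move=> dU U0 /andP[s0 s1] y1; have y0 : y < 0 by lra.
have [Uy /andP[m0 m1]] := mills_ratio dU U0 y0.
have p0 := phi_gt0 y; set m := phi y + y * U y in m0 m1 *.
have ny : 1 <= - y by lra.
have y2 : 0 < y ^+ 2 by rewrite exprn_even_gt0 //= ltr0_neq0.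
have My : m * y ^+ 2 <= phi y by rewrite -ler_pdivlMr.
have y2y : - y <= y ^+ 2 by nra.
have sm0 : 0 <= s * m by rewrite mulr_ge0.
have smm : s * m <= m by rewrite ler_piMl.
split.
- rewrite ger0_norm ?divr_ge0 ?mulr_ge0 ?(ltW p0) // ler_pdivrMr // mul1r.
  apply: le_trans (ler_piMl Uy s1) _; move: m0; rewrite /m; nra.
- rewrite ger0_norm ?divr_ge0 ?(ltW p0) // ler_pdivrMr // mul1r.
  apply: le_trans smm _; apply: le_trans My; rewrite ler_peMr //; lra.
- rewrite normrM ltr0_norm // ger0_norm ?divr_ge0 ?(ltW p0) // mulrA ler_pdivrMr // mul1r.
  apply: le_trans My; rewrite mulrC; apply: ler_pM => //; lra.
Qed.

(** [F] is the integral of (ramp - c) phi over ]-oo, x], divided by phi x, where [c] is the Gaussian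
    mean of the ramp. Tail bounds and continuity give global bounds. *)
Lemma stein_solution a b : a < b -> exists F D : R -> R, exists c M : R,
  [/\ forall x : R, is_derive x 1 F (D x),
      forall x : R, `|F x| <= M /\ `|D x| <= M,
      forall e : R, 0 < e -> exists2 d : R, 0 < d &
        forall x y : R, `|x - y| <= d -> `|D x - D y| <= e,
      forall x : R, ramp a b x = D x - x * F x + c &
      Phi a <= c <= Phi b].
Proof.
move=> ab.
have [A0 dA0] : exists A0 : R -> R, forall x, is_derive x 1 A0 (ramp a b x * phi x).
  apply: primitive_exists => x; apply: cvgM; first exact: ramp_continuous.
  exact: is_derive_continuous (is_derive_phi x).
(* The constant makes [A] equal to [Phi] left of [a], so that [A x] is the integral of ramp * phi
   from -oo. *)
pose A x := A0 x + (Phi a - A0 a).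
have dA x : is_derive x 1 A (ramp a b x * phi x).
  by rewrite -[_ * _]addr0; apply: is_deriveD.
have Aa : A a = Phi a by rewrite /A addrC subrK.
have AL x : x <= a -> A x = Phi x.
  move=> xa; apply: oppr_inj; apply: (@addrI _ (Phi a)); rewrite -{1}Aa.
  apply: (derive_eq xa) => y /andP[xy ya]; last exact: is_derive_Phi.
  by have := dA y; rewrite ramp1 // mul1r.
(* The ramp vanishes beyond [b], so [A] is constant there and [c] is the whole Gaussian integral of
   the ramp. *)
pose c := A b.
have AR x : b <= x -> A x = c.
  move=> bx; apply/eqP; rewrite -subr_eq0; apply/eqP.
  transitivity (cst (0 : R) x - cst (0 : R) b); last by rewrite subrr.
  apply: (@derive_eq _ A (cst (0 : R)) (fun=> 0) b x bx) => y /andP[y1 y2].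
    by have := dA y; rewrite ramp0 // mul0r.
have ca : Phi a <= c.
  rewrite -Aa; apply: (derive_ge0 (ltW ab) (fun x _ => dA x)) => x _.
  by rewrite mulr_ge0 ?ramp_ge0 // ltW // phi_gt0.
have cb : c <= Phi b.
  rewrite -subr_ge0; have -> : 0 = Phi a - A a by rewrite Aa subrr.
  apply: (derive_ge0 (ltW ab) (fun x _ => is_deriveB (is_derive_Phi x) (dA x))) => x _.
  by rewrite subr_ge0 ler_piMl ?ramp_le1 // ltW // phi_gt0.
have Phi0 := @Phi_ge0 R.
have Phi1 := @Phi_le1 R.
have c0 : 0 <= c by apply: le_trans ca.
have c1 : c <= 1 by apply: le_trans cb _.
pose F x := (A x - c * Phi x) / phi x.
pose D x := ramp a b x - c + x * F x.
have pn0 x : phi x != 0 by rewrite gt_eqF // phi_gt0.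
have dF x : is_derive x 1 F (D x).
  have H1 := is_derive_phi x; have H2 := is_derive_Phi x; have H3 := dA x.
  apply: (is_derive_eq (is_deriveM (is_deriveB H3 (is_deriveZ c H2)) (is_deriveV (pn0 x) H1))).
  have -> : (A - c \*: Phi (R:=R)) x = A x - c * Phi x by [].
  by rewrite /GRing.scale /= /D /F; field; exact: pn0.
(* The derivative of x F. Its boundedness, with the Lipschitz ramp, makes [D] Lipschitz. *)
pose G x := F x + x * D x.
have dG x : is_derive x 1 (fun y => y * F y) (G x).
  apply: (is_derive_eq (is_deriveM (is_derive_id x (1 : R)) (dF x))).
  by rewrite /GRing.scale /= /G; ring.
have cF : continuous F by move=> x; exact: is_derive_continuous (dF x).
have cD : continuous D.
  move=> x; apply: cvgD; first by apply: cvgB; [exact: ramp_continuous|exact: cvg_cst].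
  by apply: cvgM; [exact: cvg_id|exact: cF].
have cG : continuous G.
  by move=> x; apply: cvgD; [exact: cF|apply: cvgM; [exact: cvg_id|exact: cD]].
pose T := `|a| + `|b| + 1.
have tail x : T <= `|x| -> [/\ `|F x| <= 1, `|D x| <= 1 & `|x * D x| <= 1].
  have aT : `|a| + 1 <= T by rewrite /T; have := normr_ge0 b; lra.
  have bT : `|b| + 1 <= T by rewrite /T; have := normr_ge0 a; lra.
  have [x0|x0] := leP x 0; [rewrite (ler0_norm x0)|rewrite (gtr0_norm x0)] => xT.
    have xa : x <= a by have := ler_norm (- a); rewrite normrN; lra.
    have x1 : x <= -1 by have := normr_ge0 a; lra.
    have s01 : 0 <= 1 - c <= 1 by apply/andP; split; lra.
    have FE : F x = (1 - c) * Phi x / phi x by rewrite /F AL //; field.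
    have DE : D x = (1 - c) * (phi x + x * Phi x) / phi x.
      by rewrite /D ramp1 // FE; field.
    by rewrite FE DE; apply: stein_tail => //; [exact: is_derive_Phi|exact: Phi_vanishes].
  have bx : b <= x by have := ler_norm b; lra.
  have x1 : - x <= -1 by have := normr_ge0 a; lra.
  have c01 : 0 <= c <= 1 by rewrite c0 c1.
  have [] := @stein_tail (fun z => 1 - Phi (- z)) c (- x) _ _ c01 x1.
  - move=> z; have H1 := is_derive_Phi (- z).
    have H2 : is_derive z 1 (fun y : R => Phi (- y)) (phi (- z) * -1).
      by apply: is_derive1_comp.
    apply: (is_derive_eq (is_deriveB (is_derive_cst (1 : R) z (1 : R)) H2)).
    by rewrite phiN; ring.
  - exact: ccdf_vanishes.
  rewrite opprK phiN.
  have FE : F x = c * (1 - Phi x) / phi x by rewrite /F AR //; field.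
  have DE : D x = - (c * (phi x + - x * (1 - Phi x)) / phi x).
    by rewrite /D ramp0 // FE; field.
  by rewrite FE DE normrN mulrN -mulNr.
have [M1 HM1] := @continuous_bounded_tail _ F T 1 cF (fun x xT => let: And3 h _ _ := tail x xT in h).
have [M2 HM2] := @continuous_bounded_tail _ D T 1 cD (fun x xT => let: And3 _ h _ := tail x xT in h).
have [M3 HM3] : exists M3, forall x, `|G x| <= M3.
  apply: (@continuous_bounded_tail _ G T 2 cG) => x /tail[h1 _ h3].
  by apply: le_trans (ler_normD _ _) _; lra.
exists F, D, c, (Num.max M1 M2); split => //; last by rewrite ca cb.
- by move=> x; rewrite !le_max HM1 HM2 orbT.
- move=> e e0; pose K := (b - a)^-1 + M3.
  have K0 : 0 < K.
    by rewrite /K ltr_wpDr ?invr_gt0 ?subr_gt0 //; apply: le_trans (HM3 0).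
  exists (e / K) => [|x y]; first by rewrite divr_gt0.
  rewrite ler_pdivlMr // => xy; apply: le_trans _ xy.
  have -> : D x - D y = (ramp a b x - ramp a b y) + (x * F x - y * F y) by rewrite /D; ring.
  apply: le_trans (ler_normD _ _) _; rewrite [leRHS]mulrC /K mulrDl lerD ?ramp_lip //.
  wlog yx : x y / y <= x.
    by move=> H; case: (leP y x) => [/H //|/ltW /H]; rewrite distrC [`|y - x|]distrC.
  rewrite [`|x - y|]ger0_norm ?subr_ge0 //.
  exact: (derive_bound yx (fun z _ => dG z) (fun z _ => HM3 z)).
- by move=> x; rewrite /D; ring.
Qed.

End SteinEquation.

(** * Perturbation of the Ewens distribution *)

Section Tannery.
Variable R : realType.
Implicit Types (b t : nat -> R) (S : R).

Lemma partial_sums_tail b S : (forall k, 0 <= b k) ->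
  (forall N, \sum_(k < N) b k <= S) ->
  forall e : R, 0 < e -> exists M, forall N, (M <= N)%N -> \sum_(M <= k < N) b k <= e.
Proof.
move=> b0 bS e e0; pose s N := \sum_(k < N) b k.
have snd : nondecreasing_seq s.
  move=> m n mn; rewrite /s -!(big_mkord xpredT b) (@big_cat_nat _ _ _ m 0 n) //=.
  by rewrite lerDl sumr_ge0.
have scv : cvgn s.
  by apply: (nondecreasing_is_cvgn snd); exists S => _ [N _ <-]; exact: bS.
have /cvgrPdist_le /(_ e e0) [M _ HM] := scv.
exists M => N MN; have := HM M (leqnn M).
have -> : \sum_(M <= k < N) b k = s N - s M.
  by rewrite /s -!(big_mkord xpredT b) (@big_cat_nat _ _ _ M 0 N) //= addrAC subrr add0r.
have sN : s N <= limn s by exact: nondecreasing_cvgn_le.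
have sM : s M <= limn s by exact: nondecreasing_cvgn_le.
by rewrite ger0_norm ?subr_ge0 //; lra.
Qed.

Lemma summable_cvg t b S : (forall k, `|t k| <= b k) ->
  (forall N, \sum_(k < N) b k <= S) -> cvgn (fun N => \sum_(k < N) t k).
Proof.
move=> tb bS.
have -> : (fun N => \sum_(k < N) t k) = series t.
  by apply/funext => N; rewrite /series /= big_mkord.
apply: normed_cvg; apply: nondecreasing_is_cvgn.
  by apply: nondecreasing_series => n _ _; exact: normr_ge0.
exists S => _ [N _ <-]; rewrite /= seriesEord; apply: le_trans (bS N).
exact: ler_sum.
Qed.

(** Dominated convergence for sums whose range grows with n: a fixed head converges termwise, and
    the rest is uniformly small by domination. *)
Lemma tannery b S (T : nat -> nat -> R) (Nn : nat -> nat) t (l : R) :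
  (forall N, \sum_(k < N) b k <= S) ->
  (forall n k, (k < Nn n)%N -> `|T n k| <= b k) ->
  (forall k, 0 <= b k) ->
  (forall M, \forall n \near \oo, (M <= Nn n)%N) ->
  (forall k, T n k @[n --> \oo] --> t k) ->
  (fun N => \sum_(k < N) t k) @ \oo --> l ->
  \sum_(k < Nn n) T n k @[n --> \oo] --> l.
Proof.
move=> bS Tb b0 NnP Tt tl; apply/cvgrPdist_le => e e0.
have e3 : 0 < e / 3 by rewrite divr_gt0.
have [M HM] := partial_sums_tail b0 bS e3.
have /cvgrPdist_le /(_ _ e3) [M' _ HM'] := tl.
pose K := maxn M M'.
have TK : \sum_(k < K) T n k @[n --> \oo] --> \sum_(k < K) t k.
  by apply: cvg_big => [|k _]; [exact: add_continuous|exact: Tt].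
have /cvgrPdist_le /(_ _ e3) TK' := TK.
near=> n.
have Kn : (K <= Nn n)%N by near: n; exact: NnP.
have h1 := HM' K (leq_maxr _ _).
have h2 : `|\sum_(k < K) t k - \sum_(k < K) T n k| <= e / 3 by near: n.
have -> : \sum_(k < Nn n) T n k = \sum_(k < K) T n k + \sum_(K <= k < Nn n) T n k.
  by rewrite -!(big_mkord xpredT (T n)) (@big_cat_nat _ _ _ K 0 (Nn n)).
have h3 : `|\sum_(K <= k < Nn n) T n k| <= e / 3.
  apply: le_trans (ler_norm_sum _ _ _) _.
  apply: le_trans (HM (Nn n) (leq_trans (leq_maxl _ _) Kn)).
  rewrite (@big_cat_nat _ _ _ K M (Nn n)) //= ?leq_maxl //.
  rewrite ler_wpDl ?sumr_ge0 // big_nat [leRHS]big_nat; apply: ler_sum => k /andP[_ kN].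
  exact: Tb.
rewrite /= opprD addrA; apply: le_trans (ler_normB _ _) _.
have := ler_distD (\sum_(k < K) t k) l (\sum_(k < K) T n k).
move: h1 h2 h3; move: (\sum_(K <= k < Nn n) T n k) => z.
move: (\sum_(k < K) t k) (\sum_(k < K) T n k) => x y; lra.
Unshelve. all: by end_near. Qed.

(** With [P] and [Q] truncations of the exponential and of its exponent, non-negativity turns P' =
    Q' P into an inequality P' <= Q' P for x >= 0. Hence P exp (- Q) does not increase on [0, 1],
    and P(1) <= exp (Q(1)). *)
Lemma exp_rec_sum_bound (e c : nat -> R) B : exp_rec e c ->
  (forall k, 0 <= e k.+1) -> (forall n, 0 <= c n) ->
  (forall N, \sum_(k < N) e k.+1 / k.+1%:R <= B) ->
  forall N, \sum_(n < N) c n <= expR B.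
Proof.
move=> [c0 cS] e0 cn0 eB [|N]; first by rewrite big_ord0 expR_ge0.
pose P := \poly_(i < N.+1) c i.
pose Q := \poly_(i < N.+1) (if i is j.+1 then e j.+1 / j.+1%:R else 0).
have Q0 : Q.[0] = 0 by rewrite horner_coef0 coef_poly.
have Q1 : Q.[1] <= B.
  rewrite horner_poly big_ord_recl mul0r add0r; apply: le_trans (eB N).
  by apply: ler_sum => i _; rewrite expr1n mulr1.
have P0 : P.[0] = 1 by rewrite horner_coef0 coef_poly.
have P1 : P.[1] = \sum_(n < N.+1) c n.
  by rewrite horner_poly; apply: eq_bigr => i _; rewrite expr1n mulr1.
have poly_le (p q : {poly R}) x : 0 <= x -> (forall i, p`_i <= q`_i) -> p.[x] <= q.[x].
  move=> x0 pq; pose n := maxn (size p) (size q).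
  rewrite !(@horner_coef_wide _ n) ?leq_maxl ?leq_maxr //.
  by apply: ler_sum => i _; rewrite ler_wpM2r // exprn_ge0.
have Qd i : (Q^`())`_i = if (i < N)%N then e i.+1 else 0.
  rewrite coef_deriv coef_poly ltnS; case: ifP => _; last by rewrite mul0rn.
  by rewrite -[_ *+ _]mulr_natr mulfVK // pnatr_eq0.
have dPQ (x : R) : 0 <= x -> (P^`()).[x] <= (Q^`()).[x] * P.[x].
  move=> x0; rewrite -hornerM; apply: poly_le => // i.
  rewrite coef_deriv coef_poly ltnS coefM; case: (ltnP i N) => iN; last first.
    rewrite mul0rn; apply: sumr_ge0 => j _; rewrite Qd coef_poly mulr_ge0 //.
      by case: ifP.
    by case: ifP.
  rewrite -mulr_natl cS; apply: ler_sum => j _; rewrite Qd coef_poly.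
  have jN : (j < N)%N by apply: leq_ltn_trans iN; rewrite -ltnS.
  by rewrite jN ltnS (leq_trans (leq_subr _ _)) // ltnW.
pose g x := P.[x] * expR (- Q.[x]).
have dh (p : {poly R}) (x : R) : is_derive x 1 (horner p) (p^`()).[x].
  by rewrite derivE derive1E; apply/derivableP; exact: derivable_horner.
have dg (x : R) : is_derive x 1 g (((P^`()).[x] - (Q^`()).[x] * P.[x]) * expR (- Q.[x])).
  have H1 := dh P x; have H2 := dh Q x.
  have H3 : is_derive x 1 (fun y => expR (- Q.[y])) (expR (- Q.[x]) * - (Q^`()).[x]).
    by apply: is_derive1_comp.
  by apply: (is_derive_eq (is_deriveM H1 H3)); rewrite /GRing.scale /=; ring.
have : - g 0 <= - g 1.
  apply: (derive_ge0 ler01 (fun x _ => is_deriveN (dg x))) => x /andP[x0 _].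
  rewrite oppr_ge0 mulr_le0_ge0 ?expR_ge0 // subr_le0; exact: dPQ.
rewrite lerN2 /g P0 Q0 oppr0 expR0 mul1r P1 expRN ler_pdivrMr ?expR_gt0 // mul1r.
by move/le_trans; apply; rewrite ler_expR.
Qed.

End Tannery.

Section PerturbedEwens.
Variables (R : realType) (th : R) (e : nat -> R) (B : R).
Hypothesis th_gt0 : 0 < th.
Hypothesis eB : forall N, \sum_(k < N) `|e k.+1| / k.+1%:R <= B.
Hypothesis e_cvg0 : e @ \oo --> 0.

Let Dbar n : R := (expoly (fun k => `|e k|) n).[1].
Let S := expR B.
Let b n := expoly (fun=> th) n.
Let d n := expoly e n.

Let Dbar_ge0 n : 0 <= Dbar n.
Proof. by apply: le_trans (l1norm_expoly e n); exact: l1norm_ge0. Qed.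

Let Dbar_sum N : \sum_(n < N) Dbar n <= S.
Proof.
apply: (exp_rec_sum_bound (expoly_horner1 (fun k => `|e k|))) => // [k|]; exact: normr_ge0.
Qed.

Let d_le n : `|(d n).[1]| <= Dbar n.
Proof. exact: le_trans (norm_horner1 _) (l1norm_expoly _ _). Qed.

(** By the recursion, [n * Dbar n] is a convolution of [|e|], which tends to 0, with the summable
    sequence [Dbar]. *)
Let Dbar_cvg0 : (n%:R * Dbar n) @[n --> \oo] --> 0.
Proof.
rewrite -(cvg_shiftS (fun n => n%:R * Dbar n)).
have dS n : n.+1%:R * Dbar n.+1 = \sum_(k < n.+1) `|e (n - k).+1| * Dbar k.
  rewrite (proj2 (expoly_horner1 (fun k => `|e k|))) (reindex_inj rev_ord_inj) /=.
  by apply: eq_bigr => k _; rewrite subSS subKn // -ltnS.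
under eq_fun do rewrite dS.
have [E HE] : exists E, forall k, `|e k| <= E.
  have /cvg_seq_bounded [E0 [_ HE]] : cvgn e by apply/cvg_ex; exists 0.
  by exists (E0 + 1) => k; apply: (HE (E0 + 1)); rewrite ?ltrDl.
have E0 : 0 <= E by apply: le_trans (HE 0%N).
apply: (@tannery _ (fun k => E * Dbar k) (E * S)
  (fun n k => `|e (n - k).+1| * Dbar k) succn (fun=> 0)).
- by move=> N; rewrite -mulr_sumr ler_wpM2l.
- by move=> n k _; rewrite normrM normr_id (ger0_norm (Dbar_ge0 k)) ler_wpM2r.
- by move=> k; rewrite mulr_ge0.
- by move=> M; near=> n; apply: leqW; near: n; exact: nbhs_infty_ge.
- move=> k; rewrite -(mul0r (Dbar k)); apply: cvgM; last exact: cvg_cst.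
  rewrite -[X in _ --> X](@normr0 _ R); apply: cvg_norm.
  rewrite -(cvg_shiftn k); under eq_fun do rewrite addnK.
  by move: e_cvg0; rewrite -(cvg_shiftS e).
- by under eq_fun do rewrite big1 //; exact: cvg_cst.
Unshelve. all: by end_near. Qed.

Let limD : R := limn (fun N => \sum_(k < N) (d k).[1]).

Let limD_cvg : (fun N => \sum_(k < N) (d k).[1]) @ \oo --> limD.
Proof. exact: (summable_cvg d_le Dbar_sum). Qed.

Lemma expoly0 n : expoly (fun=> 0 : R) n = (n == 0%N)%:R.
Proof.
case: n => [|n]; first exact: (proj1 (expoly_rec _)).
apply: (@scalerI _ _ n.+1%:R); first by rewrite pnatr_eq0.
by rewrite expolyS big1 ?mul0r ?scaler0 // => k _; rewrite scale0r.
Qed.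

(** The Cauchy product with the coefficients attached to [- e] is the constant series 1, so [limD]
    has an inverse. *)
Let limD_neq0 : limD != 0.
Proof.
pose dm n := expoly (fun k => - e k) n.
pose Sm N := \sum_(k < N) (dm k).[1].
have dm_le n : `|(dm n).[1]| <= Dbar n.
  apply: le_trans (norm_horner1 _) (le_trans (l1norm_expoly _ _) _).
  by rewrite (expoly_eq (e' := fun k => `|e k|)) // => k; rewrite normrN.
have Sm_cvg : Sm @ \oo --> limn Sm by exact: (summable_cvg dm_le Dbar_sum).
have Sm_le N : `|Sm N| <= S.
  by apply: le_trans (ler_norm_sum _ _ _) (le_trans (ler_sum _ _) (Dbar_sum N)).
have E N : \sum_(k < N.+1) (d k).[1] * Sm (N - k).+1 = 1.
  transitivity (\sum_(n < N.+1) (conv d dm n).[1]); last first.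
    rewrite big_ord_recl big1 ?addr0 => [|n _]; rewrite -expolyD
      (expoly_eq (e' := fun=> 0)) ?expoly0 ?hornerC // => k; exact: subrr.
  have -> : \sum_(n < N.+1) (conv d dm n).[1] = \sum_(n < N.+1)
      \sum_(i < N.+1 | (i <= n)%N) (d i).[1] * (dm (n - i)%N).[1].
    apply: eq_bigr => n _; rewrite /conv horner_sum (big_ord_widen N.+1
      (fun i => (d i * dm (n - i)%N).[1])) //.
    by apply: eq_big => [i|i _]; rewrite ?ltnS // hornerM.
  rewrite (exchange_big_dep xpredT) //=; apply: eq_bigr => k _.
  rewrite -mulr_sumr; congr (_ * _); rewrite /Sm.
  rewrite -(big_mkord xpredT (fun j => (dm j).[1])).
  rewrite -(big_mkord (fun n => (k <= n)%N) (fun n => (dm (n - k)%N).[1])).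
  rewrite (@big_cat_nat _ _ _ k 0 N.+1) //=; last by rewrite ltnW // ltn_ord.
  rewrite [X in _ = X + _]big_nat_cond [X in _ = X + _]big1 ?add0r; last first.
    by move=> n /= /andP[nk]; rewrite leqNgt nk.
  rewrite -{2}(add0n (k : nat)) big_addn subSn -1?ltnS //.
  by apply: eq_big => [j|j _]; rewrite ?leq_addl // addnK.
have lim1 : (fun N => \sum_(k < N) (d k).[1] * limn Sm) @ \oo --> limD * limn Sm.
  by under eq_fun do rewrite -mulr_suml; apply: cvgM; [exact: limD_cvg|exact: cvg_cst].
have lim2 := @tannery _ (fun k => Dbar k * S) (S * S)
   (fun N k => (d k).[1] * Sm (N - k).+1) succn (fun k => (d k).[1] * limn Sm)
   (limD * limn Sm) _ _ _ _ _ lim1.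
have h : (fun=> 1 : R) @ \oo --> limD * limn Sm.
  have <- : (fun N => \sum_(k < N.+1) (d k).[1] * Sm (N - k).+1) = fun=> 1.
    by apply/funext => N; exact: E.
  apply: lim2.
  - by move=> N; rewrite -mulr_suml ler_wpM2r ?expR_ge0.
  - by move=> n k _; rewrite normrM ler_pM.
  - by move=> k; rewrite mulr_ge0 ?expR_ge0.
  - by move=> M; near=> n; apply: leqW; near: n; exact: nbhs_infty_ge.
  - move=> k; apply: cvgM; first exact: cvg_cst.
    rewrite -(cvg_shiftn k); under eq_fun do rewrite addnK.
    by move: Sm_cvg; rewrite -(cvg_shiftS Sm).
have E1 : limD * limn Sm = 1.
  by rewrite -(cvg_lim (@Rhausdorff R) h) lim_cst //; exact: Rhausdorff.
by apply/negP => /eqP l0; move/eqP: E1; rewrite l0 mul0r eq_sym oner_eq0.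
Unshelve. all: by end_near. Qed.

Let b1 n : R := (b n).[1].

Let b1S n : b1 n.+1 = (th + n%:R) / n.+1%:R * b1 n.
Proof.
rewrite /b1 /b expoly_cst; move: (expoly _ n) => P.
rewrite hornerZ hornerM hornerD hornerZ hornerX hornerC mulr1.
by ring.
Qed.

Lemma expoly_cst_gt0 n : 0 < (expoly (fun=> th) n).[1].
Proof.
rewrite -/(b n) -/(b1 n); elim: n => [|n IHn]; first by rewrite /b1 /b (proj1 (expoly_rec _)) hornerC.
by rewrite b1S mulr_gt0 // divr_gt0 // ltr_wpDr.
Qed.

Let b1_gt0 n : 0 < b1 n. Proof. exact: expoly_cst_gt0. Qed.

(** [m * b1 m] is nondecreasing in m, since (m + 1) b1 (m + 1) = (th + m) b1 m. *)
Let b1_half n k : (k <= n./2)%N -> b1 (n - k) <= 2 * b1 n.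
Proof.
move=> kn; have mono m j : m%:R * b1 m <= (m + j)%:R * b1 (m + j).
  elim: j => [|j IHj]; first by rewrite addn0.
  apply: le_trans IHj _; rewrite addnS; move: (m + j)%N => q.
  rewrite b1S mulrA mulrCA divff ?pnatr_eq0 // mulr1 ler_wpM2r ?(ltW (b1_gt0 _)) //.
  by rewrite lerDr ltW.
have [->|n0] := eqVneq n 0%N; first by have := b1_gt0 0; lra.
have kn' : (k <= n)%N by apply: leq_trans kn _; rewrite -divn2 leq_div.
have := mono (n - k)%N k; rewrite subnK //.
have h : (n <= 2 * (n - k))%N by lia.
have n0' : 0 < n%:R :> R by rewrite ltr0n lt0n.
have nk : n%:R <= 2 * (n - k)%:R :> R by rewrite -natrM ler_nat.
have B0 := b1_gt0 (n - k).
move=> H; rewrite -(@ler_pM2l _ n%:R) //; apply: (@le_trans _ _ (2 * (n - k)%:R * b1 (n - k))).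
  by rewrite ler_wpM2r ?(ltW B0).
by rewrite mulrCA -mulrA ler_wpM2l.
Qed.

Let b1_ratio k : b1 (n - k) / b1 n @[n --> \oo] --> (1 : R).
Proof.
rewrite -(cvg_shiftn k); under eq_fun do rewrite addnK.
have r1 : b1 n / b1 n.+1 @[n --> \oo] --> (1 : R).
  have -> : (fun n => b1 n / b1 n.+1) = fun n => 1 + (1 - th) / (th + n%:R).
    apply/funext => n; rewrite b1S; have := b1_gt0 n => bn.
    rewrite -natr1; field.
    by rewrite !gt_eqF // ?ltr_wpDr // ltr_wpDl.
  rewrite -[X in _ --> X]addr0; apply: cvgD; first exact: cvg_cst.
  rewrite -(mulr0 (1 - th)); apply: cvgM; first exact: cvg_cst.
  apply/cvgrPdist_le => eps eps0; near=> n.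
  have thn : 0 < th + n%:R by rewrite ltr_wpDr.
  rewrite sub0r normrN ger0_norm ?invr_ge0 ?(ltW thn) // invf_ple ?posrE //.
  apply: (@le_trans _ _ n%:R); last by rewrite lerDr ltW.
  by near: n; exact: nbhs_infty_ger.
elim: k => [|k IHk].
  have -> : (fun n => b1 n / b1 (n + 0)%N) = fun=> 1.
    by apply/funext => n; rewrite addn0 divff // gt_eqF.
  exact: cvg_cst.
have -> : (fun n => b1 n / b1 (n + k.+1)%N) =
    fun n => (b1 n / b1 (n + k)%N) * (b1 (n + k)%N / b1 (n + k).+1).
  by apply/funext => n; rewrite addnS mulrA mulfVK // gt_eqF.
have h : (fun n => b1 (n + k)%N / b1 (n + k).+1) @ \oo --> (1 : R).
  by rewrite (cvg_shiftn k (fun n => b1 n / b1 n.+1)).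
have H := cvgM IHk h; rewrite mulr1 in H; exact: H.
Unshelve. all: by end_near. Qed.

(** This is the sum of all Ewens normalizations, by which the terms k > n / 2 of the mixture are
    bounded. *)
Let b1_sum n : n%:R * b1 n = th * \sum_(k < n) b1 k.
Proof.
elim: n => [|n IHn]; first by rewrite mul0r big_ord0 mulr0.
rewrite big_ord_recr /= mulrDr -IHn b1S mulrA mulrCA divff ?pnatr_eq0 //.
by rewrite mulr1 addrC mulrDl.
Qed.

(** The mixture is cut at n / 2. Below, [b1_half] dominates the terms and [tannery] applies. Above,
    the ratio b1 (n - k) / b1 n is unbounded when th < 1; there [Dbar k] is o(1 / n), and [b1_sum]
    bounds the sum of the ratios by n / th. The constant [D] does not depend on [f]. *)
Lemma perturbed_ewens_limit : exists2 D : R, D != 0 &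
  forall (f : nat -> nat -> R) (c : R),
  (forall n s, `|f n s| <= 1) ->
  (forall k j, ewens th (n - k) (fun s => f n (s + j)%N) @[n --> \oo] --> c) ->
  expectation (f n) (expoly (fun k => th + e k) n) / (expoly (fun=> th) n).[1]
    @[n --> \oo] --> D * c.
Proof.
exists limD => [|f c]; first exact: limD_neq0.
move=> f1 fc.
have HE n : expoly (fun k => th + e k) n = \sum_(k < n.+1) d k * b (n - k)%N.
  rewrite -[RHS]/(conv d b n) /d /b -expolyD.
  by apply: expoly_eq => k; rewrite addrC.
pose T n k := expectation (f n) (d k * b (n - k)%N) / b1 n.
have bE n g : expectation g (b n) = b1 n * ewens th n g by exact: expectation_ewens.
have Tle n k : `|T n k| <= Dbar k * (b1 (n - k) / b1 n).
  rewrite /T normrM normfV (gtr0_norm (b1_gt0 n)) mulrA ler_wpM2r ?invr_ge0 ?(ltW (b1_gt0 n)) //.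
  apply: (@le_trans _ _ (l1norm (d k) * b1 (n - k))).
    apply: expectation_normM => i; rewrite bE normrM (gtr0_norm (b1_gt0 _)) ler_piMr ?(ltW (b1_gt0 _)) //.
    exact: ewens_norm.
  by rewrite ler_wpM2r ?(ltW (b1_gt0 _)) //; exact: l1norm_expoly.
have TE n : expectation (f n) (expoly (fun k => th + e k) n) / b1 n =
    \sum_(k < n./2.+1) T n k + \sum_(n./2.+1 <= k < n.+1) T n k.
  rewrite HE expectation_sum mulr_suml -!(big_mkord xpredT (T n)).
  by rewrite (@big_cat_nat _ _ _ n./2.+1) //= ltnS; lia.
have -> : (fun n => expectation (f n) (expoly (fun k => th + e k) n) /
     (expoly (fun=> th) n).[1]) =
   fun n => \sum_(k < n./2.+1) T n k + \sum_(n./2.+1 <= k < n.+1) T n k.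
  by apply/funext.
rewrite -[X in _ --> X]addr0; apply: cvgD.
  apply: (@tannery _ (fun k => 2 * Dbar k) (2 * S) T (fun n => n./2.+1)
    (fun k => (d k).[1] * c)).
  - by move=> N; rewrite -mulr_sumr ler_wpM2l.
  - move=> n k kn; apply: le_trans (Tle n k) _; rewrite mulrC ler_wpM2r //.
    by rewrite ler_pdivrMr // b1_half // -ltnS.
  - by move=> k; rewrite mulr_ge0.
  - move=> M; near=> n; have : (2 * M <= n)%N by near: n; exact: nbhs_infty_ge.
    by lia.
  - move=> k; rewrite -expectation1 /expectation mulr_suml.
    have -> : (fun n => T n k) = fun n => \sum_(i < size (d k))
        (d k)`_i * 1 * (b1 (n - k) / b1 n * ewens th (n - k) (fun s => f n (s + i)%N)).
      apply/funext => n; rewrite /T expectationM mulr_suml; apply: eq_bigr => i _.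
      rewrite bE (ewens_eq _ _ (g := fun s => f n (s + i)%N)); last by move=> s; rewrite addnC.
      by ring.
    apply: cvg_big => [|i _]; first exact: add_continuous.
    apply: cvgM; first exact: cvg_cst.
    by rewrite -[X in _ --> X]mul1r; apply: cvgM; [exact: b1_ratio|exact: fc].
  - by under eq_fun do rewrite -mulr_suml; apply: cvgM; [exact: limD_cvg|exact: cvg_cst].
apply/cvgrPdist_le => eps eps0.
(* For n <= 2 k, the bound k * Dbar k <= eps * th / 2 gives Dbar k <= eps * th / n, and the factor
   th / n cancels against [b1_sum]. *)
have eth : 0 < eps * th / 2 by rewrite divr_gt0 ?mulr_gt0.
have /cvgrPdist_le /(_ _ eth) [M _ HM] := Dbar_cvg0.
near=> n.
have Mn : (2 * M <= n)%N by near: n; exact: nbhs_infty_ge.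
have n0 : (0 < n)%N by near: n; exact: nbhs_infty_gt.
have n0' : 0 < n%:R :> R by rewrite ltr0n.
rewrite sub0r normrN; apply: le_trans (ler_norm_sum _ _ _) _.
apply: (@le_trans _ _ (\sum_(n./2.+1 <= k < n.+1) eps * th / n%:R * (b1 (n - k) / b1 n))).
  rewrite big_nat [leRHS]big_nat; apply: ler_sum => k /andP[nk kn].
  apply: le_trans (Tle n k) _; rewrite ler_wpM2r ?divr_ge0 ?(ltW (b1_gt0 _)) //.
  have := HM k; rewrite sub0r normrN ger0_norm ?mulr_ge0 // => /(_ _) HD.
  have k2 : n%:R <= 2 * k%:R :> R by rewrite -natrM ler_nat; lia.
  have HD' : k%:R * Dbar k <= eps * th / 2 by apply: HD => /=; lia.
  rewrite ler_pdivlMr //; apply: (@le_trans _ _ (Dbar k * (2 * k%:R))).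
    by rewrite ler_wpM2l.
  by move: HD'; move: (k%:R : R) (Dbar k) (eps * th) => x y z; lra.
rewrite -mulr_sumr -mulr_suml.
apply: (@le_trans _ _ (eps * th / n%:R * ((\sum_(k < n) b1 k) / b1 n))).
  rewrite ler_wpM2l ?divr_ge0 ?mulr_ge0 ?(ltW eps0) ?(ltW th_gt0) //.
  rewrite ler_wpM2r ?invr_ge0 ?(ltW (b1_gt0 _)) //.
  have -> : \sum_(k < n) b1 k = \sum_(1 <= i < n.+1) b1 (n - i).
    by rewrite (reindex_inj rev_ord_inj) /= big_add1 /= big_mkord.
  rewrite [leRHS](@big_cat_nat _ _ _ n./2.+1 1 n.+1) //=; last by lia.
  by rewrite lerDr sumr_ge0 // => i _; rewrite ltW.
have := b1_sum n; rewrite mulrC => bs.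
have -> : eps * th / n%:R * ((\sum_(k < n) b1 k) / b1 n) =
   eps / n%:R / b1 n * (th * \sum_(k < n) b1 k).
  by field; rewrite !gt_eqF.
rewrite -bs (_ : _ * _ = eps) //.
by field; rewrite !gt_eqF.
Unshelve. all: by end_near. Qed.

End PerturbedEwens.

(** * Central limit theorem for cycle weights *)

Section CycleCLT.
Variables (R : realType) (th : R) (e : nat -> R) (B : R).
Hypothesis th_gt0 : 0 < th.
Hypothesis eB : forall N, \sum_(k < N) `|e k.+1| / k.+1%:R <= B.
Hypothesis e_cvg0 : e @ \oo --> 0.
Hypothesis e_ge : forall k, 0 <= th + e k.+1.

Let H n := expoly (fun k => th + e k) n.

Definition standardized n (s : nat) : R :=
  (s%:R - th * ln n%:R) / Num.sqrt (th * ln n%:R).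

(** The unknown constant of [perturbed_ewens_limit] cancels between the test functions ramp and
    1. *)
Lemma expoly_ramp_limit a b : a < b -> exists2 c, Phi a <= c <= Phi b &
  expectation (fun s => ramp a b (standardized n s)) (H n) / (H n).[1] @[n --> \oo] --> c.
Proof.
move=> ab; have [F [D [c [M [dF FDM Duc hE cPhi]]]]] := stein_solution ab.
have [L L0 HL] := perturbed_ewens_limit th_gt0 eB e_cvg0.
exists c => //.
have h1 : (H n).[1] / (expoly (fun=> th) n).[1] @[n --> \oo] --> L.
  have := HL (fun _ _ => 1) 1 _ _; rewrite mulr1 => h.
  under eq_fun do rewrite -expectation1; apply: h => [n s|k j]; first by rewrite normr1.
  by under eq_fun do rewrite ewens_cst //; exact: cvg_cst.
have h2 : expectation (fun s => ramp a b (standardized n s)) (H n) /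
    (expoly (fun=> th) n).[1] @[n --> \oo] --> L * c.
  apply: (HL (fun n s => ramp a b (standardized n s))) => [n s|k j].
    by rewrite ger0_norm ?ramp_ge0 // ramp_le1.
  exact: (@ewens_clt R th th_gt0 F D (ramp a b) c M k j dF
    (fun x => proj1 (FDM x)) (fun x => proj2 (FDM x)) Duc hE).
have X := cvgM h2 (cvgV L0 h1); rewrite mulrAC divff // mul1r in X.
have E : (fun n => expectation (fun s => ramp a b (standardized n s)) (H n) / (H n).[1]) =
    (fun n => expectation (fun s => ramp a b (standardized n s)) (H n) /
    (expoly (fun=> th) n).[1] * ((H n).[1] / (expoly (fun=> th) n).[1])^-1).
  by apply/funext => n; rewrite invf_div mulrA divfK // gt_eqF // expoly_cst_gt0.
by rewrite E; exact: X.
Qed.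

(** The coefficients of [H n] are non-negative, so the indicator can be squeezed between a ramp
    ending at [x] and one starting at [x]; continuity of [Phi] closes the gap. *)
Lemma expoly_cdf_limit x :
  expectation (fun s => (standardized n s <= x)%R%:R) (H n) / (H n).[1]
    @[n --> \oo] --> Phi x.
Proof.
have H0 n i : 0 <= (H n)`_i by exact: expoly_ge0.
have H1 n : 0 <= (H n).[1]^-1.
  by rewrite invr_ge0 -expectation1; apply: sumr_ge0 => i _; rewrite mulr1.
apply/cvgrPdist_le => eps eps0.
have e2 : 0 < eps / 2 by rewrite divr_gt0.
have cPhi : {for x, continuous (@Phi R)} by exact: is_derive_continuous (is_derive_Phi x).
have [d d0 Hd] : exists2 d : R, 0 < d & forall y, `|x - y| <= d -> `|Phi x - Phi y| <= eps / 2.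
  have /cvgrPdist_le /(_ _ e2) := cPhi; rewrite nearE -nbhs_ballE => -[d d0 Hd].
  exists (d / 2) => [|y xy]; first by rewrite divr_gt0.
  by apply: Hd; rewrite /ball /=; apply: le_lt_trans xy _; rewrite ltr_pdivrMr // ltr_pMr // ltr1n.
have xd : x < x + d by rewrite ltrDl.
have dx : x - d < x by rewrite ltrBlDr ltrDl.
have [c1 /andP[_ c1P] L1] := expoly_ramp_limit xd.
have [c2 /andP[c2P _] L2] := expoly_ramp_limit dx.
have up : Phi (x + d) <= Phi x + eps / 2.
  have := Hd (x + d); rewrite opprD addrA subrr sub0r normrN (gtr0_norm d0) => /(_ (lexx _)).
  by rewrite ler_norml => /andP[]; lra.
have low : Phi x - eps / 2 <= Phi (x - d).
  have := Hd (x - d); rewrite opprB addrC subrK (gtr0_norm d0) => /(_ (lexx _)).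
  by rewrite ler_norml => /andP[]; lra.
near=> n.
have N1 : `|c1 - expectation (fun s => ramp x (x + d) (standardized n s)) (H n) / (H n).[1]| <= eps / 2.
  by near: n; have /cvgrPdist_le /(_ _ e2) := L1.
have N2 : `|c2 - expectation (fun s => ramp (x - d) x (standardized n s)) (H n) / (H n).[1]| <= eps / 2.
  by near: n; have /cvgrPdist_le /(_ _ e2) := L2.
have le1 : expectation (fun s => (standardized n s <= x)%R%:R) (H n) / (H n).[1] <=
    expectation (fun s => ramp x (x + d) (standardized n s)) (H n) / (H n).[1].
  rewrite ler_wpM2r //; apply: expectation_le => // s.
  by case: (leP (standardized n s) x) => sx; rewrite ?ramp_ge0 // ramp1.
have le2 : expectation (fun s => ramp (x - d) x (standardized n s)) (H n) / (H n).[1] <=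
    expectation (fun s => (standardized n s <= x)%R%:R) (H n) / (H n).[1].
  rewrite ler_wpM2r //; apply: expectation_le => // s.
  by case: (leP (standardized n s) x) => sx; rewrite ?ramp_le1 // ramp0 // ltW.
move: N1 N2; rewrite !ler_norml => /andP[? ?] /andP[? ?].
by apply/andP; split; lra.
Unshelve. all: by end_near. Qed.

End CycleCLT.

Section WeightedPermutationLaw.
Variables (R : realType) (Theta : nat -> R) (r : R).
Hypothesis r_gt0 : 0 < r.

Lemma card_porbit_bounds n (s : 'S_n) c : c \in porbits s -> (1 <= #|c| < n.+1)%N.
Proof.
move=> /imsetP[x _ ->]; rewrite lt0n card_porbit_neq0 ltnS.
by rewrite -[X in (_ <= X)%N]card_ord max_card.
Qed.

Lemma total_cyclesE n (s : 'S_n) : total_cycles s = #|porbits s|.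
Proof.
rewrite /total_cycles -sum1_card.
under eq_bigr => m _ do rewrite /num_cycles_of_length -sum1dep_card.
rewrite (exchange_big_dep (mem (porbits s))) /=; last by move=> m c _ /andP[].
apply: eq_bigr => c cs; under eq_bigl => m do rewrite cs /= eq_sym.
by rewrite big_nat1_eq (card_porbit_bounds cs).
Qed.

Lemma perm_weightE n (s : 'S_n) : perm_weight Theta s = \prod_(c in porbits s) Theta #|c|.
Proof.
rewrite /perm_weight.
transitivity (\prod_(1 <= m < n.+1) \prod_(c in porbits s | #|c| == m) Theta m).
  apply: eq_bigr => m _; rewrite prodr_const; congr (_ ^+ _).
  by apply: eq_card => c; rewrite !inE.
rewrite (exchange_big_dep (mem (porbits s))) /=; last by move=> m c _ /andP[].
apply: eq_bigr => c cs; under eq_bigl => m do rewrite cs /= eq_sym.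
by rewrite big_nat1_eq (card_porbit_bounds cs).
Qed.

Lemma sum_card_porbits n (s : 'S_n) : (\sum_(c in porbits s) #|c|)%N = n.
Proof.
rewrite -[RHS]card_ord -[RHS]sum1_card (partition_big_imset (porbit s)).
apply: eq_bigr => _ /imsetP[x _ ->]; rewrite -sum1_card.
by apply: eq_bigl => y; rewrite eq_porbit_mem.
Qed.

(** Cycle lengths add up to n, so the weights [Theta k * r ^+ k] multiply every permutation weight
    by [r ^+ n], which cancels in the quotient. If the normalization is 0, both sides are 0 by the
    convention on division. *)
Lemma perm_prob_expectation n (P : pred nat) :
  let H := expoly (fun k => Theta k * r ^+ k) n in
  perm_prob Theta [set s : 'S_n | P (total_cycles s)]%SET =
  expectation (fun k => (P k)%:R) H / H.[1].
Proof.
move=> H.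
have rn : r ^+ n != 0 by rewrite expf_neq0 // gt_eqF.
have fn : n`!%:R != 0 :> R by rewrite pnatr_eq0 -lt0n fact_gt0.
have HE f : expectation f H =
    n`!%:R^-1 * r ^+ n * \sum_(s : 'S_n) perm_weight Theta s * f (total_cycles s).
  rewrite /H /expoly expectationZ -sum_cycle_weight expectation_sum -[RHS]mulrA.
  congr (_ * _); rewrite mulr_sumr; apply: eq_bigr => s _.
  have -> : \prod_(c in porbits s) ((Theta #|c| * r ^+ #|c|) *: 'X) =
      (r ^+ n * perm_weight Theta s) *: 'X^(total_cycles s).
    rewrite scaler_prod prodr_const -total_cyclesE big_split /= perm_weightE.
    by rewrite prodrXr sum_card_porbits mulrC.
  by rewrite expectationZ expectationXn mulrA.
rewrite -expectation1 !HE; under [in RHS]eq_bigr do rewrite mulr_natr mulrb.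
rewrite -big_mkcond /=; under [X in _ / (_ * X)]eq_bigr do rewrite mulr1.
rewrite /perm_prob -mulr_sumr.
have -> : perm_norm n Theta * n`!%:R = \sum_(s : 'S_n) perm_weight Theta s.
  by rewrite /perm_norm mulrAC mulVf // mul1r.
have -> : \sum_(s in [set s : 'S_n | P (total_cycles s)]%SET) perm_weight Theta s =
   \sum_(s : 'S_n | P (total_cycles s)) perm_weight Theta s.
  by apply: eq_bigl => s; rewrite inE.
by rewrite invfM mulrACA divff ?mulf_neq0 ?invr_eq0 // mul1r mulrC.
Qed.

End WeightedPermutationLaw.

Local Open Scope complex_scope.

(** * Complex differentiation and integration *)

Section ComplexModulus.
Variable R : realType.
Implicit Types (z w : R[i]) (x y : R).

Notation nc := Normc.normc.
Notation Re := complex.Re.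
Notation Im := complex.Im.

Lemma nc_ge0 z : 0 <= nc z.
Proof. by case: z => a b; exact: sqrtr_ge0. Qed.

Lemma ncM z w : nc (z * w) = nc z * nc w.
Proof. exact: Normc.normcM. Qed.

Lemma ncV z : nc z^-1 = (nc z)^-1.
Proof. exact: Normc.normcV. Qed.

Lemma ncN z : nc (- z) = nc z.
Proof. by case: z => a b /=; rewrite !sqrrN. Qed.

Lemma nc_real x : nc x%:C = `|x|.
Proof. by rewrite /= expr0n /= addr0 sqrtr_sqr. Qed.

Lemma nc0 : nc (0 : R[i]) = 0.
Proof. by rewrite (nc_real 0) normr0. Qed.

Lemma nc1 : nc (1 : R[i]) = 1.
Proof. by rewrite (nc_real 1) normr1. Qed.

Lemma nci : nc ('i%C : R[i]) = 1.
Proof. by rewrite /= expr0n add0r expr1n sqrtr1. Qed.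

Lemma nc_eq0 z : (nc z == 0) = (z == 0).
Proof. by apply/eqP/eqP => [/Normc.eq0_normc|->]; rewrite ?nc0. Qed.

Lemma nc_gt0 z : (0 < nc z) = (z != 0).
Proof. by rewrite lt_neqAle nc_ge0 andbT eq_sym nc_eq0. Qed.

Lemma ncX z n : nc (z ^+ n) = nc z ^+ n.
Proof. by elim: n => [|n IHn]; rewrite ?expr0 ?nc1 // !exprS ncM IHn. Qed.

Lemma ncD z w : nc (z + w) <= nc z + nc w.
Proof. exact: le_normcD. Qed.

Lemma ncB z w : nc (z - w) <= nc z + nc w.
Proof. by rewrite -(ncN w); exact: ncD. Qed.

Lemma nc_distC z w : nc (z - w) = nc (w - z).
Proof. by rewrite -ncN opprB. Qed.

Lemma nc_sum I (s : seq I) (P : pred I) (F : I -> R[i]) :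
  nc (\sum_(i <- s | P i) F i) <= \sum_(i <- s | P i) nc (F i).
Proof.
elim/big_rec2: _ => [|i x y _ H]; first by rewrite nc0.
by apply: le_trans (ncD _ _) _; rewrite lerD2l.
Qed.

Lemma nc_sqr z : nc z ^+ 2 = Re z ^+ 2 + Im z ^+ 2.
Proof. by case: z => a b; rewrite /= sqr_sqrtr // addr_ge0 // sqr_ge0. Qed.

Lemma nc_Re z : `|Re z| <= nc z.
Proof.
rewrite -(@ler_pXn2r _ 2) ?nnegrE ?nc_ge0 // real_normK ?num_real // nc_sqr.
by rewrite lerDl sqr_ge0.
Qed.

Lemma nc_Im z : `|Im z| <= nc z.
Proof.
rewrite -(@ler_pXn2r _ 2) ?nnegrE ?nc_ge0 // real_normK ?num_real // nc_sqr.
by rewrite lerDr sqr_ge0.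
Qed.

Lemma nc_ReIm z : nc z <= `|Re z| + `|Im z|.
Proof.
case: z => a b; have -> : a +i* b = a%:C + 'i%C * b%:C by simpc.
apply: le_trans (ncD _ _) _; rewrite ncM nci mul1r !nc_real.
by rewrite /= ; simpc.
Qed.

Lemma cReD z w : Re (z + w) = Re z + Re w. Proof. by case: z; case: w. Qed.
Lemma cImD z w : Im (z + w) = Im z + Im w. Proof. by case: z; case: w. Qed.
Lemma cReN z : Re (- z) = - Re z. Proof. by case: z. Qed.
Lemma cImN z : Im (- z) = - Im z. Proof. by case: z. Qed.
Lemma cReM z w : Re (z * w) = Re z * Re w - Im z * Im w.
Proof. by case: z; case: w. Qed.
Lemma cImM z w : Im (z * w) = Re z * Im w + Im z * Re w.
Proof. by case: z => a b; case: w => c d /=; rewrite addrC. Qed.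
Lemma complex_eq z w : Re z = Re w -> Im z = Im w -> z = w.
Proof. by case: z => a b; case: w => c d /= -> ->. Qed.

(** Written with epsilon, delta and the real-valued modulus, which keeps all estimates in the
    ordered field [R]. *)
Definition ccont (u : R -> R[i]) := forall x e, 0 < e ->
  exists2 d, 0 < d & forall y, `|y - x| < d -> nc (u y - u x) <= e.

Lemma ccont_Re u : ccont u -> continuous (@Re R \o u).
Proof.
move=> cu x; apply/cvgrPdist_le => e e0; have [d d0 Hd] := cu x e e0.
near=> y; rewrite /= distrC -cReN -cReD; apply: le_trans (nc_Re _) (Hd _ _).
by rewrite distrC; near: y; apply: (@cvgr_dist_lt _ _ _ _ _ id x) => //; exact: cvg_id.
Unshelve. all: by end_near. Qed.

Lemma ccont_Im u : ccont u -> continuous (@Im R \o u).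
Proof.
move=> cu x; apply/cvgrPdist_le => e e0; have [d d0 Hd] := cu x e e0.
near=> y; rewrite /= distrC -cImN -cImD; apply: le_trans (nc_Im _) (Hd _ _).
by rewrite distrC; near: y; apply: (@cvgr_dist_lt _ _ _ _ _ id x) => //; exact: cvg_id.
Unshelve. all: by end_near. Qed.

Lemma ccontP u : continuous (@Re R \o u) -> continuous (@Im R \o u) -> ccont u.
Proof.
move=> cr ci x e e0; have e2 : 0 < e / 2 by rewrite divr_gt0.
have /cvgrPdist_le /(_ _ e2) := cr x; rewrite nearE -nbhs_ballE => -[d1 /= d10 H1].
have /cvgrPdist_le /(_ _ e2) := ci x; rewrite nearE -nbhs_ballE => -[d2 /= d20 H2].
exists (Num.min d1 d2) => [|y]; first by rewrite lt_min d10 d20.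
rewrite lt_min distrC => /andP[y1 y2]; apply: le_trans (nc_ReIm _) _.
rewrite cReD cReN cImD cImN (splitr e) lerD //.
  by rewrite distrC; exact: H1.
by rewrite distrC; exact: H2.
Qed.

Lemma ccontD u v : ccont u -> ccont v -> ccont (fun x => u x + v x).
Proof.
move=> cu cv; apply: ccontP => x.
  have -> : @Re R \o (fun x => u x + v x) = fun x => Re (u x) + Re (v x).
    by apply/funext => y; exact: cReD.
  by apply: cvgD; [exact: (ccont_Re cu)|exact: (ccont_Re cv)].
have -> : @Im R \o (fun x => u x + v x) = fun x => Im (u x) + Im (v x).
  by apply/funext => y; exact: cImD.
by apply: cvgD; [exact: (ccont_Im cu)|exact: (ccont_Im cv)].
Qed.

Lemma ccontM u v : ccont u -> ccont v -> ccont (fun x => u x * v x).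
Proof.
move=> cu cv; have [cur cui] := (ccont_Re cu, ccont_Im cu).
have [cvr cvi] := (ccont_Re cv, ccont_Im cv); apply: ccontP => x.
  have -> : @Re R \o (fun x => u x * v x) =
      fun x => Re (u x) * Re (v x) - Im (u x) * Im (v x).
    by apply/funext => y; exact: cReM.
  by apply: cvgB; apply: cvgM; [exact: cur|exact: cvr|exact: cui|exact: cvi].
have -> : @Im R \o (fun x => u x * v x) =
    fun x => Re (u x) * Im (v x) + Im (u x) * Re (v x).
  by apply/funext => y; exact: cImM.
by apply: cvgD; apply: cvgM; [exact: cur|exact: cvi|exact: cui|exact: cvr].
Qed.

Lemma ccont_cst z : ccont (fun=> z).
Proof. by move=> x e e0; exists 1 => // y _; rewrite subrr nc0 ltW. Qed.

Lemma ccontN u : ccont u -> ccont (fun x => - u x).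
Proof.
move=> cu; have -> : (fun x => - u x) = fun x => -1 * u x.
  by apply/funext => x; rewrite mulN1r.
by apply: ccontM => //; exact: ccont_cst.
Qed.

Lemma ccontB u v : ccont u -> ccont v -> ccont (fun x => u x - v x).
Proof. by move=> cu cv; apply: ccontD => //; exact: ccontN. Qed.

Lemma ccont_sum (I : Type) (s : seq I) (F : I -> R -> R[i]) :
  (forall i, ccont (F i)) -> ccont (fun x => \sum_(i <- s) F i x).
Proof.
move=> cF; elim: s => [|i s IHs].
  have -> : (fun x => \sum_(j <- [::]) F j x) = fun=> 0.
    by apply/funext => x; rewrite big_nil.
  exact: ccont_cst.
have -> : (fun x => \sum_(j <- i :: s) F j x) = fun x => F i x + \sum_(j <- s) F j x.
  by apply/funext => x; rewrite big_cons.
exact: ccontD.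
Qed.

Lemma ccont_real (f : R -> R) : continuous f -> ccont (fun x => (f x)%:C).
Proof. by move=> cf; apply: ccontP; [exact: cf|exact: cst_continuous]. Qed.

(* A chosen primitive of [u], a junk value if [u] has none. *)
Definition rprim (u : R -> R) : R -> R :=
  xget u [set U | forall x : R, is_derive x 1 U (u x)].

Lemma rprimP u : continuous u -> forall x : R, is_derive x 1 (rprim u) (u x).
Proof.
move=> /primitive_exists [U HU]; rewrite /rprim.
by case: xgetP => [U' _ //|/(_ U)] nU; case: (nU HU).
Qed.

(** Integration by differences of primitives: additivity over intervals is then an identity for
    every [u], and the other rules follow from the mean value theorem. *)
Definition cint (u : R -> R[i]) (a b : R) : R[i] :=
  (rprim (@Re R \o u) b - rprim (@Re R \o u) a) +i*
  (rprim (@Im R \o u) b - rprim (@Im R \o u) a).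

Lemma cint_chasles u a b c : cint u a c = cint u a b + cint u b c.
Proof. by apply: complex_eq; rewrite /cint /=; ring. Qed.

Lemma cint_ftc u (U : R -> R[i]) a b : a <= b -> ccont u ->
  (forall x, a <= x <= b -> is_derive x 1 (@Re R \o U) (Re (u x))) ->
  (forall x, a <= x <= b -> is_derive x 1 (@Im R \o U) (Im (u x))) ->
  cint u a b = U b - U a.
Proof.
move=> ab cu UR UI; apply: complex_eq; rewrite ?cReD ?cReN ?cImD ?cImN /=.
  by apply: (derive_eq ab (fun x _ => rprimP (ccont_Re cu) x) UR).
by apply: (derive_eq ab (fun x _ => rprimP (ccont_Im cu) x) UI).
Qed.

Lemma cintD u v a b : a <= b -> ccont u -> ccont v ->
  cint (fun x => u x + v x) a b = cint u a b + cint v a b.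
Proof.
move=> ab cu cv.
pose U x := (rprim (@Re R \o u) x + rprim (@Re R \o v) x) +i*
  (rprim (@Im R \o u) x + rprim (@Im R \o v) x).
transitivity (U b - U a); last by apply: complex_eq; rewrite /cint /U /=; ring.
apply: cint_ftc => //.
- exact: ccontD.
- move=> x _; rewrite cReD; apply: is_deriveD; exact: rprimP (ccont_Re _) _.
- move=> x _; rewrite cImD; apply: is_deriveD; exact: rprimP (ccont_Im _) _.
Qed.

Lemma cintZ z u a b : a <= b -> ccont u ->
  cint (fun x => z * u x) a b = z * cint u a b.
Proof.
move=> ab cu.
pose U x := z * (rprim (@Re R \o u) x +i* rprim (@Im R \o u) x).
have dR x := rprimP (ccont_Re cu) x; have dI x := rprimP (ccont_Im cu) x.
transitivity (U b - U a).
  apply: cint_ftc => //.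
- by apply: ccontM => //; exact: ccont_cst.
- move=> x _; rewrite cReM.
  have -> : @Re R \o U = fun x => Re z * rprim (@Re R \o u) x - Im z * rprim (@Im R \o u) x.
    by apply/funext => y; rewrite /U /= cReM.
  exact: (is_deriveB (is_deriveZ (Re z) (dR x)) (is_deriveZ (Im z) (dI x))).
- move=> x _; rewrite cImM.
  have -> : @Im R \o U = fun x => Re z * rprim (@Im R \o u) x + Im z * rprim (@Re R \o u) x.
    by apply/funext => y; rewrite /U /= cImM.
  exact: (is_deriveD (is_deriveZ (Re z) (dI x)) (is_deriveZ (Im z) (dR x))).
by apply: complex_eq; rewrite /U !(cReD, cImD, cReN, cImN, cReM, cImM) /=; ring.
Qed.

Lemma cintB u v a b : a <= b -> ccont u -> ccont v ->
  cint (fun x => u x - v x) a b = cint u a b - cint v a b.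
Proof.
move=> ab cu cv; rewrite cintD //; last exact: ccontN.
have -> : (fun x => - v x) = fun x => -1 * v x by apply/funext => x; rewrite mulN1r.
by rewrite cintZ // mulN1r.
Qed.

Lemma cint0 a b : a <= b -> cint (fun=> 0) a b = 0.
Proof.
move=> ab; have -> : (fun=> 0) = fun _ : R => 0 * (0 : R[i]) by apply/funext => x; rewrite mul0r.
by rewrite (cintZ 0) ?mul0r //; exact: ccont_cst.
Qed.

Lemma cint_sum (I : Type) (s : seq I) (F : I -> R -> R[i]) a b : a <= b ->
  (forall i, ccont (F i)) ->
  cint (fun x => \sum_(i <- s) F i x) a b = \sum_(i <- s) cint (F i) a b.
Proof.
move=> ab cF; elim: s => [|i s IHs].
  rewrite big_nil -[RHS](cint0 ab); congr cint.
  by apply/funext => x; rewrite big_nil.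
rewrite big_cons -IHs -cintD //; last exact: ccont_sum.
by congr cint; apply/funext => x; rewrite big_cons.
Qed.

(** The factor 2 comes from bounding real and imaginary parts separately; only the order of
    magnitude matters later. *)
Lemma cint_le u a b M : a <= b -> ccont u ->
  (forall x, a <= x <= b -> nc (u x) <= M) -> nc (cint u a b) <= 2 * M * (b - a).
Proof.
move=> ab cu uM; apply: le_trans (nc_ReIm _) _.
have -> : 2 * M * (b - a) = M * (b - a) + M * (b - a) by ring.
apply: lerD; rewrite /cint /=.
  apply: (derive_bound ab (fun x _ => rprimP (ccont_Re cu) x)) => x xab.
  by apply: le_trans (nc_Re _) (uM x xab).
apply: (derive_bound ab (fun x _ => rprimP (ccont_Im cu) x)) => x xab.
by apply: le_trans (nc_Im _) (uM x xab).
Qed.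

Lemma cint_Re_ge0 u a b : a <= b -> ccont u ->
  (forall x, a <= x <= b -> 0 <= Re (u x)) -> 0 <= Re (cint u a b).
Proof.
move=> ab cu u0; rewrite /cint /= subr_ge0.
exact: (derive_ge0 ab (fun x _ => rprimP (ccont_Re cu) x)).
Qed.

Lemma cint_cst z a b : a <= b -> cint (fun=> z) a b = (b - a)%:C * z.
Proof.
move=> ab; transitivity (b%:C * z - a%:C * z); last by rewrite -mulrBl -rmorphB.
apply: (@cint_ftc _ (fun x => x%:C * z)) => //.
- exact: ccont_cst.
- move=> x _; have -> : @Re R \o (fun x => x%:C * z) = fun x => x * Re z.
    by apply/funext => y; rewrite /= cReM /= mul0r subr0.
  by apply: is_derive_eq; rewrite /GRing.scale /=; ring.
- move=> x _; have -> : @Im R \o (fun x => x%:C * z) = fun x => x * Im z.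
    by apply/funext => y; rewrite /= cImM /= mul0r addr0.
  by apply: is_derive_eq; rewrite /GRing.scale /=; ring.
Qed.

End ComplexModulus.

(** * Bisection of rectangles and Goursat's lemma *)

Section Bisection.
Variables (R : realType) (P : R -> R -> R -> R -> Prop) (x0 y0 w0 h0 : R).
Hypotheses (w0_ge0 : 0 <= w0) (h0_ge0 : 0 <= h0).
Hypothesis P_quarters : forall x y w h : R,
  P x y (w / 2) (h / 2) -> P (x + w / 2) y (w / 2) (h / 2) ->
  P x (y + h / 2) (w / 2) (h / 2) -> P (x + w / 2) (y + h / 2) (w / 2) (h / 2) ->
  P x y w h.

Let nested_limit (u l : R ^nat) : (forall n, u n <= u n.+1) ->
  (forall n, u n.+1 + l n.+1 <= u n + l n) -> (forall n, 0 <= l n) ->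
  exists p, forall n, u n <= p <= u n + l n.
Proof.
move=> uS lS l0.
have uh : {homo u : m n / (m <= n)%N >-> m <= n}.
  by apply/nondecreasing_seqP.
have lh m n : (m <= n)%N -> u n + l n <= u m + l m.
  move=> mn; rewrite -(subnKC mn); elim: (n - m)%N => [|k IHk]; first by rewrite addn0.
  by rewrite addnS; apply: le_trans (lS _) IHk.
have ul m n : u m <= u n + l n.
  case: (leqP m n) => mn; first by rewrite (le_trans (uh _ _ mn)) // lerDl.
  by apply: le_trans _ (lh _ _ (ltnW mn)); rewrite lerDl.
have uc : cvgn u.
  by apply: nondecreasing_is_cvgn => //; exists (u 0%N + l 0%N) => _ [n _ <-].
exists (limn u) => n; rewrite nondecreasing_cvgn_le //=.
by apply: limr_le => //; near=> m; exact: ul.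
Unshelve. all: by end_near. Qed.

(** Contrapositive: a failing rectangle has a failing quarter, and the nested failing rectangles
    shrink to a point contradicting the local hypothesis. It serves both for Goursat's lemma and, in
    [derivative_bounded], in place of compactness. *)
Lemma bisection :
  (forall px py : R, x0 <= px <= x0 + w0 -> y0 <= py <= y0 + h0 ->
    exists2 d, 0 < d & forall x y w h, 0 <= w -> 0 <= h ->
      x0 <= x -> x + w <= x0 + w0 -> y0 <= y -> y + h <= y0 + h0 ->
      x <= px <= x + w -> y <= py <= y + h -> w + h < d -> P x y w h) ->
  P x0 y0 w0 h0.
Proof.
move=> Ploc; apply: contrapT => nP0.
pose w n : R := w0 / 2 ^+ n; pose h n : R := h0 / 2 ^+ n.
have wS n : w n.+1 = w n / 2 by rewrite /w exprSr invfM mulrA.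
have hS n : h n.+1 = h n / 2 by rewrite /h exprSr invfM mulrA.
have w_ge0 n : 0 <= w n by rewrite divr_ge0 ?exprn_ge0.
have h_ge0 n : 0 <= h n by rewrite divr_ge0 ?exprn_ge0.
have step (a : nat * (R * R)) : exists z : R * R,
    ~ P a.2.1 a.2.2 (w a.1) (h a.1) ->
    [/\ ~ P z.1 z.2 (w a.1.+1) (h a.1.+1),
      a.2.1 <= z.1, z.1 + w a.1.+1 <= a.2.1 + w a.1,
      a.2.2 <= z.2 & z.2 + h a.1.+1 <= a.2.2 + h a.1].
  case: a => n [x y] /=; have wn := w_ge0 n; have hn := h_ge0 n.
  have [Pn|nPn] := pselect (P x y (w n) (h n)); first by exists (x, y).
  have [H1|H1] := pselect (P x y (w n / 2) (h n / 2)); last first.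
    by exists (x, y) => _; rewrite wS hS; split => //=; lra.
  have [H2|H2] := pselect (P (x + w n / 2) y (w n / 2) (h n / 2)); last first.
    by exists (x + w n / 2, y) => _; rewrite wS hS; split => //=; lra.
  have [H3|H3] := pselect (P x (y + h n / 2) (w n / 2) (h n / 2)); last first.
    by exists (x, y + h n / 2) => _; rewrite wS hS; split => //=; lra.
  have [H4|H4] := pselect (P (x + w n / 2) (y + h n / 2) (w n / 2) (h n / 2)); last first.
    by exists (x + w n / 2, y + h n / 2) => _; rewrite wS hS; split => //=; lra.
  by exfalso; apply: nPn; exact: P_quarters.
have [f Hf] := choice step.
pose s := fix s n := if n is m.+1 then f (m, s m) else (x0, y0).
have nPs n : ~ P (s n).1 (s n).2 (w n) (h n).
  elim: n => [|n IHn]; first by rewrite /w /h !expr0 !divr1.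
  by have [] := Hf (n, s n) IHn.
have sS n := Hf (n, s n) (nPs n).
have [px Hx] := @nested_limit (fun n => (s n).1) w (fun n => let: And5 _ a _ _ _ := sS n in a)
  (fun n => let: And5 _ _ a _ _ := sS n in a) w_ge0.
have [py Hy] := @nested_limit (fun n => (s n).2) h (fun n => let: And5 _ _ _ a _ := sS n in a)
  (fun n => let: And5 _ _ _ _ a := sS n in a) h_ge0.
have sub n : [/\ x0 <= (s n).1, (s n).1 + w n <= x0 + w0, y0 <= (s n).2 &
    (s n).2 + h n <= y0 + h0].
  elim: n => [|n [a b c d]]; first by rewrite /w /h !expr0 !divr1 /=.
  have [_ a' b' c' d'] := sS n.
  by split; [exact: le_trans a'|exact: le_trans b|exact: le_trans c'|exact: le_trans d].
have px0 : x0 <= px <= x0 + w0 by have := Hx 0%N; rewrite /w expr0 divr1.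
have py0 : y0 <= py <= y0 + h0 by have := Hy 0%N; rewrite /h expr0 divr1.
have [d d0 Hd] := Ploc px py px0 py0.
have [n nd] : exists n, w n + h n < d.
  have [n Hn] : exists n : nat, (w0 + h0) / d < n%:R.
    exists (Num.bound ((w0 + h0) / d)); apply: archi_boundP.
    by rewrite divr_ge0 ?addr_ge0 // ltW.
  exists n; rewrite -mulrDl ltr_pdivrMr ?exprn_gt0 //.
  move: Hn; rewrite ltr_pdivrMr // mulrC => /lt_le_trans; apply.
  by rewrite ler_wpM2l ?(ltW d0) // -natrX ler_nat ltnW // ltn_expl.
have [a b c e] := sub n.
by apply: (nPs n); apply: Hd.
Qed.

End Bisection.

Section Goursat.
Variable R : realType.
Notation nc := Normc.normc.
Notation Re := complex.Re.
Notation Im := complex.Im.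
Variable F : R -> R -> R[i].
Hypothesis Fx : forall y, ccont (fun x => F x y).
Hypothesis Fy : forall x, ccont (F x).

(** The counterclockwise contour integral of G dz, with [G] a function of the two real
    coordinates. *)
Definition rect_int (G : R -> R -> R[i]) x y w h : R[i] :=
  cint (fun x => G x y) x (x + w) + 'i%C * cint (G (x + w)) y (y + h)
  - cint (fun x => G x (y + h)) x (x + w) - 'i%C * cint (G x) y (y + h).

Lemma rect_int_quarters G x y w h : rect_int G x y w h =
  rect_int G x y (w / 2) (h / 2) + rect_int G (x + w / 2) y (w / 2) (h / 2) +
  rect_int G x (y + h / 2) (w / 2) (h / 2) +
  rect_int G (x + w / 2) (y + h / 2) (w / 2) (h / 2).
Proof.
rewrite /rect_int -!addrA -!splitr !addrA.
rewrite (cint_chasles (fun x => G x y) x (x + w / 2) (x + w)).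
rewrite (cint_chasles (fun x => G x (y + h)) x (x + w / 2) (x + w)).
rewrite (cint_chasles (G x) y (y + h / 2) (y + h)).
rewrite (cint_chasles (G (x + w)) y (y + h / 2) (y + h)).
ring.
Qed.

Let affine (a b : R[i]) (x y : R) := a + b * (x +i* y).

Let affine_x a b y : ccont (fun x => affine a b x y).
Proof.
apply: ccontD; first exact: ccont_cst.
apply: ccontM; first exact: ccont_cst.
by apply: ccontP; [move=> x; exact: cvg_id|move=> x; exact: cvg_cst].
Qed.

Let affine_y a b x : ccont (affine a b x).
Proof.
apply: ccontD; first exact: ccont_cst.
apply: ccontM; first exact: ccont_cst.
by apply: ccontP; [move=> y; exact: cvg_cst|move=> y; exact: cvg_id].
Qed.

Let affine_hint a b y x1 x2 : x1 <= x2 -> cint (fun x => affine a b x y) x1 x2 =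
  (x2 - x1)%:C * (a + b * (0 +i* y)) + b * ((x2 ^+ 2 - x1 ^+ 2) / 2)%:C.
Proof.
move=> x12; pose U x := x%:C * (a + b * (0 +i* y)) + b * (x ^+ 2 / 2)%:C.
transitivity (U x2 - U x1).
  apply: cint_ftc => //.
  - move=> x _; have -> : @Re R \o U = fun x => x * Re (a + b * (0 +i* y)) + Re b * (x ^+ 2 / 2).
      by apply/funext => z; rewrite /U /comp !(cReD, cReM, cImD, cImM) /=; ring.
    by apply: is_derive_eq; rewrite /affine !(cReD, cReM, cImD, cImM) /GRing.scale /=; field.
  - move=> x _; have -> : @Im R \o U = fun x => x * Im (a + b * (0 +i* y)) + Im b * (x ^+ 2 / 2).
      by apply/funext => z; rewrite /U /comp !(cReD, cReM, cImD, cImM) /=; ring.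
    by apply: is_derive_eq; rewrite /affine !(cReD, cReM, cImD, cImM) /GRing.scale /=; field.
by apply: complex_eq; rewrite /U !(cReD, cReM, cImD, cImM, cReN, cImN) /=; field.
Qed.

Let affine_vint a b x y1 y2 : y1 <= y2 -> cint (affine a b x) y1 y2 =
  (y2 - y1)%:C * (a + b * x%:C) + b * 'i%C * ((y2 ^+ 2 - y1 ^+ 2) / 2)%:C.
Proof.
move=> y12; pose U y := y%:C * (a + b * x%:C) + b * 'i%C * (y ^+ 2 / 2)%:C.
transitivity (U y2 - U y1).
  apply: cint_ftc => //.
  - move=> y _; have -> : @Re R \o U = fun y => y * Re (a + b * x%:C) - Im b * (y ^+ 2 / 2).
      by apply/funext => z; rewrite /U /comp !(cReD, cReM, cImD, cImM) /=; ring.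
    by apply: is_derive_eq; rewrite /affine !(cReD, cReM, cImD, cImM) /GRing.scale /=; field.
  - move=> y _; have -> : @Im R \o U = fun y => y * Im (a + b * x%:C) + Re b * (y ^+ 2 / 2).
      by apply/funext => z; rewrite /U /comp !(cReD, cReM, cImD, cImM) /=; ring.
    by apply: is_derive_eq; rewrite /affine !(cReD, cReM, cImD, cImM) /GRing.scale /=; field.
by apply: complex_eq; rewrite /U !(cReD, cReM, cImD, cImM, cReN, cImN) /=; field.
Qed.

Let rect_int_affine a b x y w h : 0 <= w -> 0 <= h ->
  rect_int (affine a b) x y w h = 0.
Proof.
move=> w0 h0; rewrite /rect_int !affine_hint ?affine_vint ?lerDl //.
by apply: complex_eq; rewrite !(cReD, cReM, cImD, cImM, cReN, cImN) /=; field.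
Qed.

(** Near each point [F] is affine in x + i y up to a small error, and affine functions integrate to
    0. Differentiability is asked only relative to the closed rectangle, so [F] may be clipped
    outside it, as is done in [circle_constant]. *)
Lemma goursat (x0 y0 w0 h0 : R) : 0 <= w0 -> 0 <= h0 ->
  (forall px py : R, x0 <= px <= x0 + w0 -> y0 <= py <= y0 + h0 ->
    exists A : R[i], forall e : R, 0 < e -> exists2 d : R, 0 < d &
      forall x y : R, x0 <= x <= x0 + w0 -> y0 <= y <= y0 + h0 ->
        nc ((x - px) +i* (y - py)) < d ->
        nc (F x y - F px py - A * ((x - px) +i* (y - py))) <=
          e * nc ((x - px) +i* (y - py))) ->
  rect_int F x0 y0 w0 h0 = 0.
Proof.
move=> w00 h00 Fd.
suff H e : 0 < e -> nc (rect_int F x0 y0 w0 h0) <= 4 * e * (w0 + h0) ^+ 2.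
  apply/eqP; rewrite -nc_eq0 eq_le nc_ge0 andbT.
  apply/ler_addgt0Pr => e e0; rewrite add0r.
  have q0 : 0 < 4 * ((w0 + h0) ^+ 2 + 1) by rewrite mulr_gt0 // ltr_wpDl // sqr_ge0.
  apply: le_trans (H (e / (4 * ((w0 + h0) ^+ 2 + 1))) _) _; first by rewrite divr_gt0.
  move: (sqr_ge0 (w0 + h0)); move: ((w0 + h0) ^+ 2) => q qge.
  have -> : 4 * (e / (4 * (q + 1))) * q = e * (q / (q + 1)).
    by field; rewrite gt_eqF //; lra.
  by rewrite ler_piMr ?(ltW e0) // ler_pdivrMr; lra.
move=> e0.
(* The bound is homogeneous of degree 2, hence exactly the sum of its values on the four
   quarters. *)
apply: (@bisection R (fun x y w h => nc (rect_int F x y w h) <= 4 * e * (w + h) ^+ 2)) => //.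
  move=> x y w h H1 H2 H3 H4; rewrite rect_int_quarters.
  apply: le_trans (ncD _ _) _; have := ncD (rect_int F x y (w / 2) (h / 2) +
    rect_int F (x + w / 2) y (w / 2) (h / 2)) (rect_int F x (y + h / 2) (w / 2) (h / 2)).
  have := ncD (rect_int F x y (w / 2) (h / 2)) (rect_int F (x + w / 2) y (w / 2) (h / 2)).
  have -> : 4 * e * (w + h) ^+ 2 = 4 * (4 * e * (w / 2 + h / 2) ^+ 2) by field.
  by move: H1 H2 H3 H4; move: (4 * e * (w / 2 + h / 2) ^+ 2) => q; lra.
move=> px py pxP pyP; have [A HA] := Fd px py pxP pyP.
have [d d0 Hd] := HA e e0.
exists d => // x y w h w_ge0 h_ge0 x0x xw y0y yh pxx pyy whd.
pose L := affine (F px py - A * (px +i* py)) A.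
have FL x' y' : x <= x' <= x + w -> y <= y' <= y + h ->
    nc (F x' y' - L x' y') <= e * (w + h).
  move=> /andP[x1 x2] /andP[y1 y2]; move: pxx pyy => /andP[p1 p2] /andP[p3 p4].
  have N : nc ((x' - px) +i* (y' - py)) <= w + h.
    apply: le_trans (nc_ReIm _) _; apply: lerD; rewrite /= ler_norml; apply/andP; split; lra.
  have -> : F x' y' - L x' y' = F x' y' - F px py - A * ((x' - px) +i* (y' - py)).
    rewrite /L /affine; have -> : (x' - px) +i* (y' - py) = (x' +i* y') - (px +i* py) by [].
    ring.
  apply: le_trans (Hd _ _ _ _ _) _; last by rewrite ler_wpM2l // ltW.
  - by apply/andP; split; lra.
  - by apply/andP; split; lra.
  - exact: le_lt_trans N whd.
have xw' : x <= x + w by rewrite lerDl.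
have yh' : y <= y + h by rewrite lerDl.
have -> : rect_int F x y w h =
    cint (fun x => F x y - L x y) x (x + w)
  + 'i%C * cint (fun y => F (x + w) y - L (x + w) y) y (y + h)
  - cint (fun x => F x (y + h) - L x (y + h)) x (x + w)
  - 'i%C * cint (fun z => F x z - L x z) y (y + h).
  have := rect_int_affine (F px py - A * (px +i* py)) A x y w_ge0 h_ge0.
  have LX z : ccont (fun x => L x z) by exact: affine_x.
  have LY z : ccont (L z) by exact: affine_y.
  rewrite !cintB // -/L /rect_int => L0.
  rewrite -[LHS]subr0 -{1}L0; ring.
have B1 := @cint_le _ (fun x => F x y - L x y) x (x + w) (e * (w + h)) xw'
  (ccontB (Fx y) (affine_x _ _ y)) (fun x' h' => FL x' y h' (introT andP (conj (lexx _) yh'))).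
have B2 := @cint_le _ (fun z => F (x + w) z - L (x + w) z) y (y + h) (e * (w + h)) yh'
  (ccontB (Fy (x + w)) (affine_y _ _ (x + w)))
  (fun y' h' => FL (x + w) y' (introT andP (conj xw' (lexx _))) h').
have B3 := @cint_le _ (fun x => F x (y + h) - L x (y + h)) x (x + w) (e * (w + h)) xw'
  (ccontB (Fx (y + h)) (affine_x _ _ (y + h)))
  (fun x' h' => FL x' (y + h) h' (introT andP (conj yh' (lexx _)))).
have B4 := @cint_le _ (fun z => F x z - L x z) y (y + h) (e * (w + h)) yh'
  (ccontB (Fy x) (affine_y _ _ x))
  (fun y' h' => FL x y' (introT andP (conj (lexx _) xw')) h').
have Ex : x + w - x = w by ring.
have Ey : y + h - y = h by ring.
move: B1 B2 B3 B4; rewrite Ex Ey.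
set I1 := cint _ _ _; set I2 := cint _ _ _; set I3 := cint _ _ _; set I4 := cint _ _ _.
move=> B1 B2 B3 B4.
apply: (@le_trans _ _ (nc (I1 + 'i%C * I2 - I3) + nc ('i%C * I4))); first exact: ncB.
rewrite ncM nci mul1r.
have := ncB (I1 + 'i%C * I2) I3; have := ncD I1 ('i%C * I2); rewrite ncM nci mul1r.
have -> : 4 * e * (w + h) ^+ 2 = 2 * (2 * (e * (w + h)) * w) + 2 * (2 * (e * (w + h)) * h) by ring.
move: B1 B2 B3 B4; move: (2 * (e * (w + h)) * w) (2 * (e * (w + h)) * h) => u v.
by lra.
Qed.

End Goursat.

Section ComplexDerivative.
Variable R : realType.
Notation nc := Normc.normc.
Notation Re := complex.Re.
Notation Im := complex.Im.
Implicit Types (f g : R[i] -> R[i]) (p q A : R[i]).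

Definition ccts_at f p := forall e : R, 0 < e ->
  exists2 d : R, 0 < d & forall q, nc (q - p) < d -> nc (f q - f p) <= e.

Definition cdiff f p A := forall e : R, 0 < e ->
  exists2 d : R, 0 < d &
    forall q, nc (q - p) < d -> nc (f q - f p - A * (q - p)) <= e * nc (q - p).

Lemma posC (e : R[i]) : 0 < e -> e = (Re e)%:C /\ 0 < Re e.
Proof. by rewrite ltcE /= => /andP[/eqP e0 ->]; split=> //; case: e e0 => a b /= ->. Qed.

Lemma nbhsC (p : R[i]^o) (P : set R[i]^o) :
  nbhs p P <-> exists2 d : R, 0 < d & forall q, nc (q - p) < d -> P q.
Proof.
split.
  move=> /nbhs_ballP[e /= /posC[-> e0] H]; exists (Re e) => // q qp; apply: H.
  by rewrite /ball /= -opprB normrN ltcR.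
move=> [d d0 H]; apply/nbhs_ballP; exists d%:C; first by rewrite /= ltcR.
by move=> q; rewrite /ball /= -opprB normrN ltcR => /H.
Qed.

Lemma ccts_cst a p : ccts_at (fun=> a) p.
Proof. by move=> e e0; exists 1 => // q _; rewrite subrr nc0 ltW. Qed.

Lemma ccts_id p : ccts_at id p.
Proof. by move=> e e0; exists e => // q /ltW. Qed.

Lemma cctsD f g p : ccts_at f p -> ccts_at g p -> ccts_at (fun q => f q + g q) p.
Proof.
move=> cf cg e e0; have e2 : 0 < e / 2 by rewrite divr_gt0.
have [d1 d10 H1] := cf _ e2; have [d2 d20 H2] := cg _ e2.
exists (Num.min d1 d2) => [|q]; first by rewrite lt_min d10.
rewrite lt_min => /andP[q1 q2]; rewrite opprD addrACA (splitr e).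
by apply: le_trans (ncD _ _) _; rewrite lerD ?H1 ?H2.
Qed.

Lemma cctsM f g p : ccts_at f p -> ccts_at g p -> ccts_at (fun q => f q * g q) p.
Proof.
move=> cf cg e e0; pose M := nc (f p) + nc (g p) + 1.
have fp0 := nc_ge0 (f p); have gp0 := nc_ge0 (g p).
have M0 : 0 < M by rewrite /M; lra.
pose e' := Num.min 1 (e / (2 * M)).
have e'0 : 0 < e' by rewrite lt_min ltr01 divr_gt0 // mulr_gt0.
have e'1 : e' <= 1 by rewrite ge_min lexx.
have e'M : e' * M <= e / 2.
  apply: (@le_trans _ _ (e / (2 * M) * M)); last by rewrite invfM mulrA divfK ?gt_eqF.
  by rewrite ler_wpM2r ?(ltW M0) // ge_min lexx orbT.
have [d1 d10 H1] := cf _ e'0; have [d2 d20 H2] := cg _ e'0.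
exists (Num.min d1 d2) => [|q]; first by rewrite lt_min d10.
rewrite lt_min => /andP[/H1 q1 /H2 q2].
have -> : f q * g q - f p * g p = (f q - f p) * (g q - g p) + (f q - f p) * g p +
    f p * (g q - g p) by ring.
apply: le_trans (ncD _ _) _; have := ncD ((f q - f p) * (g q - g p)) ((f q - f p) * g p).
rewrite !ncM.
have : nc (f q - f p) * nc (g q - g p) <= e' * 1.
  by rewrite ler_pM ?nc_ge0 // (le_trans q2).
have : nc (f q - f p) * nc (g p) <= e' * nc (g p) by rewrite ler_wpM2r.
have : nc (f p) * nc (g q - g p) <= nc (f p) * e' by rewrite ler_wpM2l.
by move: e'M; rewrite /M; lra.
Qed.

Lemma ccts_comp f g p : ccts_at g p -> ccts_at f (g p) -> ccts_at (fun q => f (g q)) p.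
Proof.
move=> cg cf e e0; have [d d0 H] := cf e e0.
have d2 : 0 < d / 2 by rewrite divr_gt0.
have [d' d'0 H'] := cg _ d2; exists d' => // q qp; apply: H.
by apply: le_lt_trans (H' q qp) _; lra.
Qed.

Lemma cctsV p : p != 0 -> ccts_at (fun q => q^-1) p.
Proof.
move=> p0 e e0; have np : 0 < nc p by rewrite nc_gt0.
exists (Num.min (nc p / 2) (e * (nc p ^+ 2 / 2))) => [|q].
  by rewrite lt_min !(divr_gt0, mulr_gt0, exprn_gt0).
rewrite lt_min => /andP[q1 q2].
have nq : nc p / 2 <= nc q.
  have := ncD q (p - q); rewrite addrC subrK nc_distC; lra.
have q0 : q != 0 by rewrite -nc_gt0; apply: lt_le_trans nq; rewrite divr_gt0.
have -> : q^-1 - p^-1 = - (q - p) / (q * p) by field; rewrite p0 q0.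
rewrite ncM ncV ncM ncN ler_pdivrMr ?mulr_gt0 ?nc_gt0 //.
apply: le_trans (ltW q2) _; rewrite ler_wpM2l ?(ltW e0) //.
by rewrite expr2 mulrAC ler_wpM2r // ltW.
Qed.

(** With a slope function continuous at [p], the sum, product and chain rules reduce to algebra and
    continuity. *)
Lemma caratheodory f p A : cdiff f p A <->
  exists2 h : R[i] -> R[i], forall q, f q - f p = h q * (q - p) & h p = A /\ ccts_at h p.
Proof.
split=> [fA|[h fh [<- ch]] e e0]; last first.
  have [d d0 Hd] := ch e e0; exists d => // q qp.
  by rewrite fh -mulrBl ncM ler_wpM2r ?nc_ge0 // Hd.
exists (fun q => if q == p then A else (f q - f p) / (q - p)).
  by move=> q; case: eqVneq => [->|qp]; rewrite ?subrr ?mulr0 // divfK // subr_eq0.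
rewrite eqxx; split=> // e e0; have [d d0 Hd] := fA e e0.
exists d => // q qpd; rewrite eqxx; case: eqVneq => [_|qp]; first by rewrite subrr nc0 ltW.
have qp0 : q - p != 0 by rewrite subr_eq0.
rewrite -(@ler_pM2r _ (nc (q - p))) ?nc_gt0 // -ncM mulrBl divfK //; exact: Hd.
Qed.

Lemma cdiff_ccts f p A : cdiff f p A -> ccts_at f p.
Proof.
move=> /caratheodory[h fh [_ ch]].
have -> : f = fun q => h q * (q - p) + f p by apply/funext => q; rewrite -fh subrK.
apply: cctsD; last exact: ccts_cst.
by apply: cctsM => //; apply: cctsD; [exact: ccts_id|exact: ccts_cst].
Qed.

Lemma cdiff_cst a p : cdiff (fun=> a) p 0.
Proof. by move=> e e0; exists 1 => // q _; rewrite subrr mul0r subrr nc0 mulr_ge0 ?nc_ge0 // ltW. Qed.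

Lemma cdiff_id p : cdiff id p 1.
Proof. by move=> e e0; exists 1 => // q _; rewrite mul1r subrr nc0 mulr_ge0 ?nc_ge0 // ltW. Qed.

Lemma cdiffD f g p A B : cdiff f p A -> cdiff g p B -> cdiff (fun q => f q + g q) p (A + B).
Proof.
move=> /caratheodory[h fh [<- ch]] /caratheodory[k gk [<- ck]].
apply/caratheodory; exists (fun q => h q + k q) => [q|].
  by rewrite mulrDl -fh -gk; ring.
by split=> //; exact: cctsD.
Qed.

Lemma cdiffM f g p A B : cdiff f p A -> cdiff g p B ->
  cdiff (fun q => f q * g q) p (A * g p + f p * B).
Proof.
move=> fA gB; have cg := cdiff_ccts gB; move: fA gB.
move=> /caratheodory[h fh [<- ch]] /caratheodory[k gk [<- ck]].
apply/caratheodory; exists (fun q => h q * g q + f p * k q) => [q|].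
  rewrite mulrDl mulrAC -fh -mulrA -gk; ring.
split=> //; apply: cctsD; first exact: cctsM.
by apply: cctsM => //; exact: ccts_cst.
Qed.

Lemma cdiffZ a f p A : cdiff f p A -> cdiff (fun q => a * f q) p (a * A).
Proof. by move=> fA; have := cdiffM (cdiff_cst a p) fA; rewrite mul0r add0r. Qed.

Lemma cdiffB f g p A B : cdiff f p A -> cdiff g p B -> cdiff (fun q => f q - g q) p (A - B).
Proof.
move=> fA gB; have := cdiffD fA (cdiffZ (-1) gB); rewrite mulN1r.
by have -> : (fun q => f q + -1 * g q) = fun q => f q - g q
  by apply/funext => q; rewrite mulN1r.
Qed.

Lemma cdiff_comp f g p A B : cdiff g p B -> cdiff f (g p) A ->
  cdiff (fun q => f (g q)) p (A * B).
Proof.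
move=> gB fA; have cg := cdiff_ccts gB; move: fA gB.
move=> /caratheodory[h fh [<- ch]] /caratheodory[k gk [<- ck]].
apply/caratheodory; exists (fun q => h (g q) * k q) => [q|].
  by rewrite fh gk mulrA.
by split=> //; apply: cctsM => //; exact: ccts_comp.
Qed.

Lemma cdiffV p : p != 0 -> cdiff (fun q => q^-1) p (- p ^- 2).
Proof.
move=> p0; apply/caratheodory.
(* Since the inverse of 0 is 0, the slope between 0 and [p] is p ^ -2; the point 0 is later avoided
   by staying within [nc p] of [p]. *)
exists (fun q => if q == 0 then p ^- 2 else - (q^-1 * p^-1)) => [q|].
  case: eqVneq => [->|q0]; last by field; rewrite p0 q0.
  by rewrite invr0; field.
rewrite (negPf p0) expr2 invfM; split=> // e e0.
have np : 0 < nc p by rewrite nc_gt0.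
have [d d0 H] := cctsM (ccts_cst (- 1) p) (cctsM (cctsV p0) (ccts_cst p^-1 p)) e0.
exists (Num.min d (nc p)) => [|q]; first by rewrite lt_min d0.
rewrite lt_min (negPf p0) => /andP[/H q1 q2].
case: eqVneq => [q0|_]; first by move: q2; rewrite q0 sub0r ncN ltxx.
by move: q1; rewrite !mulN1r.
Qed.

Lemma derivable_cdiff (f : R[i]^o -> R[i]^o) (p : R[i]^o) :
  derivable f p (1 : R[i]^o) -> exists A, cdiff f p A.
Proof.
move=> /cvg_ex[A /cvgrPdist_le HA]; exists A => e e0.
have := HA e%:C; rewrite ltcR => /(_ e0); rewrite nearE /dnbhs /within /= => /nbhsC[d d0 H].
exists d => // q qp; have [->|qp0] := eqVneq q p.
  by rewrite !subrr mulr0 subrr nc0 mulr0.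
have qp1 : q - p != 0 by rewrite subr_eq0.
have := H (q - p); rewrite subr0 => /(_ qp qp1).
rewrite -opprB normrN lecR /GRing.scale /= mulr1 subrK => H1.
have -> : f q - f p - A * (q - p) = ((q - p)^-1 * (f q - f p) - A) * (q - p).
  by field.
by rewrite ncM ler_wpM2r ?nc_ge0.
Qed.

Lemma ccont_comp f (u : R -> R[i]) : ccont u -> (forall x, ccts_at f (u x)) ->
  ccont (fun x => f (u x)).
Proof.
move=> cu cf x e e0; have [d d0 Hd] := cf x e e0.
have d2 : 0 < d / 2 by rewrite divr_gt0.
have [d' d'0 Hd'] := cu x (d / 2) d2; exists d' => // y yx.
apply: Hd; apply: le_lt_trans (Hd' y yx) _; rewrite ltr_pdivrMr // ltr_pMr //; lra.
Qed.

Lemma real_derive_eps (f : R -> R) (x d : R) : is_derive x 1 f d ->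
  forall e : R, 0 < e -> exists2 r : R, 0 < r &
    forall h, `|h| < r -> `|f (x + h) - f x - d * h| <= e * `|h|.
Proof.
move=> [fx <-] e e0; have /cvgrPdist_le /(_ e e0) := fx.
rewrite nearE /dnbhs /within /= => /nbhs_ballP[r /= r0 H].
exists r => // h hr; have [->|h0] := eqVneq h 0.
  by rewrite addr0 subrr mulr0 subrr normr0 mulr0.
have := H h; rewrite /ball /= sub0r normrN => /(_ hr h0).
rewrite -/('D_1 f x) /GRing.scale /= mulr1 [h + x]addrC distrC => H1.
have -> : f (x + h) - f x - 'D_1 f x * h = (h^-1 * (f (x + h) - f x) - 'D_1 f x) * h.
  by field.
by rewrite normrM ler_wpM2r.
Qed.

Definition cexp (z : R[i]) : R[i] :=
  (expR (Re z) * cos (Im z)) +i* (expR (Re z) * sin (Im z)).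

Lemma cexpD z w : cexp (z + w) = cexp z * cexp w.
Proof.
apply: complex_eq; rewrite ?cReM ?cImM /cexp /= cReD cImD expRD.
  by rewrite cosD; ring.
by rewrite sinD; ring.
Qed.

Lemma cexp0 : cexp 0 = 1.
Proof. by apply: complex_eq; rewrite /cexp /= expR0 ?cos0 ?sin0 ?mulr1 ?mulr0. Qed.

Lemma nc_cexp z : nc (cexp z) = expR (Re z).
Proof.
rewrite /cexp /= !exprMn -mulrDr cos2Dsin2 mulr1 sqrtr_sqr ger0_norm //.
Qed.

Lemma cexp_neq0 z : cexp z != 0.
Proof. by rewrite -nc_gt0 nc_cexp expR_gt0. Qed.

Lemma cdiff_cexp0 : cdiff cexp 0 1.
Proof.
(* The error terms [B1] to [B4] contribute 1, 2, 2 and 1 times e * nc q. *)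
move=> e0 e00; pose e := Num.min 1 (e0 / 6).
have e_gt0 : 0 < e by rewrite lt_min ltr01 divr_gt0.
have e1 : e <= 1 by rewrite /e ge_min lexx.
have ee0 : 6 * e <= e0.
  by rewrite mulrC -ler_pdivlMr // /e ge_min lexx orbT.
have [d1 d10 H1] := real_derive_eps (is_derive_expR (0 : R)) e_gt0.
have [d2 d20 H2] := real_derive_eps (is_derive_cos (0 : R)) e_gt0.
have [d3 d30 H3] := real_derive_eps (is_derive_sin (0 : R)) e_gt0.
pose d := Num.min (Num.min d1 d2) (Num.min d3 (e / 2)).
exists d; first by rewrite !lt_min d10 d20 d30 divr_gt0.
move=> q; rewrite subr0 cexp0 mul1r /d !lt_min => /andP[/andP[q1 q2] /andP[q3 q4]].
have xq := nc_Re q; have yq := nc_Im q.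
have := H1 (Re q) (le_lt_trans xq q1); have := H2 (Im q) (le_lt_trans yq q2).
have := H3 (Im q) (le_lt_trans yq q3).
rewrite !add0r expR0 cos0 sin0 oppr0 mul0r !subr0 !mul1r.
set x := Re q in xq *; set y := Im q in yq * => S1 C1 E1.
apply: le_trans (nc_ReIm _) _.
have xe : `|x| <= e / 2 by apply: le_trans xq (ltW q4).
have Ex : `|expR x - 1| <= e.
  have -> : expR x - 1 = (expR x - 1 - x) + x by ring.
  apply: le_trans (ler_normD _ _) _.
  have : e * `|x| <= `|x| by rewrite ler_piMl.
  lra.
have E2 : `|expR x| <= 2.
  have -> : expR x = (expR x - 1) + 1 by ring.
  by apply: le_trans (ler_normD _ _) _; rewrite normr1; lra.
have reE : Re (cexp q - 1 - q) = (expR x - 1 - x) * cos y + (1 + x) * (cos y - 1).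
  by rewrite !cReD !cReN /cexp /= -/x -/y; ring.
have imE : Im (cexp q - 1 - q) = expR x * (sin y - y) + (expR x - 1) * y.
  by rewrite !cImD !cImN /cexp /= -/x -/y; ring.
have B1 : `|(expR x - 1 - x) * cos y| <= e * `|x|.
  rewrite normrM; apply: le_trans (ler_piMr _ _) E1 => //.
  by rewrite ler_norml cos_geN1 cos_le1.
have B2 : `|(1 + x) * (cos y - 1)| <= 2 * (e * `|y|).
  by rewrite normrM ler_pM //; apply: le_trans (ler_normD _ _) _; rewrite normr1; lra.
have B3 : `|expR x * (sin y - y)| <= 2 * (e * `|y|).
  by rewrite normrM ler_pM // -[X in `|X - _|]addr0.
have B4 : `|(expR x - 1) * y| <= e * `|y| by rewrite normrM ler_wpM2r.
rewrite reE imE; have := ler_normD ((expR x - 1 - x) * cos y) ((1 + x) * (cos y - 1)).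
have := ler_normD (expR x * (sin y - y)) ((expR x - 1) * y).
have : e * `|x| <= e * nc q by rewrite ler_wpM2l // ltW.
have : e * `|y| <= e * nc q by rewrite ler_wpM2l // ltW.
have : 6 * e * nc q <= e0 * nc q by rewrite ler_wpM2r ?nc_ge0.
by rewrite -mulrA; lra.
Qed.

Lemma cdiff_cexp p : cdiff cexp p (cexp p).
Proof.
move=> e e0; have ep : 0 < e / nc (cexp p) by rewrite divr_gt0 // nc_gt0 cexp_neq0.
have [d d0 H] := cdiff_cexp0 ep; exists d => // q qp.
have := H (q - p); rewrite subr0 => /(_ qp); rewrite cexp0 mul1r => H1.
have -> : cexp q - cexp p - cexp p * (q - p) = cexp p * (cexp (q - p) - 1 - (q - p)).
  have -> : cexp q = cexp p * cexp (q - p) by rewrite -cexpD addrC subrK.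
  ring.
rewrite ncM -ler_pdivlMl ?nc_gt0 ?cexp_neq0 //; apply: le_trans H1 _.
by rewrite mulrAC mulrC.
Qed.

End ComplexDerivative.

(** * Cauchy estimates and power series *)

Section CircleIntegrals.
Variable R : realType.
Notation nc := Normc.normc.
Notation Re := complex.Re.
Notation Im := complex.Im.
Implicit Types (f g : R[i] -> R[i]) (p q a A : R[i]).

Definition cis (y : R) : R[i] := cexp (0 +i* y).

Lemma cisE y : cis y = cos y +i* sin y.
Proof. by rewrite /cis /cexp /= expR0 !mul1r. Qed.

Lemma nc_cis y : nc (cis y) = 1.
Proof. by rewrite /cis nc_cexp /= expR0. Qed.

Lemma cis_neq0 y : cis y != 0. Proof. exact: cexp_neq0. Qed.

Lemma cisD x y : cis (x + y) = cis x * cis y.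
Proof. by rewrite /cis -cexpD; congr cexp; apply: complex_eq; rewrite ?cReD ?cImD /= ?addr0. Qed.

Lemma cis0 : cis 0 = 1. Proof. exact: cexp0. Qed.

Lemma cisN y : cis (- y) = (cis y)^-1.
Proof.
by apply: (mulfI (cis_neq0 y)); rewrite -cisD subrr cis0 divff // cis_neq0.
Qed.

Lemma cisX y n : cis y ^+ n = cis (n%:R * y).
Proof.
elim: n => [|n IHn]; first by rewrite expr0 mul0r cis0.
by rewrite exprS IHn -cisD -natr1 mulrDl mul1r addrC.
Qed.

Lemma cis2pi : cis (2 * pi) = 1.
Proof. by rewrite cisE mulrC mulr_natr cos2pi sin2pi. Qed.

Lemma cis_ccont c : ccont (fun y => cis (c * y)).
Proof.
apply: ccontP.
  have -> : @Re R \o (fun y => cis (c * y)) = (fun y => cos (c * y)).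
    by apply/funext => y; rewrite /comp cisE.
  move=> y; apply: (@continuous_comp _ _ _ (fun y => c * y) (@cos R)); last exact: continuous_cos.
  by apply: cvgM; [exact: cvg_cst|exact: cvg_id].
have -> : @Im R \o (fun y => cis (c * y)) = (fun y => sin (c * y)).
  by apply/funext => y; rewrite /comp cisE.
move=> y; apply: (@continuous_comp _ _ _ (fun y => c * y) (@sin R)); last exact: continuous_sin.
by apply: cvgM; [exact: cvg_cst|exact: cvg_id].
Qed.

Lemma cis_ccont1 : ccont cis.
Proof.
have -> : cis = fun y => cis (1 * y) by apply/funext => y; rewrite mul1r.
exact: cis_ccont.
Qed.

Let pi2_ge0 : 0 <= 2 * pi :> R.
Proof. by rewrite mulr_ge0 // pi_ge0. Qed.

Definition circ (u : R -> R[i]) := cint u 0 (2 * pi).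

Lemma circ_cis (j k : nat) :
  circ (fun y => cis ((j%:R - k%:R) * y)) = if j == k then (2 * pi)%:C else 0.
Proof.
case: eqVneq => [->|jk].
  have -> : (fun y => cis ((k%:R - k%:R) * y)) = fun=> 1.
    by apply/funext => y; rewrite subrr mul0r cis0.
  by rewrite /circ cint_cst // subr0 mulr1.
pose c : R := j%:R - k%:R.
have c0 : c != 0 by rewrite subr_eq0 eqr_nat.
pose U y := (sin (c * y) / c) +i* (- cos (c * y) / c).
rewrite /circ -/c; transitivity (U (2 * pi) - U 0).
  apply: cint_ftc => //.
  - exact: cis_ccont.
  - move=> y _; rewrite cisE; have -> : @Re R \o U = fun y => sin (c * y) / c by [].
    by apply: is_derive_eq; rewrite /GRing.scale /=; field.
  - move=> y _; rewrite cisE; have -> : @Im R \o U = fun y => - cos (c * y) / c by [].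
    by apply: is_derive_eq; rewrite /GRing.scale /=; field.
have := cisE (c * (2 * pi)); have -> : cis (c * (2 * pi)) = 1.
  rewrite /c mulrBl cisD cisN -(cisX (2 * pi) j) -(cisX (2 * pi) k) cis2pi !expr1n invr1 mulr1 //.
move=> [c1 s1]; rewrite /U -c1 -s1 mulr0 cos0 sin0.
by apply: complex_eq; rewrite ?cReD ?cImD ?cReN ?cImN /= subrr.
Qed.

Lemma circle_ccont f a s : (forall y, ccts_at f (a + s%:C * cis y)) ->
  ccont (fun y => f (a + s%:C * cis y)).
Proof.
move=> cf; apply: (@ccont_comp _ f (fun y => a + s%:C * cis y)) => //.
apply: ccontD; first exact: ccont_cst.
by apply: ccontM; [exact: ccont_cst|exact: cis_ccont1].
Qed.

(* In the logarithmic coordinate [w], [q = a + cexp w], concentric circles are the vertical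
   sides of a rectangle whose horizontal sides coincide by periodicity. *)
Lemma circle_constant f a (s1 s2 rho : R) : 0 < s1 -> s1 <= s2 -> s2 < rho ->
  (forall q, 0 < nc (q - a) < rho -> exists A, cdiff f q A) ->
  circ (fun y => f (a + s1%:C * cis y)) = circ (fun y => f (a + s2%:C * cis y)).
Proof.
move=> s10 s12 s2r fd.
have s20 : 0 < s2 by apply: lt_le_trans s12.
pose l1 := ln s1; pose l2 := ln s2.
have l12 : l1 <= l2 by rewrite /l1 /l2 ler_ln.
(* Clipping x at [l2] keeps the argument in the punctured disc, so [F] is continuous everywhere, as
   [goursat] demands, and unchanged on the rectangle. *)
pose F x y := f (a + cexp (Num.min x l2 +i* y)).
have Fdom x y : 0 < nc (a + cexp (Num.min x l2 +i* y) - a) < rho.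
  rewrite addrC addKr nc_cexp /= expR_gt0 /=.
  apply: le_lt_trans s2r; rewrite -[leRHS](lnK (x := s2)) ?posrE // ler_expR.
  by rewrite ge_min lexx orbT.
have Fc x y : ccts_at f (a + cexp (Num.min x l2 +i* y)).
  by have [A] := fd _ (Fdom x y); exact: cdiff_ccts.
have cexp_polar x y : cexp (x +i* y) = (expR x)%:C * cis y.
  by rewrite cisE; apply: complex_eq; rewrite ?cReM ?cImM /= ?mul0r ?subr0 ?addr0.
have Fx y : ccont (fun x => F x y).
  apply: (@ccont_comp _ f (fun x => a + cexp (Num.min x l2 +i* y))) => //.
  apply: ccontD; first exact: ccont_cst.
  under eq_fun do rewrite cexp_polar.
  apply: ccontM; last exact: ccont_cst.
  apply: ccont_real => x; apply: continuous_comp; last exact: continuous_expR.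
  by apply: (@continuous_min _ _ (fun x => x) (fun=> l2)); [exact: cvg_id|exact: cvg_cst].
have Fy x : ccont (F x).
  apply: (@ccont_comp _ f (fun y => a + cexp (Num.min x l2 +i* y))) => //.
  apply: ccontD; first exact: ccont_cst.
  under eq_fun do rewrite cexp_polar.
  by apply: ccontM; [exact: ccont_cst|exact: cis_ccont1].
have Fper x : F x (2 * pi) = F x 0.
  by rewrite /F !cexp_polar cis2pi cis0.
have lw : 0 <= l2 - l1 by rewrite subr_ge0.
have := @goursat R F Fx Fy l1 0 (l2 - l1) (2 * pi) lw pi2_ge0 _.
rewrite addrC subrK add0r => G.
have {}G : rect_int F l1 0 (l2 - l1) (2 * pi) = 0.
  apply: G => px py /andP[_ pxl] _.
  have pE : Num.min px l2 = px by rewrite min_l.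
  have [A fA] := fd _ (Fdom px py); rewrite pE in fA.
  have hA : cdiff (fun w => f (a + cexp w)) (px +i* py) (A * (0 + cexp (px +i* py))).
    apply: (@cdiff_comp _ f (fun w => a + cexp w)) => //.
    by apply: cdiffD; [exact: cdiff_cst|exact: cdiff_cexp].
  exists (A * (0 + cexp (px +i* py))) => e e0; have [d d0 H] := hA e e0.
  exists d => // x y /andP[_ xl] _ xyd.
  by rewrite /F pE (min_l xl); exact: (H (x +i* y)).
move: G; rewrite /rect_int add0r [l1 + _]addrC subrK.
have -> : (fun x => F x (2 * pi)) = (fun x => F x 0) by apply/funext => x.
move=> G.
have : 'i%C * (cint (F l2) 0 (2 * pi) - cint (F l1) 0 (2 * pi)) = 0 by rewrite -G; ring.
move/eqP; rewrite mulf_eq0 -nc_eq0 nci oner_eq0 /= subr_eq0 => /eqP E.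
rewrite /circ.
have E1 s : 0 < s -> s <= s2 -> F (ln s) = fun y => f (a + s%:C * cis y).
  move=> s0 ss; apply/funext => y; rewrite /F min_l ?ler_ln // cexp_polar lnK //.
by rewrite -(E1 s1 s10 s12) -(E1 s2 s20 (lexx _)) E.
Qed.

(** The difference quotient of [f] at [a] is holomorphic off [a]; its integral over circles does not
    depend on the radius and tends to 2 pi A as the radius shrinks. At radius s / 2 the quotient is
    at most 2 M / (s / 2), and [cint_le] doubles this to 8 M / s. *)
Lemma cauchy_derivative_bound f a A (M s : R) : 0 < s ->
  (forall q, nc (q - a) <= s -> exists A, cdiff f q A) -> cdiff f a A ->
  (forall q, nc (q - a) <= s -> nc (f q) <= M) -> nc A <= 8 * M / s.
Proof.
move=> s0 fd fA fM.
pose h q := (f q - f a) / (q - a).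
have aK (z : R[i]) : a + z - a = z by rewrite addrC addKr.
have fdh q : 0 < nc (q - a) < s -> exists A, cdiff h q A.
  move=> /andP[q0 qs]; have [B fB] := fd q (ltW qs).
  have qa : q - a != 0 by rewrite -nc_gt0.
  have H1 := cdiffB fB (cdiff_cst (f a) q).
  have H2 := cdiff_comp (cdiffB (cdiff_id q) (cdiff_cst a q)) (cdiffV qa).
  by eexists; exact: (cdiffM H1 H2).
have hc t : 0 < t -> t < s -> ccont (fun y => h (a + t%:C * cis y)).
  move=> t0 ts; apply: circle_ccont => y.
  have [|B] := fdh (a + t%:C * cis y); last exact: cdiff_ccts.
  by rewrite aK ncM nc_real nc_cis mulr1 gtr0_norm // t0.
have s20 : 0 < s / 2 by rewrite divr_gt0.
have s2s : s / 2 < s by rewrite ltr_pdivrMr // ltr_pMr // ltr1n.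
have N t y : 0 < t -> nc (t%:C * cis y) = t.
  by move=> t0; rewrite ncM nc_real nc_cis mulr1 gtr0_norm.
have bound : nc (circ (fun y => h (a + (s / 2)%:C * cis y))) <= 2 * (2 * M / (s / 2)) * (2 * pi).
  rewrite -[X in _ <= _ * X](subr0 (2 * pi)); apply: cint_le => //; first exact: hc.
  move=> y _; rewrite /h aK ncM ncV N // ler_wpM2r ?invr_ge0 ?(ltW s20) //.
  apply: le_trans (ncB _ _) _; have := fM a; rewrite subrr nc0 => /(_ (ltW s0)).
  have := fM (a + (s / 2)%:C * cis y); rewrite aK N // => /(_ (ltW s2s)).
  lra.
have limE : circ (fun y => h (a + (s / 2)%:C * cis y)) = (2 * pi)%:C * A.
  apply/eqP; rewrite -subr_eq0 -nc_eq0 eq_le nc_ge0 andbT.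
  apply/ler_addgt0Pr => e e0; rewrite add0r.
  have pi4 : 0 < 2 * (2 * pi) :> R by rewrite !mulr_gt0 // pi_gt0.
  have e4 : 0 < e / (2 * (2 * pi)) by rewrite divr_gt0.
  have [d d0 Hd] := fA _ e4.
  pose t := Num.min (d / 2) (s / 2).
  have t0 : 0 < t by rewrite lt_min s20 divr_gt0.
  have ts : t <= s / 2 by rewrite ge_min lexx orbT.
  have td : t < d by apply: le_lt_trans (_ : t <= d / 2) _; [rewrite ge_min lexx|lra].
  rewrite -(circle_constant t0 ts s2s fdh).
  have := @cint_cst R A 0 (2 * pi) pi2_ge0; rewrite subr0 => <-.
  rewrite /circ -cintB //; last 2 first.
  - by apply: hc => //; apply: le_lt_trans ts s2s.
  - exact: ccont_cst.
  have p0 : pi != 0 :> R by rewrite gt_eqF // pi_gt0.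
  have -> : e = 2 * (e / (2 * (2 * pi))) * (2 * pi - 0).
    by rewrite subr0 [RHS]mulrAC [RHS]mulrC divfK // gt_eqF.
  apply: cint_le => //.
    apply: ccontB; last exact: ccont_cst.
    by apply: hc => //; apply: le_lt_trans ts s2s.
  move=> y _; rewrite /h aK.
  have q0 : t%:C * cis y != 0 by rewrite -nc_gt0 N.
  have := Hd (a + t%:C * cis y); rewrite aK N // => /(_ td) H.
  have -> : (f (a + t%:C * cis y) - f a) / (t%:C * cis y) - A =
     (f (a + t%:C * cis y) - f a - A * (t%:C * cis y)) / (t%:C * cis y).
    by rewrite [RHS]mulrBl mulfK.
  by rewrite ncM ncV N // ler_pdivrMr.
move: bound; rewrite limE ncM nc_real ger0_norm //.
have -> : 2 * (2 * M / (s / 2)) * (2 * pi) = 2 * pi * (8 * M / s) by field; rewrite gt_eqF.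
by rewrite ler_pM2l // mulr_gt0 // pi_gt0.
Qed.

End CircleIntegrals.

Section PowerSeries.
Variable R : realType.
Notation nc := Normc.normc.
Notation Re := complex.Re.
Notation Im := complex.Im.
Implicit Types (f g : R[i] -> R[i]) (p q a A : R[i]) (u v : nat -> R[i]).

Definition series_near0 f u := exists2 d : R, 0 < d &
  forall q, nc q < d -> forall e : R, 0 < e -> exists N : nat,
    forall n, (N <= n)%N -> nc (\sum_(k < n) u k * q ^+ k - f q) <= e.

Lemma series_near0B f g u v : series_near0 f u -> series_near0 g v ->
  series_near0 (fun q => f q - g q) (fun k => u k - v k).
Proof.
move=> [d d0 H] [d' d'0 H']; exists (Num.min d d'); first by rewrite lt_min d0.
move=> q; rewrite lt_min => /andP[q1 q2] e e0; have e2 : 0 < e / 2 by rewrite divr_gt0.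
have [N HN] := H q q1 _ e2; have [N' HN'] := H' q q2 _ e2.
exists (maxn N N') => n; rewrite geq_max => /andP[n1 n2].
have -> : \sum_(k < n) (u k - v k) * q ^+ k - (f q - g q) =
    (\sum_(k < n) u k * q ^+ k - f q) - (\sum_(k < n) v k * q ^+ k - g q).
  under eq_bigr do rewrite mulrBl; rewrite sumrB; ring.
by apply: le_trans (ncB _ _) _; rewrite (splitr e) lerD ?HN ?HN'.
Qed.

Lemma series_near0_rotate f u w : nc w = 1 -> series_near0 f u ->
  series_near0 (fun q => f (q * w)) (fun k => u k * w ^+ k).
Proof.
move=> w1 [d d0 H]; exists d => // q qd e e0.
have [|N HN] := H (q * w) _ e e0; first by rewrite ncM w1 mulr1.
exists N => n /HN; congr (nc (_ - _) <= _); apply: eq_bigr => k _.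
by rewrite exprMn mulrAC mulrA.
Qed.

Lemma geometric_tail (x : R) m n : 0 <= x < 1 -> (m <= n)%N ->
  \sum_(m <= k < n) x ^+ k <= x ^+ m / (1 - x).
Proof.
move=> /andP[x0 x1] mn; have y0 : 0 < 1 - x by rewrite subr_gt0.
have -> : \sum_(m <= k < n) x ^+ k = (x ^+ m - x ^+ n) / (1 - x).
  rewrite -(subnKC mn); elim: (n - m)%N => [|j IHj].
    by rewrite addn0 big_geq // subrr mul0r.
  rewrite addnS big_nat_recr ?leq_addr //= IHj exprS.
  by field; rewrite gt_eqF.
by rewrite ler_wpM2r ?invr_ge0 ?(ltW y0) // gerBl exprn_ge0.
Qed.

(** Abel's argument: convergence at one point [s0] bounds the terms there, which forces geometric
    decay on smaller circles. *)
Lemma series_tail f u : series_near0 f u ->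
  exists s0 M : R, [/\ 0 < s0, 0 <= M & forall q, nc q < s0 -> forall N,
    nc (f q - \sum_(k < N) u k * q ^+ k) <= M * ((nc q / s0) ^+ N / (1 - nc q / s0))].
Proof.
move=> [d d0 H]; pose s0 := d / 2; have s00 : 0 < s0 by rewrite divr_gt0.
have ns0 : nc s0%:C = s0 by rewrite nc_real gtr0_norm.
have s0d : nc s0%:C < d by rewrite ns0 ltr_pdivrMr // ltr_pMr // ltr1n.
have [N HN] := H _ s0d 1 ltr01.
(* From index [N] on, partial sums are within 1 of [f], so a single term is at most 2; the finite
   sum covers the earlier terms. *)
pose M := 2 + \sum_(k < N) nc (u k) * s0 ^+ k.
have M0 : 0 <= \sum_(k < N) nc (u k) * s0 ^+ k.
  by apply: sumr_ge0 => k _; rewrite mulr_ge0 ?nc_ge0 ?exprn_ge0 // ltW.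
have uM k : nc (u k) * s0 ^+ k <= M.
  have [kN|Nk] := ltnP k N.
    rewrite /M (bigD1 (Ordinal kN)) //= addrCA lerDl addr_ge0 //.
    by apply: sumr_ge0 => j _; rewrite mulr_ge0 ?nc_ge0 ?exprn_ge0 // ltW.
  have h1 := HN k Nk; have h2 := HN k.+1 (leqW Nk).
  have -> : nc (u k) * s0 ^+ k = nc ((\sum_(j < k.+1) u j * s0%:C ^+ j - f s0%:C) -
      (\sum_(j < k) u j * s0%:C ^+ j - f s0%:C)).
    by rewrite big_ord_recr /= opprB addrA subrK addrAC subrr add0r ncM ncX ns0.
  by apply: le_trans (ncB _ _) _; rewrite /M; lra.
exists s0, M; split; [by []|by rewrite /M; lra|move=> q qs m].
set x := nc q / s0; have x01 : 0 <= x < 1.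
  by rewrite /x divr_ge0 ?nc_ge0 ?(ltW s00) //= ltr_pdivrMr // mul1r.
apply/ler_addgt0Pr => e e0.
have qd : nc q < d by apply: lt_trans qs _; move: s0d; rewrite ns0.
have [N' HN'] := H q qd e e0.
pose n := maxn m N'; have mn : (m <= n)%N by rewrite leq_maxl.
have := HN' n (leq_maxr _ _) => h.
have -> : f q - \sum_(k < m) u k * q ^+ k =
    \sum_(m <= k < n) u k * q ^+ k - (\sum_(k < n) u k * q ^+ k - f q).
  rewrite -!(big_mkord xpredT (fun k => u k * q ^+ k)) (@big_cat_nat _ _ _ m 0 n) //=; ring.
apply: le_trans (ncB _ _) _; apply: lerD => //.
apply: le_trans (nc_sum _ _ _) _.
apply: (@le_trans _ _ (M * \sum_(m <= k < n) x ^+ k)).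
  rewrite mulr_sumr; apply: ler_sum => k _; rewrite ncM ncX /x expr_div_n mulrA.
  rewrite ler_pdivlMr ?exprn_gt0 // mulrAC ler_wpM2r ?exprn_ge0 ?nc_ge0 //.
by rewrite ler_wpM2l ?geometric_tail // /M; lra.
Qed.

Lemma geometric_small (x C e : R) : 0 <= x < 1 -> 0 < e -> 0 <= C ->
  exists N, forall n, (N <= n)%N -> C * x ^+ n <= e.
Proof.
move=> /andP[x0 x1] e0 C0.
have : (fun n => C * x ^+ n) @ \oo --> C * 0.
  by apply: cvgM; [exact: cvg_cst|apply: cvg_expr; rewrite ger0_norm].
rewrite mulr0 => /cvgrPdist_le /(_ e e0) [N _ HN]; exists N => n /HN.
by rewrite sub0r normrN ger0_norm // mulr_ge0 // exprn_ge0.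
Qed.

Let pi2_ge0 : 0 <= 2 * pi :> R.
Proof. by rewrite mulr_ge0 // pi_ge0. Qed.

Lemma ccont_circle f (s : R) : (forall y, ccts_at f (s%:C * cis y)) ->
  ccont (fun y => f (s%:C * cis y)).
Proof.
move=> cf; have := @circle_ccont _ f 0 s; under eq_fun do rewrite add0r.
by apply => y; rewrite add0r.
Qed.

Lemma coef_circ_small f u : series_near0 f u -> exists2 s0 : R, 0 < s0 &
  forall s, 0 < s < s0 -> (forall y, ccts_at f (s%:C * cis y)) ->
  forall k, circ (fun y => f (s%:C * cis y) * cis (- k%:R * y)) =
    (2 * pi)%:C * (u k * s%:C ^+ k).
Proof.
move=> /series_tail [s0 [M [s00 M0 HM]]]; exists s0 => // s /andP[sp ss0] cf k.
have ns y : nc (s%:C * cis y) = s by rewrite ncM nc_real nc_cis mulr1 gtr0_norm.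
have cq : ccont (fun y => f (s%:C * cis y) * cis (- k%:R * y)).
  by apply: ccontM; [exact: ccont_circle|exact: cis_ccont].
pose S n y := \sum_(j < n) u j * (s%:C ^+ j) * cis ((j%:R - k%:R) * y).
have cS n : ccont (S n).
  apply: ccont_sum => j; apply: ccontM; [exact: ccont_cst|exact: cis_ccont].
have circS n : (k < n)%N -> circ (S n) = (2 * pi)%:C * (u k * s%:C ^+ k).
  move=> kn; rewrite /circ /S cint_sum //; last first.
    by move=> j; apply: ccontM; [exact: ccont_cst|exact: cis_ccont].
  rewrite (bigD1 (Ordinal kn)) //= big1 ?addr0 => [|j jk].
    by rewrite cintZ //; [rewrite -/(circ _) circ_cis eqxx mulrC|exact: cis_ccont].
  rewrite cintZ //; last exact: cis_ccont.
  by rewrite -/(circ _) circ_cis (negPf (_ : (j : nat) != k)) ?mulr0.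
apply/eqP; rewrite -subr_eq0 -nc_eq0 eq_le nc_ge0 andbT.
apply/ler_addgt0Pr => e e0; rewrite add0r.
set x := s / s0; have x01 : 0 <= x < 1.
  by rewrite /x divr_ge0 ?(ltW sp) ?(ltW s00) //= ltr_pdivrMr // mul1r.
pose C := 2 * (M / (1 - x)) * (2 * pi).
have x1 : 0 < 1 - x by case/andP: x01 => _; rewrite subr_gt0.
have C0 : 0 <= C by rewrite /C !mulr_ge0 ?pi_ge0 ?invr_ge0 ?(ltW x1).
have [N HN] := geometric_small x01 e0 C0.
pose n := maxn N k.+1; have kn : (k < n)%N by rewrite leq_maxr.
rewrite -(circS n kn) /circ -cintB //.
apply: le_trans _ (HN n (leq_maxl _ _)).
have -> : C * x ^+ n = 2 * (M * (x ^+ n / (1 - x))) * (2 * pi - 0) by rewrite /C subr0; ring.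
apply: cint_le => //; first exact: ccontB.
move=> y _; have -> : f (s%:C * cis y) * cis (- k%:R * y) - S n y =
    (f (s%:C * cis y) - \sum_(j < n) u j * (s%:C * cis y) ^+ j) * cis (- k%:R * y).
  rewrite mulrBl mulr_suml; congr (_ - _); apply: eq_bigr => j _.
  by rewrite exprMn mulrDl cisD cisX !mulrA.
by rewrite ncM nc_cis mulr1; have := HM (s%:C * cis y); rewrite ns => /(_ ss0 n).
Qed.

Lemma series_unique f u v : series_near0 f u -> series_near0 f v -> u =1 v.
Proof.
move=> fu fv k; have := series_near0B fu fv => /coef_circ_small [s0 s00 H].
have s2 : 0 < s0 / 2 < s0 by rewrite divr_gt0 //= ltr_pdivrMr // ltr_pMr // ltr1n.
have c0 : (fun q => f q - f q) = fun=> 0 by apply/funext => q; rewrite subrr.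
have := H _ s2 _ k; rewrite c0 => /(_ (fun y => ccts_cst 0 _)).
rewrite (_ : (fun y : R => _) = fun=> 0); last by apply/funext => y; rewrite subrr mul0r.
rewrite /circ cint0 // => /esym/eqP; rewrite !mulf_eq0 expf_eq0.
have /negPf -> : (2 * pi)%:C != 0 :> R[i].
  by rewrite -nc_gt0 nc_real normr_gt0 mulf_neq0 // gt_eqF // pi_gt0.
have /negPf -> : (s0 / 2)%:C != 0 :> R[i].
  by rewrite -nc_gt0 nc_real normr_gt0 gt_eqF //; case/andP: s2.
by rewrite andbF orbF /= subr_eq0 => /eqP.
Qed.

(** On small circles the series can be integrated. As f / q ^ k is holomorphic off 0,
    [circle_constant] carries the formula to any radius below [rho], where nothing is known about
    convergence of the series. *)
Lemma coef_circ f u (rho s : R) k : series_near0 f u ->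
  (forall q, nc q < rho -> exists A, cdiff f q A) -> 0 < s -> s < rho ->
  circ (fun y => f (s%:C * cis y) * cis (- k%:R * y)) =
    (2 * pi)%:C * (u k * s%:C ^+ k).
Proof.
move=> fu fd s_gt0 srho; have [s0 s00 H] := coef_circ_small fu.
pose t := Num.min (s0 / 2) s.
have t0 : 0 < t by rewrite lt_min s_gt0 divr_gt0.
have ts : t <= s by rewrite ge_min lexx orbT.
have ts0 : t < s0 by apply: (@le_lt_trans _ _ (s0 / 2)); [rewrite ge_min lexx|lra].
have nts (r : R) y : 0 < r -> nc (r%:C * cis y) = r.
  by move=> r0; rewrite ncM nc_real nc_cis mulr1 gtr0_norm.
pose g q := f q * (q ^+ k)^-1.
have gd q : 0 < nc (q - 0) < rho -> exists A, cdiff g q A.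
  rewrite subr0 => /andP[q0 qr]; have [A fA] := fd q qr.
  have [B HB] : exists B, cdiff (fun q => q ^+ k) q B.
    clear g; elim: k => [|j [B HB]]; first by exists 0; exact: cdiff_cst.
    exists (1 * q ^+ j + q * B).
    have -> : (fun q => q ^+ j.+1) = fun q : R[i] => q * q ^+ j.
      by apply/funext => z; rewrite exprS.
    exact: cdiffM (cdiff_id q) HB.
  have qk : q ^+ k != 0 by rewrite expf_neq0 // -nc_gt0.
  by eexists; exact: (cdiffM fA (cdiff_comp HB (cdiffV qk))).
have gE (r : R) : 0 < r -> r < rho -> circ (fun y => g (0 + r%:C * cis y)) =
    (r%:C ^+ k)^-1 * circ (fun y => f (r%:C * cis y) * cis (- k%:R * y)).
  move=> r0 rr; rewrite /circ -cintZ //.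
    congr cint; apply/funext => y; rewrite add0r /g exprMn invfM cisX -cisN mulNr.
    ring.
  apply: ccontM; last exact: cis_ccont.
  apply: ccont_circle => y; have [|A] := fd (r%:C * cis y); first by rewrite nts.
  exact: cdiff_ccts.
have := circle_constant t0 ts srho gd; rewrite !gE //; last exact: le_lt_trans srho.
have tk : (t%:C : R[i]) ^+ k != 0.
  by rewrite expf_neq0 // -nc_gt0 nc_real normr_gt0 gt_eqF.
have sk : (s%:C : R[i]) ^+ k != 0.
  by rewrite expf_neq0 // -nc_gt0 nc_real normr_gt0 gt_eqF.
rewrite (H t); [|by rewrite t0|]; last first.
  move=> y; have [|A] := fd (t%:C * cis y); first by rewrite nts // (le_lt_trans ts).
  exact: cdiff_ccts.
have cancel (x y z : R[i]) : x != 0 -> x^-1 * (y * (z * x)) = y * z by move=> x0; field.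
move=> E; apply: (mulfI (_ : (s%:C ^+ k)^-1 != 0)); first by rewrite invr_eq0.
by rewrite -E (cancel _ _ _ tk) (cancel _ _ _ sk).
Qed.

Lemma bessel f u (rho s M : R) N : series_near0 f u ->
  (forall q, nc q < rho -> exists A, cdiff f q A) ->
  (forall q, nc q < rho -> nc (f q) <= M) -> 0 < s -> s < rho ->
  \sum_(k < N) (nc (u k) * s ^+ k) ^+ 2 <= M ^+ 2.
Proof.
move=> fu fd fM s0 srho.
pose c k := u k * s%:C ^+ k.
have ncc k : nc (c k) = nc (u k) * s ^+ k by rewrite ncM ncX nc_real gtr0_norm.
pose Sc y := \sum_(k < N) (c k)^* * cis (- k%:R * y).
pose S y := \sum_(k < N) c k * cis (k%:R * y).
have ScE y : (S y)^* = Sc y.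
  rewrite /S /Sc rmorph_sum; apply: eq_bigr => k _; rewrite rmorphM; congr (_ * _).
  by rewrite !cisE mulNr cosN sinN.
have cSc : ccont Sc.
  by apply: ccont_sum => k; apply: ccontM; [exact: ccont_cst|exact: cis_ccont].
have cS : ccont S.
  by apply: ccont_sum => k; apply: ccontM; [exact: ccont_cst|exact: cis_ccont].
have nq y : nc (s%:C * cis y) < rho by rewrite ncM nc_real nc_cis mulr1 gtr0_norm.
have cq : ccont (fun y => f (s%:C * cis y)).
  by apply: ccont_circle => y; have [A] := fd _ (nq y); exact: cdiff_ccts.
(* The real part of [U] is M ^ 2 - |f| ^ 2 + |f - S| ^ 2, which is non-negative, while its integral
   involves only the coefficients of order below [N]. *)
pose U y := (M ^+ 2)%:C - 2 * (f (s%:C * cis y) * Sc y) + S y * Sc y.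
have cqS : ccont (fun y => f (s%:C * cis y) * Sc y) by exact: ccontM.
have c2qS : ccont (fun y => 2 * (f (s%:C * cis y) * Sc y)).
  by apply: ccontM => //; exact: ccont_cst.
have cSS : ccont (fun y => S y * Sc y) by exact: ccontM.
have cU : ccont U by apply: ccontD => //; apply: ccontB => //; exact: ccont_cst.
have U0 y : 0 <= Re (U y).
  have -> : Re (U y) = M ^+ 2 - nc (f (s%:C * cis y)) ^+ 2 + nc (f (s%:C * cis y) - S y) ^+ 2.
    rewrite /U -ScE !nc_sqr; move: (f _) (S y) => [a b] [a' b'] /=.
    by rewrite !(mulr0, mul0r, subr0, addr0, add0r, oppr0); ring.
  rewrite addr_ge0 ?sqr_ge0 // subr_ge0 ler_sqr ?nnegrE ?nc_ge0 ?fM //.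
  by apply: le_trans (nc_ge0 _) (fM _ (nq y)).
have := cint_Re_ge0 pi2_ge0 cU (fun y _ => U0 y).
pose W : R := \sum_(k < N) nc (c k) ^+ 2.
have ccE k : c k * (c k)^* = (nc (c k) ^+ 2)%:C.
  by rewrite nc_sqr; case: (c k) => a b; apply: complex_eq => /=; ring.
have I1 : cint (fun y => f (s%:C * cis y) * Sc y) 0 (2 * pi) = (2 * pi)%:C * W%:C.
  have -> : (fun y => f (s%:C * cis y) * Sc y) = fun y =>
      \sum_(k < N) (c k)^* * (f (s%:C * cis y) * cis (- k%:R * y)).
    by apply/funext => y; rewrite /Sc mulr_sumr; apply: eq_bigr => k _; rewrite mulrCA.
  have cf k : ccont (fun y => f (s%:C * cis y) * cis (- k%:R * y)).
    by apply: ccontM => //; exact: cis_ccont.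
  rewrite cint_sum //; last by move=> k; apply: ccontM => //; exact: ccont_cst.
  rewrite /W rmorph_sum mulr_sumr; apply: eq_bigr => k _.
  rewrite cintZ // -/(circ _) (coef_circ k fu fd s0 srho) -/(c k) mulrCA; congr (_ * _).
  by rewrite mulrC ccE.
have I2 : cint (fun y => S y * Sc y) 0 (2 * pi) = (2 * pi)%:C * W%:C.
  have -> : (fun y => S y * Sc y) = fun y =>
      \sum_(k < N) (c k)^* * (\sum_(j < N) c j * cis ((j%:R - k%:R) * y)).
    apply/funext => y; rewrite /Sc mulr_sumr; apply: eq_bigr => k _.
    rewrite mulrCA; congr (_ * _); rewrite /S mulr_suml; apply: eq_bigr => j _.
    by rewrite -mulrA -cisD mulrDl.
  have cj (k j : nat) : ccont (fun y => c j * cis ((j%:R - k%:R) * y)).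
    by apply: ccontM; [exact: ccont_cst|exact: cis_ccont].
  have cjs (k : nat) : ccont (fun y => \sum_(j < N) c j * cis ((j%:R - k%:R) * y)).
    by apply: ccont_sum => j; exact: cj.
  rewrite cint_sum //; last by move=> k; apply: ccontM => //; exact: ccont_cst.
  rewrite /W rmorph_sum mulr_sumr; apply: eq_bigr => k _.
  rewrite cintZ // cint_sum // (bigD1 k) //= big1 ?addr0 => [|j jk].
    rewrite cintZ //; last exact: cis_ccont.
    by rewrite -/(circ _) circ_cis eqxx -ccE; ring.
  rewrite cintZ //; last exact: cis_ccont.
  by rewrite -/(circ _) circ_cis (negPf (_ : (j : nat) != k)) ?mulr0.
rewrite /U cintD //; last by apply: ccontB => //; exact: ccont_cst.
rewrite cintB //; last exact: ccont_cst.
rewrite cintZ // cint_cst // subr0 I1 I2.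
have -> : (2 * pi)%:C * (M ^+ 2)%:C - 2 * ((2 * pi)%:C * W%:C) + (2 * pi)%:C * W%:C =
    (2 * pi * (M ^+ 2 - W))%:C :> R[i].
  by apply: complex_eq => /=; ring.
rewrite /= pmulr_rge0; last by rewrite mulr_gt0 // pi_gt0.
by rewrite subr_ge0 (_ : W = \sum_(k < N) (nc (u k) * s ^+ k) ^+ 2) //; apply: eq_bigr => k _; rewrite ncc.
Qed.

End PowerSeries.

(** * Complex logarithm *)

Section Logarithm.
Variable R : realType.
Notation nc := Normc.normc.
Notation Re := complex.Re.
Notation Im := complex.Im.
Implicit Types (f g : R[i] -> R[i]) (p q z w t a A : R[i]).

Lemma eps_is_derive (f : R -> R) (x d : R) :
  (forall e : R, 0 < e -> exists2 r : R, 0 < r &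
    forall h, `|h| < r -> `|f (x + h) - f x - d * h| <= e * `|h|) -> is_derive x 1 f d.
Proof.
move=> H.
have Hc : (fun h : R => h^-1 *: ((f \o shift x) (h *: (1 : R)) - f x)) @ 0^' --> d.
  apply/cvgrPdist_le => e e0; have [r r0 Hr] := H e e0.
  rewrite nearE /dnbhs /within /=; apply/nbhs_ballP; exists r => // h.
  rewrite /ball /= sub0r normrN => hr h0.
  rewrite /GRing.scale /= mulr1 [h + x]addrC distrC; have := Hr h hr.
  have -> : f (x + h) - f x - d * h = (h^-1 * (f (x + h) - f x) - d) * h.
    by field.
  by rewrite normrM ler_pM2r // normr_gt0.
apply: DeriveDef; first by apply/cvg_ex; exists d.
exact: cvg_lim Hc.
Qed.

Lemma cdiff_is_derive f A (x : R) : cdiff f x%:C A ->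
  is_derive x 1 (fun y : R => Re (f y%:C)) (Re A) /\
  is_derive x 1 (fun y : R => Im (f y%:C)) (Im A).
Proof.
move=> fA; have H (e : R) : 0 < e -> exists2 r : R, 0 < r & forall h, `|h| < r ->
    nc (f (x + h)%:C - f x%:C - A * h%:C) <= e * `|h|.
  move=> e0; have [d d0 Hd] := fA e e0; exists d => // h hd; have := Hd (x + h)%:C.
  have -> : (x + h)%:C - x%:C = h%:C by rewrite -rmorphB addrC addKr.
  by rewrite nc_real; apply.
split; apply: eps_is_derive => e e0; have [r r0 Hr] := H e e0; exists r => // h /Hr.
  apply: le_trans; apply: le_trans (nc_Re _).
  by rewrite !(cReD, cReN, cReM) /= mulr0 subr0.
apply: le_trans; apply: le_trans (nc_Im _).
by rewrite !(cImD, cImN, cImM) /= mulr0 add0r.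
Qed.

Lemma path_bound f (A : R -> R[i]) (a b M : R) : a <= b ->
  (forall x, a <= x <= b -> cdiff f x%:C (A x)) ->
  (forall x, a <= x <= b -> nc (A x) <= M) -> nc (f b%:C - f a%:C) <= 2 * M * (b - a).
Proof.
move=> ab fA AM; apply: le_trans (nc_ReIm _) _.
have -> : 2 * M * (b - a) = M * (b - a) + M * (b - a) by ring.
rewrite !(cReD, cReN, cImD, cImN); apply: lerD.
  apply: (@derive_bound _ (fun y => Re (f y%:C)) (fun x => Re (A x))) => // x xab.
    by have [] := cdiff_is_derive (fA x xab).
  exact: le_trans (nc_Re _) (AM x xab).
apply: (@derive_bound _ (fun y => Im (f y%:C)) (fun x => Im (A x))) => // x xab.
  by have [] := cdiff_is_derive (fA x xab).
exact: le_trans (nc_Im _) (AM x xab).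
Qed.

Lemma cdiffX p n : cdiff (fun q => q ^+ n) p (n%:R * p ^+ n.-1).
Proof.
elim: n => [|n IHn]; first by rewrite mul0r; exact: cdiff_cst.
have -> : (fun q => q ^+ n.+1) = fun q : R[i] => q * q ^+ n.
  by apply/funext => z; rewrite exprS.
have := cdiffM (cdiff_id p) IHn; congr cdiff.
case: n {IHn} => [|n] /=; first by rewrite mul0r mulr0 addr0 mul1r.
by rewrite mul1r mulrCA -exprS -[in RHS]natr1 mulrDl mul1r addrC.
Qed.

Lemma Re_nc z : - nc z <= Re z <= nc z.
Proof. by rewrite -ler_norml nc_Re. Qed.

Lemma abs_carg z : `|carg z| = acos (Re z / nc z).
Proof.
have H : -1 <= Re z / nc z <= 1.
  have [->|] := eqVneq z 0; first by rewrite nc0 invr0 mulr0; apply/andP; split; lra.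
  rewrite -nc_gt0 => z0; rewrite ler_pdivlMr // ler_pdivrMr // mul1r mulN1r; exact: Re_nc.
by rewrite /carg; case: ifP => _; rewrite ?normrN ger0_norm ?acos_ge0.
Qed.

(** The half-angle formula gives the argument by one expression on the plane slit along the
    non-positive reals, which is the meaning of the hypothesis. Continuity is then visible, unlike
    in the definition by cases on the sign of Im z. *)
Lemma carg_atan z : 0 < nc z + Re z -> carg z = 2 * atan (Im z / (nc z + Re z)).
Proof.
move=> z0; set T := Im z / _; set x := 2 * atan T.
have nz : 0 < nc z.
  rewrite nc_gt0; apply: contraTneq z0 => ->; by rewrite nc0 add0r ltxx.
have cx : cos x = Re z / nc z.
  rewrite /x mulrC mulr_natr cos_mulr2n cos_atan exprVn sqr_sqrtr; last first.
    by rewrite addr_ge0 // sqr_ge0.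
  have -> : 1 + T ^+ 2 = 2 * nc z / (nc z + Re z).
    have e := nc_sqr z; rewrite /T expr_div_n.
    have -> : Im z ^+ 2 = nc z ^+ 2 - Re z ^+ 2 by rewrite e; ring.
    by field; rewrite gt_eqF.
  by rewrite mulr2n; field; rewrite !gt_eqF.
have [t1 t2] := (atan_gtNpi2 T, atan_ltpi2 T).
rewrite /carg -cx; case: leP => z1.
  rewrite cosK // in_itv /= /x; apply/andP; split; last by lra.
  have : atan 0 <= atan T by apply: le_atan; rewrite divr_ge0 // ltW.
  by rewrite atan0; lra.
rewrite cosKN ?opprK // /x; apply/andP; split; first by lra.
have : atan T <= atan 0 by apply: le_atan; rewrite ler_pdivrMr // mul0r ltW.
by rewrite atan0; lra.
Qed.

Lemma cexp_clog z : 0 < nc z + Re z -> cexp (clog z) = z.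
Proof.
move=> z0; rewrite /clog carg_atan //; set T := Im z / _.
have nz : 0 < nc z.
  rewrite nc_gt0; apply: contraTneq z0 => ->; by rewrite nc0 add0r ltxx.
have e := nc_sqr z.
have TE : 1 + T ^+ 2 = 2 * nc z / (nc z + Re z).
  rewrite /T expr_div_n.
  have -> : Im z ^+ 2 = nc z ^+ 2 - Re z ^+ 2 by rewrite e; ring.
  by field; rewrite gt_eqF.
have T0 : 0 <= 1 + T ^+ 2 by rewrite addr_ge0 // sqr_ge0.
have c2 : cos (atan T) ^+ 2 = (nc z + Re z) / (2 * nc z).
  by rewrite cos_atan exprVn sqr_sqrtr // TE invf_div.
have ca : cos (atan T) != 0 by rewrite cos_atan invr_neq0 // gt_eqF // sqrtr_gt0 ltr_pwDl // sqr_ge0.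
have sc : sin (atan T) = T * cos (atan T) by rewrite -[T in T * _]atanK /tan divfK.
apply: complex_eq; rewrite /cexp /= lnK ?posrE // [2 * _]mulrC mulr_natr.
  by rewrite cos_mulr2n c2 mulr2n; field; rewrite gt_eqF.
rewrite sin_mulr2n sc mulrCA -expr2 c2 mulr2n /T; field.
by rewrite !gt_eqF.
Qed.

Lemma ccts_nc p : ccts_at (fun q => (nc q)%:C) p.
Proof.
move=> e e0; exists e => // q qp; rewrite -rmorphB nc_real.
apply: le_trans _ (ltW qp); rewrite ler_norml; apply/andP; split.
  have := ncD (p - q) q; rewrite subrK nc_distC; lra.
have := ncD (q - p) p; rewrite subrK; lra.
Qed.

Lemma ccts_Re p : ccts_at (fun q => (Re q)%:C) p.
Proof.
move=> e e0; exists e => // q qp; rewrite -rmorphB nc_real -cReN -cReD.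
exact: le_trans (nc_Re _) (ltW qp).
Qed.

Lemma ccts_Im p : ccts_at (fun q => (Im q)%:C) p.
Proof.
move=> e e0; exists e => // q qp; rewrite -rmorphB nc_real -cImN -cImD.
exact: le_trans (nc_Im _) (ltW qp).
Qed.

Lemma ccts_pos (u : R[i] -> R) p : ccts_at (fun q => (u q)%:C) p -> 0 < u p ->
  exists2 d : R, 0 < d & forall q, nc (q - p) < d -> 0 < u q.
Proof.
move=> cu up; have up2 : 0 < u p / 2 by rewrite divr_gt0.
have [d d0 H] := cu _ up2; exists d => // q /H.
by rewrite -rmorphB nc_real ler_norml => /andP[]; lra.
Qed.

Lemma slit_open p : 0 < nc p + Re p ->
  exists2 d : R, 0 < d & forall q, nc (q - p) < d -> 0 < nc q + Re q.
Proof.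
apply: ccts_pos; have -> : (fun q : R[i] => (nc q + Re q)%:C) = fun q => (nc q)%:C + (Re q)%:C.
  by apply/funext => q; rewrite rmorphD.
by apply: cctsD; [exact: ccts_nc|exact: ccts_Re].
Qed.

Lemma ln_continuous_eps (x e : R) : 0 < x -> 0 < e ->
  exists2 d : R, 0 < d & forall y, `|y - x| < d -> `|ln y - ln x| <= e.
Proof.
move=> x0 e0; have /cvgrPdist_le /(_ e e0) := continuous_ln x0.
rewrite nearE => /nbhs_ballP[d /= d0 H]; exists d => // y yx.
by rewrite distrC; apply: H; rewrite /ball /= distrC.
Qed.

Lemma ccts_clog p : 0 < nc p + Re p -> ccts_at (@clog R) p.
Proof.
move=> p0.
have np : 0 < nc p.
  rewrite nc_gt0; apply: contraTneq p0 => ->; by rewrite nc0 add0r ltxx.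
have [d0 d00 H0] := slit_open p0.
pose T (q : R[i]) : R := Im q / (nc q + Re q).
have cT : ccts_at (fun q => (T q)%:C) p.
  have -> : (fun q => (T q)%:C) = fun q => (Im q)%:C * ((nc q)%:C + (Re q)%:C)^-1.
    by apply/funext => q; rewrite rmorphM fmorphV rmorphD.
  apply: cctsM; first exact: ccts_Im.
  apply: (@ccts_comp _ (fun q => q^-1) (fun q => (nc q)%:C + (Re q)%:C)).
    by apply: cctsD; [exact: ccts_nc|exact: ccts_Re].
  by apply: cctsV; rewrite -rmorphD -nc_gt0 nc_real normr_gt0 gt_eqF.
have atanL (x y : R) : `|atan x - atan y| <= `|x - y|.
  wlog yx : x y / y <= x => [W|].
    by have [/W//|/ltW/W] := leP y x; rewrite distrC [X in _ <= X]distrC.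
  rewrite [X in _ <= X]ger0_norm ?subr_ge0 // -[X in _ <= X]mul1r.
  apply: (@derive_bound _ (@atan R) (fun x => (1 + x ^+ 2)^-1)) => // z _.
  rewrite ger0_norm ?invr_ge0 ?addr_ge0 ?sqr_ge0 //.
  by rewrite invf_le1 ?ltr_pwDl ?sqr_ge0 // lerDl sqr_ge0.
move=> e e0; have e2 : 0 < e / 2 by rewrite divr_gt0.
have e4 : 0 < e / 4 by rewrite divr_gt0.
have [d1 d10 H1] := cT _ e4.
have [d2 d20 H2] := ln_continuous_eps np e2.
have d22 : 0 < d2 / 2 by rewrite divr_gt0.
have [d3 d30 H3] := ccts_nc p d22.
exists (Num.min d0 (Num.min d1 d3)) => [|q]; first by rewrite !lt_min d00 d10.
rewrite !lt_min => /and3P[q0 q1 q3]; apply: le_trans (nc_ReIm _) _.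
rewrite (splitr e) !(cReD, cReN, cImD, cImN) /=; apply: lerD.
  apply: H2; have := H3 q q3; rewrite -rmorphB nc_real; lra.
rewrite carg_atan ?H0 // carg_atan // -mulrBr normrM ger0_norm //.
have := H1 q q1; rewrite -rmorphB nc_real -/(T q) -/(T p) => H.
have := atanL (T q) (T p); lra.
Qed.

(** Inverse function argument: the increment [eta] of the logarithm satisfies cexp eta = q / p and
    is small by continuity, so the derivative of [cexp] at 0 applies. *)
Lemma cdiff_clog p : 0 < nc p + Re p -> cdiff (@clog R) p p^-1.
Proof.
move=> p0 e e0.
have np : 0 < nc p.
  rewrite nc_gt0; apply: contraTneq p0 => ->; by rewrite nc0 add0r ltxx.
have pn : p != 0 by rewrite -nc_gt0.
(* The bound 1 / 2 lets [eta] be absorbed, giving nc eta <= 2 nc (q - p) / nc p; the other bound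
   then yields e * nc (q - p). *)
pose e' := Num.min (1 / 2) (e * nc p / 2).
have e'0 : 0 < e' by rewrite lt_min !(divr_gt0, mulr_gt0).
have e'1 : e' <= 1 / 2 by rewrite ge_min lexx.
have e'2 : e' <= e * nc p / 2 by rewrite ge_min lexx orbT.
have [d d0 H] := @cdiff_cexp0 R e' e'0.
have d2 : 0 < d / 2 by rewrite divr_gt0.
have [d1 d10 H1] := slit_open p0.
have [d3 d30 H3] := ccts_clog p0 d2.
exists (Num.min d1 d3) => [|q]; first by rewrite lt_min d10.
rewrite lt_min => /andP[q1 q3]; set eta := clog q - clog p.
have etad : nc (eta - 0) < d by rewrite subr0; have := H3 q q3; rewrite -/eta; lra.
have cE : cexp eta = q / p.
  have := cexpD eta (clog p); rewrite subrK (cexp_clog p0) cexp_clog ?H1 // => ->.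
  by rewrite mulfK.
have := H eta etad; rewrite cE cexp0 subr0 mul1r.
have -> : q / p - 1 - eta = (q - p) / p - eta by field.
set x := (q - p) / p => Hx.
have nx : nc x = nc (q - p) / nc p by rewrite ncM ncV.
have etax : nc eta <= 2 * nc x.
  have : nc eta <= nc x + nc (x - eta).
    have -> : eta = x - (x - eta) by ring.
    have -> : x - (x - (x - eta)) = x - eta by ring.
    exact: ncB.
  have h1 : e' * nc eta <= 1 / 2 * nc eta by rewrite ler_wpM2r ?nc_ge0.
  lra.
have -> : eta - p^-1 * (q - p) = - (x - eta) by rewrite /x; ring.
rewrite ncN; apply: le_trans Hx _.
apply: (@le_trans _ _ (e * nc p / 2 * (2 * nc x))).
  by apply: ler_pM => //; [exact: ltW|exact: nc_ge0].
by rewrite nx le_eqVlt; apply/orP; left; apply/eqP; field; rewrite gt_eqF.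
Qed.

Lemma slitV z : 0 < nc z + Re z -> 0 < nc z^-1 + Re z^-1.
Proof.
move=> z0; have nz : 0 < nc z.
  rewrite nc_gt0; apply: contraTneq z0 => ->; by rewrite nc0 add0r ltxx.
have -> : Re z^-1 = Re z / nc z ^+ 2 by rewrite nc_sqr; case: (z).
rewrite ncV; have -> : (nc z)^-1 + Re z / nc z ^+ 2 = (nc z + Re z) / nc z ^+ 2.
  by field; rewrite gt_eqF.
by rewrite divr_gt0 // exprn_gt0.
Qed.

Lemma cdiff_log_inv t : 0 < nc (1 - t) + Re (1 - t) ->
  cdiff (fun q => clog (1 - q)^-1) t (1 - t)^-1.
Proof.
move=> t0; have t1 : 1 - t != 0.
  by apply: contraTneq t0 => ->; rewrite nc0 add0r ltxx.
have H1 := cdiffB (cdiff_cst 1 t) (cdiff_id t).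
have H2 := cdiff_comp H1 (cdiffV t1).
have := cdiff_comp H2 (cdiff_clog (slitV t0)); congr cdiff.
by rewrite invrK; field.
Qed.

Lemma cdiff_log_term (r theta : R) t : 0 < r -> Re (t - r%:C) < nc (t - r%:C) ->
  exists A, cdiff (log_term r theta) t A.
Proof.
move=> r0 tr; have rn : r%:C != 0 :> R[i] by rewrite -nc_gt0 nc_real normr_gt0 gt_eqF.
have t1 : 0 < nc (1 - t / r%:C) + Re (1 - t / r%:C).
  have -> : 1 - t / r%:C = (r^-1)%:C * - (t - r%:C) by rewrite fmorphV; field.
  rewrite ncM nc_real gtr0_norm ?invr_gt0 // ncN cReM /= mul0r subr0 -mulrDr.
  by rewrite mulr_gt0 ?invr_gt0 // cReN subr_gt0.
have H := cdiffM (cdiff_id t) (cdiff_cst (r%:C)^-1 t).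
eexists; exact: (cdiffZ theta%:C (@cdiff_comp _ _ _ t _ _ H (cdiff_log_inv t1))).
Qed.

Lemma nc_lt1_slit t : nc t < 1 -> 0 < nc (1 - t) + Re (1 - t).
Proof.
move=> t1; apply: ltr_wpDl; first exact: nc_ge0.
by rewrite cReD cReN subr_gt0; have /andP[_] := Re_nc t; move=> h; exact: le_lt_trans h t1.
Qed.

(** Differentiating the Taylor remainder leaves the tail of a geometric series. The term k = 0 of
    the sum is 0, as x / 0 = 0. *)
Lemma cdiff_log_remainder z n p : nc (z * p) < 1 ->
  cdiff (fun q => clog (1 - z * q)^-1 - \sum_(k < n.+1) (z * q) ^+ k / k%:R) p
    (z * (z * p) ^+ n / (1 - z * p)).
Proof.
move=> zp; have Hz := cdiffM (cdiff_cst z p) (cdiff_id p).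
rewrite mul0r add0r mulr1 in Hz.
have zp1 : 1 - z * p != 0.
  by apply: contraTneq (nc_lt1_slit zp) => ->; rewrite nc0 add0r ltxx.
elim: n => [|n IHn].
  have -> : (fun q => clog (1 - z * q)^-1 - \sum_(k < 1) (z * q) ^+ k / k%:R) =
      fun q => clog (1 - z * q)^-1.
    by apply/funext => q; rewrite big_ord1 invr0 mulr0 subr0.
  have := cdiff_comp Hz (cdiff_log_inv (nc_lt1_slit zp)); congr cdiff.
  by rewrite expr0 mulr1 mulrC.
have Hx := cdiffZ (n.+1%:R)^-1 (cdiff_comp Hz (cdiffX (z * p) n.+1)).
have := cdiffB IHn Hx; congr cdiff.
  apply/funext => q; rewrite [in RHS]big_ord_recr /=; ring.
rewrite /= exprS -[n.+1%:R * _ * z]mulrA mulKf ?pnatr_eq0 //.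
by field.
Qed.

(** The Taylor remainder vanishes at 0 and [path_bound] integrates its derivative along the segment
    [0, z], z = q / r. For |z| < 1 / 2 this gives 4 / 2 ^ n. *)
Lemma series_log_term (r theta : R) : 0 < r ->
  series_near0 (log_term r theta) (fun k => (theta / k%:R * r ^- k)%:C).
Proof.
move=> r0; have rn : r%:C != 0 :> R[i] by rewrite -nc_gt0 nc_real normr_gt0 gt_eqF.
exists (r / 2) => [|q qr e e0]; first by rewrite divr_gt0.
pose z := q / r%:C; have nz : nc z < 1 / 2.
  rewrite ncM ncV nc_real gtr0_norm // ltr_pdivrMr //; lra.
pose C := `|theta| * 4.
have h2 : 0 <= (1 / 2 : R) < 1 by apply/andP; split; lra.
have C0 : 0 <= C by rewrite mulr_ge0.
have [N HN] := geometric_small h2 e0 C0; exists N.+1 => -[//|n nN].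
have -> : \sum_(k < n.+1) (theta / k%:R * r ^- k)%:C * q ^+ k - log_term r theta q =
    - (theta%:C * (clog (1 - z * 1)^-1 - \sum_(k < n.+1) (z * 1) ^+ k / k%:R)).
  rewrite /log_term mulr1 mulrBr opprB mulr_sumr; congr (_ - _); apply: eq_bigr => k _.
  rewrite 2!rmorphM 2!fmorphV rmorphXn rmorph_nat /z exprMn exprVn -!mulrA; congr (_ * _).
  by rewrite mulrC mulrAC mulrC.
rewrite ncN ncM nc_real.
pose F q := clog (1 - z * q)^-1 - \sum_(k < n.+1) (z * q) ^+ k / k%:R.
have F0 : F 0 = 0.
  rewrite /F mulr0 subr0 invr1 big_ord_recl /= invr0 mulr0 add0r big1 => [|k _].
    have c1 : carg (1 : R[i]) = 0.
      rewrite carg_atan; last by rewrite nc1 addr_gt0.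
      by rewrite [Im 1]/= mul0r atan0 mulr0.
    by rewrite subr0 /clog nc1 ln1 c1.
  by rewrite exprS !mul0r.
have zx (x : R) : 0 <= x <= 1 -> nc (z * x%:C) <= nc z.
  move=> /andP[x0 x1]; rewrite ncM nc_real ger0_norm // ler_piMr ?nc_ge0 //.
have := @path_bound F (fun x => z * (z * x%:C) ^+ n / (1 - z * x%:C)) 0 1 (2 * (1/2) ^+ n) ler01.
rewrite F0 !subr0 mulr1 => H.
apply: (@le_trans _ _ (`|theta| * (2 * (2 * (1 / 2) ^+ n)))); last first.
  have := HN n nN; rewrite /C; lra.
rewrite ler_wpM2l //; apply: H => x x01.
  apply: cdiff_log_remainder; have := zx x x01; lra.
have zx1 := zx x x01.
have n1 : 1 / 2 <= nc (1 - z * x%:C).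
  have : nc 1 <= nc (1 - z * x%:C) + nc (z * x%:C) by rewrite -{1}[1](subrK (z * x%:C)) ncD.
  rewrite nc1; lra.
rewrite ncM (ncM z) ncX (ncV (1 - _)) ler_pdivrMr; last by lra.
apply: (@le_trans _ _ (1 * (1 / 2) ^+ n)).
  apply: ler_pM; rewrite ?nc_ge0 ?exprn_ge0 ?nc_ge0 //; first by lra.
  by apply: lerXn2r; rewrite ?nnegrE ?nc_ge0 //; lra.
have : 0 <= (1 / 2 : R) ^+ n by rewrite exprn_ge0 //; lra.
nra.
Qed.

End Logarithm.

(** * Weights of the two classes *)

Section Classes.
Variable R : realType.
Notation nc := Normc.normc.
Notation Re := complex.Re.
Notation Im := complex.Im.
Implicit Types (f g : R[i] -> R[i]) (p q z w t a A : R[i]).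

Lemma has_power_series_near0 (f : R[i]^o -> R[i]^o) (c : nat -> R[i]^o) :
  has_power_series f c -> series_near0 f c.
Proof.
rewrite /has_power_series => /nbhsC[d d0 H]; exists d => // q qd e e0.
have := H q; rewrite subr0 => /(_ qd) /cvgrPdist_le /(_ e%:C).
rewrite ltcR => /(_ e0) [N _ HN]; exists N => n /HN /=.
by rewrite -opprB normrN lecR /series /= big_mkord.
Qed.

Lemma series_near0_eq f g u (d : R) : 0 < d -> (forall q, nc q < d -> f q = g q) ->
  series_near0 f u -> series_near0 g u.
Proof.
move=> d0 fg [d' d'0 H]; exists (Num.min d d'); first by rewrite lt_min d0.
by move=> q; rewrite lt_min => /andP[/fg <- /H].
Qed.

Lemma series_near0_cst a : series_near0 (fun=> a) (fun k => if k == 0%N then a else 0).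
Proof.
exists 1 => // q _ e e0; exists 1%N => -[//|n _].
rewrite big_ord_recl /= expr0 mulr1 big1 => [|i _]; last by rewrite mul0r.
by rewrite addr0 subrr nc0 ltW.
Qed.

(** Comparison with the integral, in telescoping form: the mean value theorem for x ^ (- g) bounds
    each term by a difference of consecutive values divided by g. *)
Lemma sum_inv_powR (g : R) : 0 < g ->
  exists S, forall N, \sum_(k < N) k.+1%:R `^ (-1 - g) <= S.
Proof.
move=> g0; exists (1 + g^-1) => N.
have key n : n.+2%:R `^ (-1 - g) <= g^-1 * (n.+1%:R `^ (- g) - n.+2%:R `^ (- g)) :> R.
  have [//|x xab|c /andP[c1 c2]] := @mean_value R (fun x : R => x `^ (- g))
      (fun x : R => - g * x `^ (- g - 1)) n.+1%:R n.+2%:R.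
  - by rewrite ler_nat.
  - have x0 : 0 < x by case/andP: xab => x1 _; apply: lt_le_trans x1; rewrite ltr0n.
    exact: is_derive1_powR.
  have -> : n.+2%:R - n.+1%:R = 1 :> R by rewrite -natrB // subSnn.
  rewrite mulr1 -opprB => /(congr1 -%R); rewrite !opprK mulNr opprK => ->.
  rewrite mulKf ?gt_eqF // [- g - 1]addrC.
  have c0 : 0 < c by apply: lt_le_trans c1; rewrite ltr0n.
  have -> : -1 - g = - (1 + g) by ring.
  rewrite !powRN lef_pV2 ?posrE ?powR_gt0 // ge0_ler_powR ?nnegrE //; lra.
have H n : \sum_(k < n.+1) k.+1%:R `^ (-1 - g) <= 1 + g^-1 * (1 - n.+1%:R `^ (- g)) :> R.
  elim: n => [|n IHn]; first by rewrite big_ord1 !powR1 subrr mulr0 addr0.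
  rewrite big_ord_recr /=; have := key n; lra.
case: N => [|n]; first by rewrite big_ord0 addr_ge0 // invr_ge0 ltW.
apply: le_trans (H n) _; rewrite lerD2l ler_piMr ?invr_ge0 ?(ltW g0) // gerBl powR_ge0.
Qed.

Lemma sum_le_eventually (f h : nat -> R) (C S : R) (N0 : nat) : 0 <= C ->
  (forall k, 0 <= f k) -> (forall k, 0 <= h k) ->
  (forall k, (N0 <= k)%N -> f k <= C * h k) -> (forall N, \sum_(k < N) h k <= S) ->
  forall N, \sum_(k < N) f k <= \sum_(k < N0) f k + C * S.
Proof.
move=> C0 f0 h0 fh hS N.
have H k : f k <= (if (k < N0)%N then f k else 0) + C * h k.
  by case: ltnP => [_|/fh]; rewrite ?add0r // lerDl mulr_ge0.
apply: (@le_trans _ _ (\sum_(k < N) ((if (k < N0)%N then f k else 0) + C * h k))).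
  by apply: ler_sum => k _; exact: H.
rewrite big_split /= -mulr_sumr.
apply: lerD; last by rewrite ler_wpM2l ?hS.
rewrite -big_mkcond /= -(big_mkord (fun k => (k < N0)%N) f) -(big_mkord xpredT f).
rewrite [leRHS](big_nat_widen _ _ (maxn N N0)) ?leq_maxr //.
rewrite [leLHS](big_nat_widen _ _ (maxn N N0)) ?leq_maxl //.
rewrite [leLHS]big_mkcond [leRHS]big_mkcond; apply: ler_sum => k _.
by case: (k < N0)%N; case: (k < N)%N => //=.
Qed.

Variables (Theta : nat -> R) (r theta : R).
Hypothesis r_gt0 : 0 < r.
Let e k := Theta k * r ^+ k - theta.

(** The bracket is a coefficient of [g - log_term]: the excess [e] is what remains of the weights
    once the logarithm is removed. *)
Lemma coef_excess k :
  e k.+1 / k.+1%:R = r ^+ k.+1 * (g_coef Theta k.+1 - theta / k.+1%:R * r ^- k.+1).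
Proof. by rewrite /e /g_coef; field; rewrite nat1r pnatr_eq0 gt_eqF // exprn_gt0. Qed.

Lemma class_eF_excess (gamma : R) : 0 < gamma ->
  formal_of_class (g_coef Theta) (class_eF r theta gamma) ->
  e @ \oo --> 0 /\ exists B, forall N, \sum_(k < N) `|e k.+1| / k.+1%:R <= B.
Proof.
move=> gamma0 [g [gs [g0 [gE _ [c [cs cO]]]]]].
have hg := series_near0B (has_power_series_near0 gs) (series_log_term theta r_gt0).
have cE : (fun k => (g_coef Theta k)%:C - (theta / k%:R * r ^- k)%:C) =1 c.
  apply: series_unique (has_power_series_near0 cs).
  apply: series_near0_eq r_gt0 _ hg => q qr.
  by rewrite gE // addrC addKr.
have [C C0 [N0 HC]] : exists2 C : R, 0 < C & exists N0, forall n, (N0 <= n)%N ->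
    nc (c n) <= C * (r ^- n * n%:R `^ (-1 - gamma)).
  move/eqO_exP: cO => [C0 /posC[-> c0] [N0 _ H]]; exists (Re C0) => //; exists N0 => n Nn.
  have := H n Nn; move=> h.
  have : (nc (c n))%:C <= ((Re C0) * nc (r ^- n * n%:R `^ (-1 - gamma))%:C)%:C.
    by rewrite rmorphM.
  by rewrite lecR nc_real ger0_norm // mulr_ge0 ?powR_ge0 // invr_ge0 exprn_ge0 // ltW.
have ek k : `|e k.+1| / k.+1%:R = r ^+ k.+1 * nc (c k.+1).
  rewrite -cE -rmorphB nc_real -[X in _ = X * _](gtr0_norm (exprn_gt0 k.+1 r_gt0)) -normrM.
  by rewrite -coef_excess normrM [X in _ = _ * X]ger0_norm.
have ekC k : (N0 <= k)%N -> `|e k.+1| / k.+1%:R <= C * k.+1%:R `^ (-1 - gamma).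
  move=> Nk; rewrite ek; have := HC k.+1 (leqW Nk).
  rewrite mulrCA => h; rewrite -ler_pdivlMl ?exprn_gt0 //.
split; last first.
  have [S HS] := sum_inv_powR gamma0; eexists.
  apply: (sum_le_eventually (ltW C0) _ _ ekC HS) => k; last exact: powR_ge0.
  by rewrite divr_ge0.
have ekC' k : (N0 <= k)%N -> `|e k.+1| <= C * k.+1%:R `^ (- gamma).
  move=> /ekC; rewrite ler_pdivrMr // => /le_trans; apply.
  rewrite -mulrA ler_wpM2l ?(ltW C0) // -[X in _ * X]powRr1 // -powRD; last first.
    by rewrite pnatr_eq0 implybT.
  by rewrite (_ : -1 - gamma + 1 = - gamma) //; ring.
apply/cvgrPdist_le => eps eps0; pose M := (C / eps) `^ gamma^-1.
near=> k; rewrite sub0r normrN.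
have k0 : (0 < k)%N by near: k; exists 1%N.
have kN : (N0 <= k.-1)%N by rewrite -ltnS prednK //; near: k; exists N0.+1.
have Mk : M <= k%:R by near: k; exact: nbhs_infty_ger.
have := ekC' _ kN; rewrite prednK // => /le_trans; apply.
rewrite powRN ler_pdivrMr ?powR_gt0 ?ltr0n // mulrC -ler_pdivrMr //.
have -> : C / eps = M `^ gamma.
  by rewrite -powRrM mulVf ?gt_eqF // powRr1 // divr_ge0 // ltW.
by rewrite ge0_ler_powR ?nnegrE ?powR_ge0 // ltW.
Unshelve. all: by end_near. Qed.
End Classes.

(** * Boundedness of the derivative up to the circle *)

Section SlitDisc.
Variable R : realType.
Notation nc := Normc.normc.
Notation Re := complex.Re.
Notation Im := complex.Im.
Implicit Types (f g G : R[i] -> R[i]) (p q z w t a A : R[i]).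
Variables (r rho c : R).
Hypotheses (r_gt0 : 0 < r) (r_rho : r < rho) (c_gt0 : 0 < c).

(** For c = cos phi the second condition says that the argument of q - r exceeds phi in absolute
    value, in a form suited to estimates; being strict, it also excludes q = r. *)
Definition slit_disc q := nc q < rho /\ Re (q - r%:C) < c * nc (q - r%:C).

Lemma slit_discW q : nc q <= r -> q != r%:C -> slit_disc q.
Proof.
move=> qr qn; split; first exact: le_lt_trans r_rho.
apply: (@le_lt_trans _ _ 0).
  rewrite cReD cReN /= subr_le0; have /andP[_] := Re_nc q; move=> h; exact: le_trans h qr.
by rewrite mulr_gt0 // nc_gt0 subr_eq0.
Qed.

Lemma slit_disc_open p : slit_disc p ->
  exists2 d : R, 0 < d & forall q, nc (q - p) < d -> slit_disc q.
Proof.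
move=> [p1 p2].
have [||d1 d10 H1] := @ccts_pos _ (fun q => rho - nc q) p.
- have -> : (fun q => (rho - nc q)%:C) = fun q => rho%:C - (nc q)%:C :> R[i].
    by apply/funext => q; rewrite rmorphB.
  apply: cctsD; first exact: ccts_cst.
  have -> : (fun q => - (nc q)%:C) = fun q => -1 * (nc q)%:C :> R[i].
    by apply/funext => q; rewrite mulN1r.
  by apply: cctsM; [exact: ccts_cst|exact: ccts_nc].
- by rewrite subr_gt0.
have cpr : ccts_at (fun q : R[i] => q - r%:C) p.
  by apply: cctsD; [exact: ccts_id|exact: ccts_cst].
have [||d2 d20 H2] := @ccts_pos _ (fun q => c * nc (q - r%:C) - Re (q - r%:C)) p.
- have -> : (fun q => (c * nc (q - r%:C) - Re (q - r%:C))%:C) =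
      fun q : R[i] => c%:C * (nc (q - r%:C))%:C + -1 * (Re (q - r%:C))%:C.
    by apply/funext => q; rewrite rmorphB rmorphM mulN1r.
  apply: cctsD; apply: cctsM; try exact: ccts_cst.
    by apply: (@ccts_comp _ (fun q => (nc q)%:C) (fun q => q - r%:C)) => //; exact: ccts_nc.
  by apply: (@ccts_comp _ (fun q => (Re q)%:C) (fun q => q - r%:C)) => //; exact: ccts_Re.
- by rewrite subr_gt0.
exists (Num.min d1 d2) => [|q]; first by rewrite lt_min d10.
by rewrite lt_min => /andP[/H1 h1 /H2 h2]; split; rewrite -subr_gt0.
Qed.

Variables (G : R[i] -> R[i]) (C d0 : R).
Hypothesis G_cdiff : forall q, slit_disc q -> exists A, cdiff G q A.
Hypotheses (d0_gt0 : 0 < d0) (C_ge0 : 0 <= C).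
Hypothesis G_vertex : forall q, slit_disc q -> nc (q - r%:C) < d0 -> nc (G q) <= C * nc (q - r%:C).

(* At distance [s] from the vertex [r], the slit disc contains a disc of radius
   [c / (1 + c) * s]: on it [G] is [O(s)], whence a bounded derivative. *)
Lemma derivative_bounded_vertex : exists2 d : R, 0 < d & exists M : R,
  forall q, nc q < r -> nc (q - r%:C) < d -> forall A, cdiff G q A -> nc A <= M.
Proof.
pose k := c / (1 + c).
have c1 : 0 < 1 + c by rewrite addr_gt0.
have k0 : 0 < k by rewrite divr_gt0.
have k1 : k < 1 by rewrite ltr_pdivrMr //; lra.
(* The value of [k] balances two bounds: for q' within k s of q, Re (q' - r) < k s because Re (q -
   r) < 0, and nc (q' - r) >= (1 - k) s. *)
have kc : k = c * (1 - k) by rewrite /k; field; rewrite gt_eqF.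
(* Such q' satisfy nc (q' - r) <= 2 s < d0 and nc q' < r + s < rho. *)
exists (Num.min (d0 / 2) (rho - r)); first by rewrite lt_min divr_gt0 //= subr_gt0.
exists (16 * C / k) => q qr; rewrite lt_min => /andP[q1 q2] A GA.
set s := nc (q - r%:C) in q1 q2.
have s0 : 0 < s.
  rewrite nc_gt0 subr_eq0; apply: contraTneq qr => ->.
  by rewrite nc_real gtr0_norm // ltxx.
have ks : 0 < k * s by rewrite mulr_gt0.
have kss : k * s < s by rewrite gtr_pMl.
have qrE q' : q' - r%:C = (q' - q) + (q - r%:C) by ring.
have near q' : nc (q' - q) <= k * s -> slit_disc q' /\ nc (q' - r%:C) <= 2 * s.
  move=> q'q; split; last by rewrite qrE; apply: le_trans (ncD _ _) _; rewrite -/s; lra.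
  split.
    have := ncD (q' - q) q; rewrite subrK; lra.
  have h1 : Re (q' - r%:C) < k * s.
    rewrite qrE cReD; have /andP[_ h] := Re_nc (q' - q).
    have /andP[_ h'] := Re_nc q; rewrite [Re (q - _)]cReD cReN /=; lra.
  have h2 : s - k * s <= nc (q' - r%:C).
    have := ncB (q' - r%:C) (q' - q).
    have -> : q' - r%:C - (q' - q) = q - r%:C by ring.
    rewrite -/s; lra.
  apply: lt_le_trans h1 _; rewrite [X in X * s]kc -mulrA ler_wpM2l ?(ltW c_gt0) //.
  by rewrite mulrBl mul1r.
have := @cauchy_derivative_bound _ G q A (C * (2 * s)) (k * s) ks _ GA _.
have -> : 8 * (C * (2 * s)) / (k * s) = 16 * C / k by field; rewrite !gt_eqF.
apply=> q' /near [sd q's]; first exact: G_cdiff.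
apply: le_trans (G_vertex sd _) _; first by move: q1; lra.
by rewrite ler_wpM2l.
Qed.

Lemma derivative_bounded_local p : nc p <= r -> exists2 d : R, 0 < d & exists M : R,
  forall q, nc q < r -> nc (q - p) < d -> forall A, cdiff G q A -> nc A <= M.
Proof.
move=> pr; have [->|pn] := eqVneq p r%:C; first exact: derivative_bounded_vertex.
have sp := slit_discW pr pn; have [d1 d10 H1] := slit_disc_open sp.
have [A GA] := G_cdiff sp; have [d2 d20 H2] := cdiff_ccts GA ltr01.
pose d := Num.min d1 d2; have d0' : 0 < d by rewrite lt_min d10.
have d3 : 0 < d / 3 by rewrite divr_gt0.
exists (d / 2); first by rewrite divr_gt0.
exists (8 * (nc (G p) + 1) / (d / 3)) => q _ qp B GB.
have near q' : nc (q' - q) <= d / 3 -> nc (q' - p) < d1 /\ nc (q' - p) < d2.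
  move=> q'q; apply/andP; rewrite -lt_min.
  have := ncD (q' - q) (q - p); rewrite addrA subrK -/d; lra.
apply: cauchy_derivative_bound GB _ => // q' /near[h1 h2]; first exact/G_cdiff/H1.
have := ncD (G q' - G p) (G p); rewrite subrK; have := H2 q' h2; lra.
Qed.

(** Local bounds are combined by bisecting the square around the disc. Around a point outside the
    closed disc, small rectangles do not meet the open disc and any bound works. *)
Lemma derivative_bounded :
  exists M : R, forall q, nc q < r -> forall A, cdiff G q A -> nc A <= M.
Proof.
pose P (x y w h : R) := exists M : R, forall q, x <= Re q <= x + w -> y <= Im q <= y + h ->
  nc q < r -> forall A, cdiff G q A -> nc A <= M.
have r2 : 0 <= 2 * r by rewrite mulr_ge0 // ltW.
have : P (- r) (- r) (2 * r) (2 * r).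
  apply: bisection => //.
    move=> x y w h [M1 H1] [M2 H2] [M3 H3] [M4 H4].
    exists (Num.max (Num.max M1 M2) (Num.max M3 M4)) => q /andP[x1 x2] /andP[y1 y2] qr A GA.
    rewrite !le_max; case: (leP (Re q) (x + w / 2)) => x3; case: (leP (Im q) (y + h / 2)) => y3.
    - by rewrite (H1 q) ?x1 ?y1.
    - by rewrite (H3 q) ?orbT ?x1 //; apply/andP; split; lra.
    - by rewrite (H2 q) ?orbT ?y1 //; apply/andP; split; lra.
    - by rewrite (H4 q) ?orbT //; apply/andP; split; lra.
  move=> px py _ _; have [pr|rp] := leP (nc (px +i* py)) r; last first.
    exists (nc (px +i* py) - r) => [|x y w h w0 h0 _ _ _ _ /andP[x1 x2] /andP[y1 y2] wh].
      by rewrite subr_gt0.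
    exists 0 => q /andP[x3 x4] /andP[y3 y4] qr; exfalso.
    have := nc_ReIm (q - (px +i* py)); rewrite !(cReD, cReN, cImD, cImN) /=.
    have : `|Re q - px| <= w by rewrite ler_norml; apply/andP; split; lra.
    have : `|Im q - py| <= h by rewrite ler_norml; apply/andP; split; lra.
    have := ncB q (q - (px +i* py)); rewrite subKr.
    lra.
  have [d d0' [M HM]] := derivative_bounded_local pr.
  exists d => // x y w h w0 h0 _ _ _ _ /andP[x1 x2] /andP[y1 y2] wh.
  exists M => q /andP[x3 x4] /andP[y3 y4] qr; apply: HM => //.
  have := nc_ReIm (q - (px +i* py)); rewrite !(cReD, cReN, cImD, cImN) /=.
  have : `|Re q - px| <= w by rewrite ler_norml; apply/andP; split; lra.
  have : `|Im q - py| <= h by rewrite ler_norml; apply/andP; split; lra.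
  lra.
move=> [M HM]; exists M => q qr; apply: HM => //.
  have := nc_Re q; rewrite ler_norml => /andP[]; move=> ??; apply/andP; split; lra.
have := nc_Im q; rewrite ler_norml => /andP[]; move=> ??; apply/andP; split; lra.
Qed.

End SlitDisc.

Section DerivativeCoefficients.
Variable R : realType.
Notation nc := Normc.normc.
Notation Re := complex.Re.
Notation Im := complex.Im.
Variables (G : R[i] -> R[i]) (u : nat -> R[i]) (r M : R).
Hypothesis r_gt0 : 0 < r.
Hypothesis G_cdiff : forall q, nc q < r -> exists A, cdiff G q A.
Hypothesis G_deriv : forall q, nc q < r -> forall A, cdiff G q A -> nc A <= M.
Hypothesis G_series : series_near0 G u.

(** The arc from [q] to [q * cis h] stays in the disc and has speed nc q < r. The angle is extended
    to a complex variable so that [path_bound] applies; the 2 comes from there. *)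
Lemma rotation_increment q (h : R) : nc q < r -> 0 <= h ->
  nc (G (q * cis h) - G q) <= 2 * (M * r) * h.
Proof.
move=> qr h0; have iy (y : R) : 'i%C * y%:C = 0 +i* y :> R[i].
  by apply: complex_eq; rewrite ?cReM ?cImM /=; ring.
have nq y : nc (q * cis y) < r by rewrite ncM nc_cis mulr1.
have [A HA] := choice (fun y => G_cdiff (nq y)).
pose f z := G (q * cexp ('i%C * z)).
have := @path_bound _ f (fun y => A y * (q * (cis y * 'i%C))) 0 h (M * r) h0.
rewrite subr0 /f !iy -!/(cis _) cis0 mulr1; apply=> y _.
  have H1 := cdiffZ 'i%C (cdiff_id y%:C).
  have := cdiffZ q (cdiff_comp H1 (cdiff_cexp ('i%C * y%:C))).
  rewrite iy -/(cis _) mulr1 => H2; apply: cdiff_comp H2 _.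
  by rewrite iy; exact: HA.
rewrite !ncM nc_cis nci !mulr1; apply: ler_pM; rewrite ?nc_ge0 ?(ltW qr) //.
exact: G_deriv (nq y) _ (HA y).
Qed.

Lemma one_subX_ge (x : R) n : 0 <= x <= 1 -> 1 - n%:R * x <= (1 - x) ^+ n.
Proof.
move=> /andP[x0 x1]; elim: n => [|n IHn]; first by rewrite mul0r subr0.
have h : (1 - n%:R * x) * (1 - x) <= (1 - x) ^+ n * (1 - x).
  by rewrite ler_wpM2r // subr_ge0.
rewrite exprSr; apply: le_trans h; rewrite -subr_ge0 -[n.+1%:R]natr1.
have -> : (1 - n%:R * x) * (1 - x) - (1 - (n%:R + 1) * x) = n%:R * x ^+ 2 by ring.
by rewrite mulr_ge0 // sqr_ge0.
Qed.

(* Bessel's inequality for [q |-> G (q * cis h) - G q], whose k-th coefficient is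
   [u k * (cis (k * h) - 1)], and whose modulus is at most [2 * M * r * h]. *)
Lemma derivative_coef_sum N (s : R) : 0 < s -> s < r ->
  \sum_(k < N) (k%:R * nc (u k) * s ^+ k) ^+ 2 <= (4 * (M * r)) ^+ 2.
Proof.
move=> s0 sr; have half0 : 0 < 1 / 2 :> R by rewrite divr_gt0.
have [d d0 Hd] := real_derive_eps (is_derive_sin (0 : R)) half0.
have sinH (x : R) : 0 <= x < d -> x / 2 <= sin x.
  move=> /andP[x0 xd]; have := Hd x; rewrite ger0_norm // => /(_ xd).
  rewrite add0r sin0 cos0 subr0 mul1r ler_norml => /andP[]; lra.
(* A single small angle suffices for given N: k h < d for all k < N, so |cis (k h) - 1| >= sin (k h)
   >= k h / 2. Dividing by (h / 2) ^ 2 removes [h] from the bound. *)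
pose h := d / (N.+1)%:R.
have h0 : 0 < h by rewrite divr_gt0.
have kh k : (k < N)%N -> 0 <= k%:R * h < d.
  move=> kN; rewrite mulr_ge0 ?(ltW h0) //= /h mulrCA gtr_pMr // ltr_pdivrMr // mul1r.
  by rewrite ltr_nat ltnW.
have H1 q : nc q < r -> exists A, cdiff (fun q => G (q * cis h) - G q) q A.
  move=> qr; have [|A HA] := @G_cdiff (q * cis h); first by rewrite ncM nc_cis mulr1.
  have [B HB] := G_cdiff qr.
  have H := cdiffM (cdiff_id q) (cdiff_cst (cis h) q).
  by eexists; exact: cdiffB (cdiff_comp H HA) HB.
have le1 : \sum_(k < N) (nc (u k * cis h ^+ k - u k) * s ^+ k) ^+ 2 <= (2 * (M * r) * h) ^+ 2.
  apply: (@bessel _ (fun q => G (q * cis h) - G q) (fun k => u k * cis h ^+ k - u k) r) => //.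
    exact: (series_near0B (series_near0_rotate (nc_cis h) G_series)).
  by move=> q qr; exact: rotation_increment (ltW h0).
have : \sum_(k < N) (k%:R * nc (u k) * s ^+ k) ^+ 2 * (h / 2) ^+ 2 <= (2 * (M * r) * h) ^+ 2.
  apply: le_trans le1; apply: ler_sum => k _; rewrite -exprMn.
  have k_s := exprn_ge0 k (ltW s0).
  apply: lerXn2r; rewrite ?nnegrE;
    [by rewrite !mulr_ge0 ?nc_ge0 ?invr_ge0 ?(ltW d0)|by rewrite mulr_ge0 ?nc_ge0|].
  have -> : u k * cis h ^+ k - u k = u k * (cis h ^+ k - 1) by ring.
  rewrite ncM cisX.
  have -> : k%:R * nc (u k) * s ^+ k * (h / 2) = nc (u k) * (k%:R * h / 2) * s ^+ k by ring.
  rewrite ler_wpM2r // ler_wpM2l ?nc_ge0 //.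
  apply: le_trans (sinH _ (kh _ (ltn_ord k))) _.
  have := nc_Im (cis (k%:R * h) - 1); rewrite cImD cImN cisE /= subr0.
  by move=> /(le_trans (ler_norm _)).
have -> : (2 * (M * r) * h) ^+ 2 = (4 * (M * r)) ^+ 2 * (h / 2) ^+ 2 by field.
by rewrite -mulr_suml ler_pM2r // exprn_gt0 // divr_gt0.
Qed.

(** The interior bound does not depend on [s], so [s] may depend on N. With s = r (1 - x) and x = 1
    / (2 (N + 1)), Bernoulli's inequality gives r ^ k <= 2 s ^ k for k < N, hence the factor 4. *)
Lemma derivative_coef_sum_boundary N :
  \sum_(k < N) (k%:R * nc (u k) * r ^+ k) ^+ 2 <= 4 * (4 * (M * r)) ^+ 2.
Proof.
pose x : R := (2 * N.+1%:R)^-1.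
have x0 : 0 < x by rewrite invr_gt0 mulr_gt0.
have x1 : x <= 1 / 2.
  by rewrite /x invfM mul1r ler_piMr // invf_le1 // ler1n.
pose s := r * (1 - x).
have s0 : 0 < s by rewrite mulr_gt0 // subr_gt0; lra.
have sr : s < r by rewrite gtr_pMr //; lra.
have sk k : (k < N)%N -> r ^+ k <= 2 * s ^+ k.
  move=> kN; rewrite /s exprMn mulrCA ler_peMr ?exprn_ge0 ?(ltW r_gt0) //.
  have kx : k%:R * x <= 1 / 2.
    rewrite /x invfM mulrCA mul1r ler_piMr // ler_pdivrMr // mul1r ler_nat.
    by rewrite ltnW // ltnW.
  have := @one_subX_ge x k; rewrite (ltW x0) => /(_ _); rewrite (_ : x <= 1); last by lra.
  by move=> /(_ isT); lra.
apply: (@le_trans _ _ (\sum_(k < N) 4 * (k%:R * nc (u k) * s ^+ k) ^+ 2)); last first.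
  by rewrite -mulr_sumr ler_wpM2l // derivative_coef_sum.
apply: ler_sum => k _; have -> : 4 * (k%:R * nc (u k) * s ^+ k) ^+ 2 =
    (k%:R * nc (u k) * (2 * s ^+ k)) ^+ 2 by ring.
have h := sk k (ltn_ord k); have h1 : 0 <= k%:R * nc (u k) by rewrite mulr_ge0 ?nc_ge0.
have h2 : 0 <= r ^+ k by rewrite exprn_ge0 // ltW.
apply: lerXn2r; rewrite ?nnegrE; [by rewrite mulr_ge0|by rewrite mulr_ge0 ?(le_trans h2 h)|].
by rewrite ler_wpM2l.
Qed.

End DerivativeCoefficients.

(** * Weights of class F *)

Section ClassF.
Variable R : realType.
Notation nc := Normc.normc.
Notation Re := complex.Re.
Notation Im := complex.Im.
Variables (Theta : nat -> R) (r theta : R).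
Hypothesis r_gt0 : 0 < r.
Let e k := Theta k * r ^+ k - theta.

Lemma slit_disc_Delta0 (rho phi : R) q : 0 < phi < pi / 2 ->
  slit_disc r rho (cos phi) q -> Delta0 r rho phi q.
Proof.
move=> /andP[phi0 phi2] [q1 q2].
have qn : 0 < nc (q - r%:C).
  rewrite nc_gt0; apply: contraTneq q2 => ->.
  by rewrite nc0 mulr0 ltxx.
split=> //; first by rewrite -subr_eq0 -nc_gt0.
rewrite abs_carg; set x := Re _ / _.
have x1 : -1 <= x <= 1.
  by rewrite /x ler_pdivlMr // ler_pdivrMr // mul1r mulN1r Re_nc.
have : x < cos phi by rewrite ltr_pdivrMr.
rewrite -{1}[x](@acosK R) ?in_itv // ltr_cos // in_itv /= ?acos_ge0 ?acos_lepi //.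
by apply/andP; split; [exact: ltW|have := @pi_gt0 R; lra].
Qed.

Lemma class_F_excess : formal_of_class (g_coef Theta) (class_F r theta) ->
  e @ \oo --> 0 /\ exists B, forall N, \sum_(k < N) `|e k.+1| / k.+1%:R <= B.
Proof.
move=> [g [gs [rho [phi [r_rho phi_bd g_hol [K gO]]]]]].
pose c := cos phi; have c0 : 0 < c.
  by apply: cos_gt0_pihalf; case/andP: phi_bd => phi0 ->; rewrite andbT; have := @pi_gt0 R; lra.
pose G (q : R[i]) : R[i] := g q - log_term r theta q - K.
have G_cdiff q : slit_disc r rho c q -> exists A, cdiff G q A.
  move=> sq; have qD := slit_disc_Delta0 phi_bd sq.
  have [A gA] := derivable_cdiff (g_hol q qD).
  have [|B lB] := @cdiff_log_term R r theta q r_gt0.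
    case: sq => _ /lt_le_trans; apply; rewrite ler_piMl ?nc_ge0 // cos_le1 //.
  by eexists; exact: cdiffB (cdiffB gA lB) (cdiff_cst K q).
have [C [d [C0 d0 HC]]] : exists C d : R, [/\ 0 <= C, 0 < d &
    forall q, slit_disc r rho c q -> nc (q - r%:C) < d -> nc (G q) <= C * nc (q - r%:C)].
  move/eqO_exP: gO => [C0 /posC[-> C0_gt0]]; rewrite nearE /within /= => /nbhsC[d d0 H].
  exists (Re C0), d; split=> //; first exact: ltW.
  move=> q sq qd; have := H q qd (slit_disc_Delta0 phi_bd sq).
  have -> : g q - (log_term r theta q + K) = G q by rewrite /G opprD addrA.
  move=> h; have : (nc (G q))%:C <= (Re C0 * nc (q - r%:C))%:C by rewrite rmorphM.
  by rewrite lecR.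
have [M HM] := derivative_bounded r_gt0 r_rho c0 G_cdiff d0 C0 HC.
have G_cdiff' q : nc q < r -> exists A, cdiff G q A.
  move=> qr; apply/G_cdiff/slit_discW => //; first exact: ltW.
  by apply: contraTneq qr => ->; rewrite nc_real gtr0_norm // ltxx.
(* The constant [K] alters only the coefficient of index 0, so [u k.+1] is still governed by
   [coef_excess]. *)
pose u k : R[i] := (g_coef Theta k)%:C - (theta / k%:R * r ^- k)%:C - (if k == 0%N then K else 0).
have Gs : series_near0 G u.
  exact: series_near0B (series_near0B (has_power_series_near0 gs)
    (series_log_term theta r_gt0)) (series_near0_cst K).
have := derivative_coef_sum_boundary r_gt0 G_cdiff' HM Gs.
set S := 4 * _ => HS.
have ek k : `|e k.+1| = k.+1%:R * nc (u k.+1) * r ^+ k.+1.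
  rewrite /u subr0 -rmorphB nc_real.
  have -> : e k.+1 = k.+1%:R * (r ^+ k.+1 * (g_coef Theta k.+1 - theta / k.+1%:R * r ^- k.+1)).
    by rewrite -coef_excess // mulrCA divff ?pnatr_eq0 // mulr1.
  by rewrite !normrM [`|_%:R|]ger0_norm // [`|r ^+ _|]gtr0_norm ?exprn_gt0 //; ring.
have sq_sum N : \sum_(k < N) e k.+1 ^+ 2 <= S.
  apply: le_trans (HS N.+1); rewrite big_ord_recl /= -[leLHS]add0r.
  apply: lerD; first exact: sqr_ge0.
  by apply: ler_sum => k _; rewrite -[e _ ^+ 2]real_normK ?num_real // ek.
split; last first.
  (* Termwise, |e k| / k <= e k ^ 2 + 1 / k ^ 2, and the second series is the power sum with
     exponent -1 - 1. *)
  have [S' HS'] := @sum_inv_powR R 1 ltr01; exists (S + S') => N.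
  apply: le_trans (lerD (sq_sum N) (HS' N)); rewrite -big_split /=.
  apply: ler_sum => k _; have -> : k.+1%:R `^ (-1 - 1) = (k.+1%:R^-1) ^+ 2 :> R.
    by rewrite (_ : -1 - 1 = - 2%:R) ?powRN ?powR_mulrn ?exprVn //; ring.
  rewrite -[e _ ^+ 2]real_normK ?num_real //.
  have : 0 <= `|e k.+1| by []; have : 0 <= k.+1%:R^-1 :> R by rewrite invr_ge0.
  move: `|_| => x; move: _^-1 => y; nra.
apply/cvgrPdist_le => eps eps0.
(* A tail of the convergent series of squares below eps ^ 2 bounds each of its terms, so |e k| <=
   eps eventually. *)
have [n0 Hn0] := partial_sums_tail (fun k => sqr_ge0 (e k.+1)) sq_sum (exprn_gt0 2 eps0).
exists n0.+1 => // -[//|k] /= nk; rewrite sub0r normrN.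
rewrite -(@ler_pXn2r _ 2) ?nnegrE ?(ltW eps0) // real_normK ?num_real //.
apply: le_trans (Hn0 k.+1 (leqW nk)); rewrite big_nat_recr //= lerDr.
by apply: sumr_ge0 => j _; exact: sqr_ge0.
Qed.

End ClassF.

Local Close Scope complex_scope.
Local Close Scope classical_set_scope.

Theorem theorem4p2 (R : realType) (Theta : nat -> R) (r theta gamma : R)
    (Theta_ge0 : forall m : nat, (1 <= m)%N -> 0 <= Theta m)
    (r_gt0 : 0 < r) (theta_gt0 : 0 < theta) (gamma_bounds : 0 < gamma <= 1)
    (Theta_class :
      formal_of_class (g_coef Theta) (class_F r theta) \/
      formal_of_class (g_coef Theta) (class_eF r theta gamma)) :
  cvg_in_distribution
    (fun (n : nat) (x : R) => perm_prob Theta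
       [set s : 'S_n | ((total_cycles s)%:R - theta * ln n%:R)
                         / Num.sqrt (theta * ln n%:R) <= x]%SET)
    (normal_prob 0 1).
Proof.
pose e k := Theta k * r ^+ k - theta.
have [e_cvg0 [B eB]] : (e @ \oo --> (0 : R))%classic /\
    exists B, forall N, \sum_(k < N) `|e k.+1| / k.+1%:R <= B.
  case: Theta_class => [hF|heF]; first exact: class_F_excess.
  by case/andP: gamma_bounds => gamma_gt0 _; exact: class_eF_excess heF.
(* Only indices from 1 on are constrained: the value of [Theta] at 0 is arbitrary and no cycle has
   length 0. *)
have e_ge k : 0 <= theta + e k.+1.
  by rewrite addrC subrK mulr_ge0 ?Theta_ge0 // exprn_ge0 // ltW.
have eE : (fun k => theta + e k) = fun k => Theta k * r ^+ k.
  by apply/funext => k; rewrite addrC subrK.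
move=> x _; have := @expoly_cdf_limit R theta e B theta_gt0 eB e_cvg0 e_ge x; rewrite eE.
apply: cvg_trans; apply: near_eq_cvg; apply: nearW => n.
by rewrite (@perm_prob_expectation R Theta r r_gt0 n (fun s => standardized theta n s <= x)).
Qed.
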